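(* Let $(X,d,\mathfrak{m})$ be a metric measure space satisfying one of the following: (a) $(X,d,\mathfrak{m})$ is a very strict $CD(K,N)$-space for some $K\in\mathbb{R}$, $N\in(1,\infty)$; (b) $(X,d,\mathfrak{m})$ is an essentially non-branching $MCP(K,N)$-space for some $K\in\mathbb{R}$, $N\in(1,\infty)$; (c) $(X,d,\mathfrak{m})$ is essentially non-branching and qualitatively non-degenerate. Suppose that there exist a point $x\in X$ and $r>0$ such that the ball $B(x,r)$ is isometric to an open interval in $\mathbb{R}$. Then $X$ is a one-dimensional manifold, possibly with boundary.
   Context: Standing conventions. A metric measure space $(X,d,\mathfrak{m})$ is a complete, locally compact and separable length space $(X,d)$ (hence geodesic) equipped with a locally finite Borel measure $\mathfrak{m}$ with $\operatorname{spt}\mathfrak{m}=X$. $B(x,r)$ denotes the open ball. $\mathrm{Geo}(X)$ is the space of constant speed, length minimising geodesics $\gamma:[0,1]\to X$, with the supremum distance; $e_t:\mathrm{Geo}(X)\to X$, $e_t(\gamma)=\gamma_t$; for $0\le s<t\le 1$, $\mathrm{restr}_s^t:\mathrm{Geo}(X)\to\mathrm{Geo}(X)$ is $\mathrm{restr}_s^t(\gamma)_u=\gamma_{(1-u)s+ut}$. $\mathcal{P}(X)$ is the set of Borel probability measures on $X$; $\mathcal{P}_2(X)$ is the set of those with finite second moment; $\mathcal{P}_2^{ac}(X)$ is the set of $\mu\in\mathcal{P}_2(X)$ absolutely continuous with respect to $\mathfrak{m}$. For $\mu_0,\mu_1\in\mathcal{P}_2(X)$, $\mathrm{Opt}(\mu_0,\mu_1)$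 is the set of minimisers of $\int d^2(x,y)\,d\sigma(x,y)$ among all $\sigma\in\mathcal{P}(X\times X)$ with first marginal $\mu_0$ and second marginal $\mu_1$, and $\mathrm{OptGeo}(\mu_0,\mu_1)$ is the set of $\pi\in\mathcal{P}(\mathrm{Geo}(X))$ with $(e_0,e_1)_\#\pi\in\mathrm{Opt}(\mu_0,\mu_1)$. Distortion coefficients. For $K\in\mathbb{R}$, $N\in(1,\infty)$, $t\in[0,1]$, $\theta\ge0$, put $\tau_{K,N}^{(t)}(\theta)=t^{1/N}\big(\sigma_{K,N-1}^{(t)}(\theta)\big)^{(N-1)/N}$, where $\sigma_{K,N-1}^{(t)}(\theta)$ equals $+\infty$ if $K\theta^2\ge(N-1)\pi^2$; $\frac{\sin(t\theta\sqrt{K/(N-1)})}{\sin(\theta\sqrt{K/(N-1)})}$ if $0<K\theta^2<(N-1)\pi^2$; $t$ if $K\theta^2=0$; $\frac{\sinh(t\theta\sqrt{-K/(N-1)})}{\sinh(\theta\sqrt{-K/(N-1)})}$ if $K\theta^2<0$. Very strict $CD(K,N)$: for all $\mu_0,\mu_1\in\mathcal{P}_2^{ac}(X)$ there exists $\pi\in\mathrm{OptGeo}(\mu_0,\mu_1)$ such that for every bounded Borel $F:\mathrm{Geo}(X)\to[0,\infty)$ with $\int F\,d\pi=1$ and all $0\le t_1<t_2\le1$, the plan $\tilde\pi=(\mathrm{restr}_{t_1}^{t_2})_\#(F\pi)$ satisfies, for all $t\in[0,1]$ and $N'\ge N$, $$\int_X\rho_t^{1-1/N'}\,d\mathfrak{m}\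 \ge\ \int\Big[\tau_{K,N'}^{(1-t)}(d(\gamma_0,\gamma_1))\,\rho_0(\gamma_0)^{-1/N'}+\tau_{K,N'}^{(t)}(d(\gamma_0,\gamma_1))\,\rho_1(\gamma_1)^{-1/N'}\Big]d\tilde\pi(\gamma),$$ where $\rho_s$ is the density of the absolutely continuous part of $(e_s)_\#\tilde\pi$ with respect to $\mathfrak{m}$ (with $\rho_s^{-1/N'}:=0$ on the singular part). $MCP(K,N)$: for every $o\in X$ and every Borel set $A\subset X$ with $0<\mathfrak{m}(A)<\infty$ and $\mu_0:=\mathfrak{m}|_A/\mathfrak{m}(A)\in\mathcal{P}_2(X)$ (and $A\subset B(o,\pi\sqrt{(N-1)/K})$ if $K>0$) there is $\pi\in\mathrm{OptGeo}(\mu_0,\delta_o)$ such that for all $t\in[0,1]$, $\frac{1}{\mathfrak{m}(A)}\mathfrak{m}\ge(e_t)_\#\big(\tau_{K,N}^{(1-t)}(d(\gamma_0,\gamma_1))^N\,\pi(d\gamma)\big)$. Essentially non-branching: for all $\mu_0,\mu_1\in\mathcal{P}_2^{ac}(X)$, every $\pi\in\mathrm{OptGeo}(\mu_0,\mu_1)$ is concentrated on a Borel set $\Gamma\subset\mathrm{Geo}(X)$ that is non-branching, i.e. if $\gamma^1,\gamma^2\in\Gamma$ and $\gamma^1|_{[0,t]}=\gamma^2|_{[0,t]}$ for some $t\in(0,1)$, then $\gamma^1=\gamma^2$. Qualitatively non-degenerate: for every $x_0\in X$ and $R>0$ there is a function $f:(0,1)\to(0,\infty)$ with $\limsup_{t\to0}f(t)>\frac12$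 such that $\mathfrak{m}(A_{t,x})\ge f(t)\,\mathfrak{m}(A)$ for all Borel $A\subset B(x_0,R)$, $x\in B(x_0,R)$ and $t\in(0,1)$, where $A_{t,x}=\{\gamma_t:\gamma\in\mathrm{Geo}(X),\gamma_0\in A,\gamma_1=x\}$. *)

(* Defs.v *)
From HB Require Import structures.
From mathcomp Require Import all_boot all_order all_algebra.
From mathcomp Require Import all_classical all_reals all_analysis.
From mathcomp Require Import measurable_realfun ring lra.

Set Implicit Arguments.
Unset Strict Implicit.
Unset Printing Implicit Defensive.

Import Order.TTheory GRing.Theory Num.Theory.
Import numFieldNormedType.Exports.

Local Open Scope classical_set_scope.
Local Open Scope ring_scope.

(* Measurable types are pointed in MathComp-Analysis, so the metric spaces
   below carry a (meaningless) distinguished point: they are nonempty. *)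
#[short(type="pmetricType")]
HB.structure Definition PointedMetric (R : numDomainType) :=
  {T of Metric R T & isPointed T}.

HB.instance Definition _ (X Y : ptopologicalType) := Pointed.on (X * Y)%type.

Notation borel T := (g_sigma_algebraType (@open T%type)).

Lemma continuous_borel (X Y : ptopologicalType) (f : X -> Y) :
  continuous f -> measurable_fun [set: borel X] (f : borel X -> borel Y).
Proof.
move=> /continuousP cf.
apply: (@measurability _ _ (borel X) (borel Y) setT f (@open Y)) => //.
move=> _ [B oB <-]; rewrite setTI; apply: sub_sigma_algebra; exact: cf.
Qed.

Section length_spaces.
Context {R : realType} (X : metricType R).

Definition curve_length (c : R -> X) : \bar R :=
  ereal_sup [set (\sum_(0 <= i < size s)
      mdist (c (nth 1 (0 :: s) i)) (c (nth 1 (0 :: s) i.+1)))%:E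
    | s in itv_partition (0 : R) 1].

Definition length_space := forall x y : X,
  (mdist x y)%:E =
  ereal_inf [set curve_length c | c in
    [set c : R -> X | [/\ {within `[0, 1], continuous c}, c 0 = x & c 1 = y]]].

End length_spaces.

Section geodesics.
Context {R : realType}.

Record geo (X : metricType R) := Geo {
  geo_fun :> {i01 R} -> X ;
  geo_speed : forall s t : {i01 R}, mdist (geo_fun s) (geo_fun t) =
    `|s%:num - t%:num| * mdist (geo_fun 0%:i01) (geo_fun 1%:i01) }.

Lemma geo_eq (X : metricType R) (g h : geo X) : g =1 h -> g = h.
Proof.
case: g h => [g sg] [h sh] /= /funext gh; rewrite gh in sg *.
by congr Geo; exact: Prop_irrelevance.
Qed.

HB.instance Definition _ (X : metricType R) := gen_eqMixin (geo X).
HB.instance Definition _ (X : metricType R) := gen_choiceMixin (geo X).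

Section distance.
Context {X : metricType R}.
Implicit Types g h : geo X.

Definition geo_dist g h : R := sup [set mdist (g t) (h t) | t in setT].

Let mdist_geo_bound g h :
  has_sup [set mdist (g t) (h t) | t in setT].
Proof.
split; first by exists (mdist (g 0%:i01) (h 0%:i01)); exists 0%:i01.
exists (mdist (g 0%:i01) (g 1%:i01) + mdist (g 0%:i01) (h 0%:i01)
        + mdist (h 0%:i01) (h 1%:i01)).
have len (k : geo X) t :
    mdist (k t) (k 0%:i01) <= mdist (k 0%:i01) (k 1%:i01).
  rewrite geo_speed /= subr0 ger0_norm//.
  by rewrite ler_piMl// mdist_ge0.
move=> _ [t _ <-].
rewrite (le_trans (metric_triangle _ (h 0%:i01) _))//.
apply: lerD; last by rewrite metric_sym len.
rewrite (le_trans (metric_triangle _ (g 0%:i01) _))//.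
by rewrite lerD2r len.
Qed.

Lemma le_geo_dist g h t : mdist (g t) (h t) <= geo_dist g h.
Proof. by apply: ub_le_sup; [case: (mdist_geo_bound g h)|exists t]. Qed.

Let geo_distxx g : geo_dist g g = 0.
Proof.
rewrite /geo_dist (_ : [set _ | _ in _] = [set 0]) ?sup1//.
apply/seteqP; split => [_ [t _ <-]|_ ->]; first by rewrite mdistxx.
by exists 0%:i01; rewrite ?mdistxx.
Qed.

Let geo_dist_positivity g h : geo_dist g h = 0 -> g = h.
Proof.
move=> gh0; apply: geo_eq => t; apply: mdist_positivity.
by apply/eqP; rewrite eq_le mdist_ge0 andbT -gh0 le_geo_dist.
Qed.

Let geo_dist_sym g h : geo_dist g h = geo_dist h g.
Proof.
by congr sup; apply/seteqP; split=> _ [t _ <-]; exists t; rewrite // metric_sym.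
Qed.

Let geo_dist_triangle h g k : geo_dist g k <= geo_dist g h + geo_dist h k.
Proof.
apply: ge_sup; first by case: (mdist_geo_bound g k).
move=> _ [t _ <-]; rewrite (le_trans (metric_triangle _ (h t) _))//.
by rewrite lerD// le_geo_dist.
Qed.

HB.instance Definition _ := @isMetric.Build R (geo X) geo_dist
  geo_distxx geo_dist_positivity geo_dist_sym geo_dist_triangle.

End distance.

Section pointed.
Context {X : pmetricType R}.

Let cst_speed (s t : {i01 R}) :
  mdist (point : X) point = `|s%:num - t%:num| * mdist (point : X) point.
Proof. by rewrite mdistxx mulr0. Qed.

HB.instance Definition _ :=
  isPointed.Build (geo X) (@Geo X (fun=> point) cst_speed).

End pointed.
End geodesics.

Section evaluation_restriction.
Context {R : realType}.

Let conv01_subproof (s t u : {i01 R}) :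
  0 <= (1 - u%:num) * s%:num + u%:num * t%:num <= 1.
Proof.
have [] : [/\ 0 <= u%:num, u%:num <= 1, 0 <= s%:num & s%:num <= 1] by [].
have [] : 0 <= t%:num /\ t%:num <= 1 by [].
move: s%:num t%:num u%:num => s' t' u'; nra.
Qed.

Definition conv01 (s t u : {i01 R}) : {i01 R} :=
  Itv01 (proj1 (andP (conv01_subproof s t u)))
        (proj2 (andP (conv01_subproof s t u))).

Section metric.
Context {X : metricType R}.

Let restr_speed (s t : {i01 R}) (g : geo X) (u v : {i01 R}) :
  mdist (g (conv01 s t u)) (g (conv01 s t v)) =
  `|u%:num - v%:num| *
    mdist (g (conv01 s t 0%:i01)) (g (conv01 s t 1%:i01)).
Proof.
rewrite !(geo_speed g (conv01 _ _ _)) /= mulrA -normrM; congr (_ * _).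
rewrite -normrN; congr `|_|; ring.
Qed.

Definition geo_restr (s t : {i01 R}) (g : geo X) : geo X :=
  Geo (restr_speed s t g).

Definition geo_eval (t : {i01 R}) (g : geo X) : X := g t.

Lemma geo_eval_continuous t : continuous (geo_eval t).
Proof.
move=> g; apply/(@metricType_numDomainType.cvgrPdist_lt _ _ _ (nbhs g)) => e e0.
rewrite near_simpl; apply/(@metricType_numDomainType.nbhs_mdistP _ (geo X)).
exists e => //= h.
by apply: le_lt_trans; exact: le_geo_dist.
Qed.

Lemma geo_restr_continuous s t : continuous (geo_restr s t).
Proof.
move=> g; apply/(@metricType_numDomainType.cvgrPdist_lt _ _ _ (nbhs g)) => e e0.
rewrite near_simpl; apply/(@metricType_numDomainType.nbhs_mdistP _ (geo X)).
exists e => //= h.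
apply: le_lt_trans; apply: ge_sup; first by exists (mdist
  (geo_restr s t g 0%:i01) (geo_restr s t h 0%:i01)), 0%:i01.
by move=> _ [u _ <-]; exact: (le_geo_dist g h (conv01 s t u)).
Qed.

Definition geo_start (g : geo X) : X := g 0%:i01.
Definition geo_end (g : geo X) : X := g 1%:i01.
Definition geo_length (g : geo X) : R := mdist (geo_start g) (geo_end g).
Definition geo_ends (g : geo X) : X * X := (geo_start g, geo_end g).

Lemma geo_ends_continuous : continuous geo_ends.
Proof.
move=> g.
exact: (cvg_pair (@geo_eval_continuous 0%:i01 g) (@geo_eval_continuous 1%:i01 g)).
Qed.

End metric.
End evaluation_restriction.

Section measurability.
Context {R : realType} {X : pmetricType R}.

HB.instance Definition _ (t : {i01 R}) := isMeasurableFun.Build _ _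
  (borel (geo X)) (borel X) (geo_eval t : borel (geo X) -> borel X)
  (continuous_borel (@geo_eval_continuous R X t)).

HB.instance Definition _ (s t : {i01 R}) := isMeasurableFun.Build _ _
  (borel (geo X)) (borel (geo X))
  (geo_restr s t : borel (geo X) -> borel (geo X))
  (continuous_borel (@geo_restr_continuous R X s t)).


HB.instance Definition _ := isMeasurableFun.Build _ _
  (borel (geo X)) (borel (X * X))
  (@geo_ends R X : borel (geo X) -> borel (X * X))
  (@continuous_borel (geo X) (X * X)%type _ (@geo_ends_continuous R X)).

End measurability.

Section reweighting.
Local Open Scope ereal_scope.
Context {d} {T : measurableType d} {R : realType}.

Definition reweight (mu : set T -> \bar R) (f : T -> \bar R) :
    set T -> \bar R :=
  fun A => \int[mu]_(x in A) f x.

Variables (mu : {measure set T -> \bar R}) (f : T -> \bar R).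
Hypotheses (mf : measurable_fun [set: T] f) (f0 : forall x, 0 <= f x).

Let reweight0 : reweight mu f set0 = 0.
Proof. by rewrite /reweight integral_set0. Qed.

Let reweight_ge0 A : 0 <= reweight mu f A.
Proof. by apply: integral_ge0. Qed.

Let reweight_sigma_additive : semi_sigma_additive (reweight mu f).
Proof. exact: semi_sigma_additive_nng_induced. Qed.

HB.instance Definition _ := isMeasure.Build _ _ _ (reweight mu f)
  reweight0 reweight_ge0 reweight_sigma_additive.

End reweighting.

Section distortion.
Context {R : realType}.
Implicit Types K N n t theta : R.

Definition sinh (x : R) : R := (expR x - expR (- x)) / 2.

(* The coefficient sigma_{K,n}; it is used with n = N - 1. *)
Definition sigma_coeff K n t theta : \bar R :=
  if n * pi ^+ 2 <= K * theta ^+ 2 then +oo%E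
  else if 0 < K * theta ^+ 2 then
    (sin (t * theta * Num.sqrt (K / n)) / sin (theta * Num.sqrt (K / n)))%:E
  else if K * theta ^+ 2 == 0 then t%:E
  else
    (sinh (t * theta * Num.sqrt (- K / n)) / sinh (theta * Num.sqrt (- K / n)))%:E.

(* At t = 0 the product may be 0 * +oo, which is 0 in \bar R. *)
Definition tau_coeff K N t theta : \bar R :=
  ((t `^ N^-1)%:E * sigma_coeff K (N - 1) t theta `^ ((N - 1) / N))%E.

End distortion.

Section metric_measure_spaces.
Context {R : realType} {X : pmetricType R}.
Implicit Types (m : {measure set (borel X) -> \bar R}).
Implicit Types (mu : probability (borel X) R) (eta : probability (borel (geo X)) R).

Definition complete_space :=
  forall F : set_system X, ProperFilter F -> cauchy F -> cvg F.

Definition separable_space := exists2 D : set X, countable D & dense D.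

Definition measure_support m : set X :=
  [set x | forall U : set X, open_nbhs x U -> (0 < m U)%E].

Definition metric_measure_space m :=
  [/\ [/\ complete_space, locally_compact [set: X], separable_space
        & length_space X],
      forall x : X, exists2 e, 0 < e & (m (ball x e) < +oo)%E
    & measure_support m = [set: X]].

Definition finite_second_moment mu :=
  exists x0 : X, (\int[mu]_x (mdist x0 x ^+ 2)%:E < +oo)%E.

Definition P2ac m mu := finite_second_moment mu /\ mu `<< m.

Definition coupling mu0 mu1 (s : probability (borel (X * X)) R) :=
  forall A : set X, measurable (A : set (borel X)) ->
    pushforward s (fst : borel (X * X) -> borel X) A = mu0 A /\
    pushforward s (snd : borel (X * X) -> borel X) A = mu1 A.

Definition transport_cost (s : probability (borel (X * X)) R) : \bar R :=
  (\int[s]_p (mdist p.1 p.2 ^+ 2)%:E)%E.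

Definition Opt mu0 mu1 (s : probability (borel (X * X)) R) :=
  coupling mu0 mu1 s /\
  forall s', coupling mu0 mu1 s' -> (transport_cost s <= transport_cost s')%E.

Definition OptGeo mu0 mu1 eta := Opt mu0 mu1 (distribution eta (@geo_ends R X)).

(* [rho] is a density of the absolutely continuous part of [nu] with respect
   to [m], and the singular part of [nu] is concentrated on [S]. *)
Definition lebesgue_decomposition m (nu : set (borel X) -> \bar R)
    (rho : X -> R) (S : set X) :=
  [/\ measurable_fun [set: borel X] rho, forall x, 0 <= rho x,
      measurable (S : set (borel X)), m S = 0%E
    & forall A : set (borel X), measurable A ->
        nu A = (\int[m]_(x in A) (rho x)%:E + nu (A `&` S))%E].

(* rho ^ p, set to 0 on the set carrying the singular part. *)
Definition density_power (rho : X -> R) (S : set X) (p : R) (x : X) : R :=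
  \1_(~` S) x * rho x `^ p.

Definition CD_inequality m (K N : R) (q : set (borel (geo X)) -> \bar R) :=
  forall (rho : {i01 R} -> X -> R) (S : {i01 R} -> set X),
  (forall s, lebesgue_decomposition m
      (pushforward q (geo_eval s : borel (geo X) -> borel X)) (rho s) (S s)) ->
  forall (t : {i01 R}) (N' : R), N <= N' ->
  (\int[q]_g
     (tau_coeff K N' (1 - t%:num)%R (geo_length g) *
        (density_power (rho 0%:i01) (S 0%:i01) (- N'^-1)%R (geo_start g))%:E +
      tau_coeff K N' t%:num (geo_length g) *
        (density_power (rho 1%:i01) (S 1%:i01) (- N'^-1)%R (geo_end g))%:E)
   <= \int[m]_x (rho t x `^ (1 - N'^-1))%R%:E)%E.

Definition very_strict_CD m (K N : R) :=
  forall mu0 mu1, P2ac m mu0 -> P2ac m mu1 ->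
  exists2 eta, OptGeo mu0 mu1 eta &
    forall F : geo X -> R, measurable_fun [set: borel (geo X)] F ->
      (forall g, 0 <= F g) -> (exists M, forall g, F g <= M) ->
      (\int[eta]_g (F g)%:E = 1)%E ->
    forall t1 t2 : {i01 R}, t1%:num < t2%:num ->
      CD_inequality m K N
        (pushforward (reweight eta (EFin \o F))
          (geo_restr t1 t2 : borel (geo X) -> borel (geo X))).

(* The second argument of [mnormalize] is irrelevant as 0 < m A < +oo. *)
Definition MCP m (K N : R) :=
  forall (o : X) (A : set X) (mA : measurable (A : set (borel X))),
  (0 < m A)%E -> (m A < +oo)%E ->
  (0 < K -> A `<=` ball o (pi * Num.sqrt ((N - 1) / K))) ->
  let mu0 : probability (borel X) R :=
    mnormalize (mrestr m mA) (dirac (o : borel X)) in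
  finite_second_moment mu0 ->
  exists2 eta, OptGeo mu0 (dirac (o : borel X)) eta &
    forall (t : {i01 R}) (B : set X), measurable (B : set (borel X)) ->
    (pushforward
       (reweight eta (fun g : geo X =>
          tau_coeff K N (1 - t%:num)%R (geo_length g) `^ N))
       (geo_eval t : borel (geo X) -> borel X) B
     <= ((fine (m A))^-1)%:E * m B)%E.

Definition non_branching_set (G : set (geo X)) :=
  forall g1 g2, G g1 -> G g2 ->
  forall t : {i01 R}, 0 < t%:num < 1 ->
  (forall s : {i01 R}, s%:num <= t%:num -> g1 s = g2 s) -> g1 = g2.

Definition essentially_non_branching m :=
  forall mu0 mu1, P2ac m mu0 -> P2ac m mu1 ->
  forall eta, OptGeo mu0 mu1 eta ->
  exists G : set (geo X), [/\ measurable (G : set (borel (geo X))),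
    eta (~` G) = 0%E & non_branching_set G].

Definition intermediate_points (t : {i01 R}) (A : set X) (x : X) : set X :=
  [set y | exists g : geo X, [/\ A (geo_start g), geo_end g = x & g t = y]].

(* [intermediate_points t A x] is a Suslin set, hence measurable for the
   completion of [m], but it need not be Borel, and [m] itself is meaningful on
   Borel sets only; the outer measure [mu_ext m] extends the completion. *)
Definition qualitatively_non_degenerate m :=
  forall (x0 : X) (r : R), 0 < r ->
  exists f : R -> R, [/\ forall t, 0 < t < 1 -> 0 < f t,
    (2^-1%:E < limf_esup (EFin \o f) (0 : R)^'+)%E
  & forall A : set X, measurable (A : set (borel X)) -> A `<=` ball x0 r ->
    forall x : X, ball x0 r x ->
    forall t : {i01 R}, 0 < t%:num < 1 ->
    ((f t%:num)%:E * m A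
       <= mu_ext m (intermediate_points t A x : set (borel X)))%E].

End metric_measure_spaces.

Definition isometric_to_open_interval {R : realType} {X : metricType R}
    (B : set X) :=
  exists (J : set R) (phi : X -> R), [/\ open J, is_interval J, phi @` B = J
    & {in B &, forall y z, `|phi y - phi z| = mdist y z}].

Definition homeomorphic_sets (T U : topologicalType) (A : set T) (B : set U) :=
  exists (f : T -> U) (g : U -> T),
    [/\ set_fun A B f /\ set_fun B A g, {in A, cancel f g}, {in B, cancel g f},
       {within A, continuous f} & {within B, continuous g}].

Definition one_manifold_with_boundary (R : realType) (T : topologicalType) :=
  [/\ hausdorff_space T, @second_countable T &
    forall x : T, exists (U : set T) (W : set R),
      [/\ open_nbhs x U, open W & homeomorphic_sets U (W `&` `[0, +oo[)]].

(* Main.v *)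
(* Call a point interior if a ball around it is isometric to an interval, and a boundary
   point if a ball around it is isometric to some [0, s[. Interior points form an open set and X
   is connected, so everything reduces to the endpoint q of a unit-speed ray of interior
   points. Suppose that q is neither interior nor a boundary point. Then arbitrarily close to q
   there are points w1 <> w2 off the ray, at the same distance from q, and a geodesic from a
   point of the ray to a neighbourhood of w1 or w2 runs back along the ray to q first.

   Fix e on the ray and call d(e, z) the height of z. Contracting a neighbourhood of w1, of w2
   or of a point of the ray towards the points of the ray between q and e maps sets of positive
   measure to sets of positive measure, under each of the three curvature hypotheses; by Fubini,
   the law of the height under m, restricted to these neighbourhoods, charges every non-null
   subset of some interval. So there are absolutely continuous measures mu1, living half near
   w1 and half near w2, and mu0 on the ray, such that mu0 is the law of the point of the ray c
   below the height of a mu1-random point, with the same c for both halves. The optimal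
   couplings are those moving all mass by c, since
   d^2 - c^2 = (d - c)^2 + 2c(d - h) + 2c(h - c), where h <= d is the difference of heights,
   whose integral is c for every coupling.
   An optimal plan thus sends geodesics from almost every starting point to both branches, and
   these agree initially: it is not concentrated on a non-branching set.

   In a very strict CD(K,N) space the given plan is concentrated on a non-branching set: if not,
   for two times s1 < s2 as close as we like there would be two reweighted subplans with the same
   law at s1 and mutually singular laws at s2. Averaging them, the integral of rho^(1-1/N) would
   jump by the factor 2^(1/N) between s1 and s2, whereas the CD inequality, applied forwards from
   s1 and backwards from s2, makes it almost constant. *)
Require Import Defs.
From HB Require Import structures.
From mathcomp Require Import all_boot all_order all_algebra.
From mathcomp Require Import all_classical all_reals all_analysis.
From mathcomp Require Import measurable_realfun ring lra.

Set Implicit Arguments.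
Unset Strict Implicit.
Unset Printing Implicit Defensive.

Import Order.TTheory GRing.Theory Num.Theory.
Import numFieldNormedType.Exports.

Local Open Scope classical_set_scope.
Local Open Scope ring_scope.

(** * Geodesics *)

(** A single pair of branching geodesics contradicts none of the hypotheses, which control plans
    only up to null sets: the fork must carry positive mass on both sides, over the same starting
    points. Contraction towards one fixed point only shows that some heights are charged; letting
    the target run through an interval of the ray is what reaches almost every height. Essential
    non-branching speaks of all optimal plans, so one has to be exhibited, hence the measurable
    choice of geodesics. The very strict CD condition speaks of one plan that cannot be prescribed,
    hence the need to describe every optimal coupling and not only the constructed one. Sets of
    intermediate points are Borel for a simple reason only when they are compact; therefore
    contraction is stated for closed sets, and inner regularity leads back to general ones. Limits
    of geodesics are taken along ultrafilters, which spares the extraction of subsequences. *)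

Lemma invS_lt (R : realType) (e : R) : 0 < e -> exists n : nat, n.+1%:R^-1 < e.
Proof.
by move=> e0; exists (Num.truncn e^-1); rewrite invf_plt ?posrE//; exact: truncnS_gt.
Qed.

Section metric_basics.
Context {R : realType} {X : metricType R}.
Implicit Types (x y z : X) (A : set X).

Lemma nbhs_mdist x A :
  nbhs x A <-> exists2 e : R, 0 < e & forall y, mdist x y < e -> A y.
Proof.
split=> [/nbhs_ballP[e e0 xeA]|[e e0 xeA]].
  by exists e => // y xy; apply: xeA; rewrite ballEmdist.
by apply/nbhs_ballP; exists e => // y; rewrite ballEmdist; exact: xeA.
Qed.

Lemma open_mdist A :
  open A <-> forall x, A x -> exists2 e : R, 0 < e & forall y, mdist x y < e -> A y.
Proof.
rewrite openE; split=> [oA x /oA/nbhs_mdist//|oA x Ax].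
exact/nbhs_mdist/oA.
Qed.

Lemma mdist_triangle_sub x y z : `|mdist x y - mdist x z| <= mdist y z.
Proof.
have := metric_triangle x y z; have := metric_triangle x z y.
rewrite (metric_sym z y) => h1 h2; rewrite ler_norml; apply/andP; split; lra.
Qed.

Lemma mdist_continuous x : continuous (mdist x : X -> R).
Proof.
move=> y; apply/cvgrPdist_lt => e e0; near=> z.
apply: le_lt_trans (mdist_triangle_sub _ _ _) _; near: z.
by apply/nbhs_mdist; exists e.
Unshelve. all: by end_near. Qed.

Lemma closed_mdist_le x (r : R) : closed [set y | mdist x y <= r].
Proof.
rewrite (_ : [set _ | _] = mdist x @^-1` [set u | u <= r])//.
by apply: preimage_closed; [move=> ? _; exact: mdist_continuous|exact: closed_le].
Qed.

Lemma open_mdist_lt x (r : R) : open [set y | mdist x y < r].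
Proof.
rewrite (_ : [set _ | _] = mdist x @^-1` [set u | u < r])//.
by apply: open_comp; [move=> ? _; exact: mdist_continuous|exact: open_lt].
Qed.

Lemma cvg_mdist {T} (F : set_system T) {FF : Filter F} (f g : T -> X) x y :
  f @ F --> x -> g @ F --> y -> (fun t => mdist (f t) (g t)) @ F --> mdist x y.
Proof.
move=> fx gy; apply/cvgrPdist_lt => e e0.
have e2 : 0 < e / 2 by rewrite divr_gt0.
near=> t.
have H1 : mdist x (f t) < e / 2.
  by near: t; apply: (fx [set u | mdist x u < e / 2]); apply/nbhs_mdist; exists (e / 2).
have H2 : mdist y (g t) < e / 2.
  by near: t; apply: (gy [set u | mdist y u < e / 2]); apply/nbhs_mdist; exists (e / 2).
have := mdist_triangle_sub x y (g t); have := mdist_triangle_sub (g t) x (f t).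
rewrite !(metric_sym (g t)) !ler_norml ltr_norml => /andP[? ?] /andP[? ?].
by apply/andP; split; lra.
Unshelve. all: by end_near. Qed.

(** A cluster point of an ultrafilter is a limit: if the preimage of a neighbourhood were not large,
    its complement would be. *)
Lemma ultra_cvg {T} (F : set_system T) (FU : UltraFilter F) (f : T -> X) (K : set X) :
  compact K -> F (f @^-1` K) -> exists2 l, K l & f @ F --> l.
Proof.
move=> cK FK.
have PF : ProperFilter F by exact: ultra_proper.
have [l [Kl clF]] := cK (f @ F) _ FK.
exists l => // B Bl.
have [//|] := in_ultra_setVsetC (f @^-1` B) FU.
move=> FB; have [x [] //] := clF (~` B) B FB Bl.
Qed.

End metric_basics.

Section curves.
Context {R : realType} {X : metricType R}.

Lemma curve_length_ge (c : R -> X) (u v : R) : 0 <= u -> u <= v -> v <= 1 ->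
  ((mdist (c 0) (c u) + mdist (c u) (c v) + mdist (c v) (c 1))%:E
    <= curve_length c)%E.
Proof.
move=> u0 uv v1; rewrite /curve_length.
suff [s ps <-] : exists2 s : seq R, itv_partition 0 1 s &
    \sum_(0 <= i < size s)
      mdist (c (nth 1 (0 :: s) i)) (c (nth 1 (0 :: s) i.+1)) =
    mdist (c 0) (c u) + mdist (c u) (c v) + mdist (c v) (c 1).
  by apply: ereal_sup_ubound; exists s.
(* An [itv_partition] is strictly increasing, so each coincidence among 0, [u], [v] and 1 calls for
   a shorter one. *)
have [u00|u0'] := eqVneq u 0; have [v11|v1'] := eqVneq v 1;
  have [uvE|uv'] := eqVneq u v.
- by exfalso; subst; move: (@oner_neq0 R); rewrite uvE eqxx.
- exists [:: 1]; first by rewrite /itv_partition /= ltr01 eqxx.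
  by rewrite /= u00 v11 !big_nat1/= !mdistxx add0r addr0.
- exists [:: 1]; first by rewrite /itv_partition /= ltr01 eqxx.
  by rewrite -uvE u00 /= !big_nat1/= !mdistxx !add0r.
- have v0 : 0 < v by rewrite lt_neqAle -u00 uv' uv.
  have v1l : v < 1 by rewrite lt_neqAle v1' v1.
  exists [:: v; 1]; first by rewrite /itv_partition /= v0 v1l eqxx.
  by rewrite /= big_nat_recr//= !big_nat1/= u00 mdistxx add0r.
- have u0l : 0 < u by rewrite lt_neqAle eq_sym u0' u0.
  exists [:: 1]; first by rewrite /itv_partition /= ltr01 eqxx.
  by rewrite uvE v11 /= big_nat1/= !mdistxx !addr0.
- have u0l : 0 < u by rewrite lt_neqAle eq_sym u0' u0.
  have u1l : u < 1 by rewrite -v11 lt_neqAle uv' uv.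
  exists [:: u; 1]; first by rewrite /itv_partition /= u0l u1l eqxx.
  by rewrite v11 /= big_nat_recr//= big_nat1/= mdistxx addr0.
- have u0l : 0 < u by rewrite lt_neqAle eq_sym u0' u0.
  have u1l : u < 1 by rewrite uvE lt_neqAle v1' v1.
  exists [:: u; 1]; first by rewrite /itv_partition /= u0l u1l eqxx.
  by rewrite -uvE /= big_nat_recr//= big_nat1/= mdistxx addr0.
- have u0l : 0 < u by rewrite lt_neqAle eq_sym u0' u0.
  have uvl : u < v by rewrite lt_neqAle uv' uv.
  have v1l : v < 1 by rewrite lt_neqAle v1' v1.
  exists [:: u; v; 1]; first by rewrite /itv_partition /= u0l uvl v1l eqxx.
  by rewrite /= !big_nat_recr//= big_geq// add0r.
Qed.

Lemma length_space_curve (x y : X) (e : R) : length_space X -> 0 < e ->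
  exists c : R -> X, [/\ {within `[0, 1], continuous c}, c 0 = x, c 1 = y &
    (curve_length c < (mdist x y + e)%:E)%E].
Proof.
move=> /(_ x y) lX e0.
have : ((mdist x y)%:E < (mdist x y + e)%:E)%E by rewrite lte_fin ltrDl.
rewrite {1}lX => /ereal_inf_lt [_ [c [cc c0 c1] <-] cle]; exists c; split => //.
Qed.

Lemma length_space_connected : length_space X -> connected [set: X].
Proof.
move=> lX.
have [[x _]|X0] := pselect ([set: X] !=set0); last first.
  have -> : [set: X] = set0.
    by apply/seteqP; split => // x _; apply: X0; exists x.
  exact: connected0.
rewrite (_ : [set: X] = \bigcup_(c in [set c : R -> X |
   {within `[0, 1], continuous c} /\ c 0 = x]) (c @` `[0, 1])); last first.
  apply/seteqP; split=> // y _.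
  have [c [cc c0 c1 _]] := length_space_curve x y lX ltr01.
  by exists c => //; exists 1 => //=; rewrite in_itv/= ler01 lexx.
apply: bigcup_connected.
  by exists x => c [_ <-]; exists 0 => //=; rewrite in_itv/= ler01 lexx.
move=> c [cc _]; apply: connected_continuous_connected => //.
exact: segment_connected.
Qed.

End curves.

Definition zero01 {R : realType} : {i01 R} := 0%:i01.
Definition one01 {R : realType} : {i01 R} := 1%:i01.

Section geodesics.
Context {R : realType} {X : metricType R}.

(** The point at time [t] is one on a nearly shortest curve at distance [t%:num * mdist x y] from
    [x], found by the intermediate value theorem. Such points may come along the curve in another
    order than their times; the length of the curve bounds their mutual distance all the same. The
    last bound keeps everything in one ball around [x]. *)
Lemma approx_geodesic (x y : X) (e : R) : length_space X -> 0 < e ->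
  exists h : {i01 R} -> X, [/\ forall s t, mdist (h s) (h t) <=
      `|s%:num - t%:num| * mdist x y + e,
    h 0%:i01 = x, mdist (h 1%:i01) y <= e &
    forall t, mdist x (h t) <= mdist x y].
Proof.
move=> lX e0; have [c [cc c0 c1 cl]] := length_space_curve x y lX e0.
have psic : {within `[0, 1], continuous (mdist x \o c)}.
  by move=> u; apply: cvg_comp; [exact: cc|exact: mdist_continuous].
have ex (t : {i01 R}) : exists u, [/\ 0 <= u, u <= 1 &
    mdist x (c u) = t%:num * mdist x y].
  have [] := IVT ler01 psic (v := t%:num * mdist x y).
    rewrite /= c0 c1 mdistxx minEle maxEle mdist_ge0 mulr_ge0//= ?mdist_ge0//.
    by rewrite ler_piMl// mdist_ge0.
  by move=> u; rewrite in_itv/= => /andP[? ?] ?; exists u.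
have [u hu] := choice ex.
have main s t : u s <= u t -> mdist (c (u s)) (c (u t)) <=
    `|s%:num - t%:num| * mdist x y + e.
  move=> st; have [us0 us1 usE] := hu s; have [ut0 ut1 utE] := hu t.
  have := le_lt_trans (curve_length_ge c us0 st ut1) cl.
  rewrite lte_fin c0 c1 usE.
  have := metric_triangle x (c (u t)) y; rewrite utE => h1 h2.
  have : - `|s%:num - t%:num| * mdist x y <= (s%:num - t%:num) * mdist x y.
    by apply: ler_wpM2r; rewrite ?mdist_ge0// lerNl ler_normr lexx orbT.
  rewrite mulrBl mulNr; lra.
exists (c \o u); split => /=.
- move=> s t; have [|/ltW ts] := leP (u s) (u t); first exact: main.
  by rewrite metric_sym distrC; exact: main.
- by have [_ _] := hu 0%:i01; rewrite /= mul0r => /mdist_positivity.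
- have [u0 u1 uE] := hu 1%:i01; move: uE; rewrite /= mul1r => uE.
  have := le_lt_trans (curve_length_ge c u0 u1 (lexx 1)) cl.
  by rewrite lte_fin c0 c1 uE mdistxx; lra.
- by move=> t; have [_ _ ->] := hu t; rewrite ler_piMl// mdist_ge0.
Qed.

Lemma oo_ultra : exists2 U : set_system nat, UltraFilter U & \oo `<=` U.
Proof. by have [G [? ?]] := @ultraFilterLemma _ (\oo : set_system nat) _; exists G. Qed.

(** Any slack in the Lipschitz bound between two times would make the distance from [x] to [y] too
    short, so all these bounds are equalities. *)
Lemma lipschitz_geo (x y : X) (l : {i01 R} -> X) :
  (forall s t, mdist (l s) (l t) <= `|s%:num - t%:num| * mdist x y) ->
  l 0%:i01 = x -> l 1%:i01 = y -> exists g : geo X, forall t, g t = l t.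
Proof.
move=> ll l0 l1.
have main (s t : {i01 R}) : s%:num <= t%:num ->
    mdist (l s) (l t) = `|s%:num - t%:num| * mdist x y.
  move=> st; apply/eqP; rewrite eq_le ll/=.
  have := metric_triangle x (l s) y; have := metric_triangle (l s) (l t) y.
  have [s0 s1] : 0 <= s%:num /\ s%:num <= 1 by [].
  have [t0 t1] : 0 <= t%:num /\ t%:num <= 1 by [].
  have : mdist x (l s) <= s%:num * mdist x y.
    by rewrite -{1}l0 (le_trans (ll _ _))//= sub0r normrN ger0_norm.
  have : mdist (l t) y <= (1 - t%:num) * mdist x y.
    by rewrite -{1}l1 (le_trans (ll _ _))//= distrC ger0_norm// subr_ge0.
  rewrite ler0_norm ?subr_le0// !opprB !mulrBl !mul1r; lra.
have ls (s t : {i01 R}) :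
    mdist (l s) (l t) = `|s%:num - t%:num| * mdist (l 0%:i01) (l 1%:i01).
  rewrite l0 l1; have [|/ltW ts] := leP s%:num t%:num; first exact: main.
  by rewrite metric_sym distrC main.
by exists (Geo ls).
Qed.

(** The pointwise limit of approximate geodesics along an ultrafilter satisfies the limiting
    Lipschitz bounds; one ultrafilter serves all times at once. *)
Lemma geodesic_exists (x y : X) (K : set X) : length_space X -> compact K ->
  (forall z, mdist x z <= mdist x y -> K z) ->
  exists g : geo X, geo_start g = x /\ geo_end g = y.
Proof.
move=> lX cK xK.
have e0 (n : nat) : 0 < (n.+1%:R : R)^-1 by rewrite invr_gt0.
have [h hP] := choice (fun n => approx_geodesic x y lX (e0 n)).
have [U UU ooU] := oo_ultra.
have ex (t : {i01 R}) : exists l : X, (h ^~ t) @ U --> l.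
  have [|l _ ?] := ultra_cvg UU (f := h ^~ t) cK; last by exists l.
  apply: filterS (@filterT _ U _) => n _ /=.
  by apply: xK; have [_ _ _] := hP n.
have [l lP] := choice ex.
have ecvg : (fun n : nat => (n.+1%:R : R)^-1) @ U --> (0 : R).
  by move=> A A0; apply: ooU; exact: (@cvg_harmonic R A A0).
have l0 : l 0%:i01 = x.
  apply: (@metric_hausdorff R X) => A B lA xB.
  have [n hA] := @filter_ex _ U _ _ (lP 0%:i01 A lA).
  exists x; split; last exact: nbhs_singleton.
  by have [_ h0 _ _] := hP n; rewrite -h0.
have l1 : l 1%:i01 = y.
  apply: mdist_positivity; apply/eqP; rewrite eq_le mdist_ge0 andbT.
  apply: (ler_cvg_to (cvg_mdist (lP 1%:i01) (cvg_cst y)) ecvg).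
  by apply: filterS (@filterT _ U _) => n _; have [] := hP n.
have [g gE] := @lipschitz_geo x y l (fun s t =>
  ltac:(have h2 : (fun n : nat => `|s%:num - t%:num| * mdist x y + (n.+1%:R : R)^-1)
     @ U --> `|s%:num - t%:num| * mdist x y + 0;
   [by apply: cvgD => //; exact: cvg_cst|];
   rewrite addr0 in h2;
   apply: (ler_cvg_to (cvg_mdist (lP s) (lP t)) h2);
   by apply: filterS (@filterT _ U _) => n _; have [] := hP n)) l0 l1.
by exists g; rewrite /geo_start /geo_end !gE.
Qed.

Lemma geo_dist_le (g h : geo X) (e : R) :
  (forall t, mdist (g t) (h t) <= e) -> mdist g h <= e.
Proof.
move=> ge; apply: ge_sup; first by exists (mdist (g 0%:i01) (h 0%:i01)), 0%:i01.
by move=> _ [t _ <-].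
Qed.

(** An Arzela-Ascoli argument: along an ultrafilter geodesics converge pointwise to a geodesic, and
    then uniformly, because their speeds are eventually bounded and a finite grid of times controls
    the rest. *)
Lemma geo_compact (K : set X) : compact K ->
  compact [set g : geo X | forall t, K (g t)].
Proof.
move=> cK; rewrite compact_ultra => F FU FK.
have PF : ProperFilter F by exact: ultra_proper.
have ex (t : {i01 R}) : exists2 l, K l & geo_eval t @ F --> l.
  by apply: (ultra_cvg FU cK); apply: filterS FK => g /(_ t).
have [l lP] := choice (fun t => ltac:(have [l ? ?] := ex t; exists l; split; eassumption) :
   exists l, K l /\ geo_eval t @ F --> l).
have lspeed (s t : {i01 R}) : mdist (l s) (l t) =
    `|s%:num - t%:num| * mdist (l 0%:i01) (l 1%:i01).
  have h1 := cvg_mdist (lP s).2 (lP t).2.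
  have h2 : (fun g : geo X => `|s%:num - t%:num| * mdist (g 0%:i01) (g 1%:i01)) @ F -->
     `|s%:num - t%:num| * mdist (l 0%:i01) (l 1%:i01).
    by apply: cvgM; [exact: cvg_cst|exact: (cvg_mdist (lP _).2 (lP _).2)].
  rewrite (_ : (fun g : geo X => _) = (fun g => mdist (geo_eval s g) (geo_eval t g))) in h2;
    last by apply/funext => g; rewrite [RHS]geo_speed.
  exact: (cvg_unique _ (h1 _) h2).
pose g := Geo lspeed.
exists g; split; first by move=> t; exact: (lP t).1.
move=> B /nbhs_mdist[e e0 gB].
pose L : R := geo_length g.
have L0 : 0 <= L by exact: mdist_ge0.
(* With speeds at most [L + 1], passing to the preceding grid time costs less than [e / 8] on each
   curve, and [e / 4] is left for the grid times. *)
have [n nP] : exists n : nat, (L + 1) / n.+1%:R < e / 8.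
  exists (Num.truncn ((L + 1) * 8 / e)).
  rewrite ltr_pdivrMr// mulrC -ltr_pdivrMr ?divr_gt0// invf_div mulrA.
  exact: truncnS_gt.
have grid (k : 'I_n.+2) : 0 <= (k%:R : R) / n.+1%:R <= 1.
  by rewrite divr_ge0//= ler_pdivrMr// mul1r ler_nat -ltnS.
pose tk (k : 'I_n.+2) : {i01 R} :=
  Itv01 (proj1 (andP (grid k))) (proj2 (andP (grid k))).
have e4 : 0 < e / 4 by rewrite divr_gt0.
have near_grid : F [set h : geo X | forall k, mdist (g (tk k)) (h (tk k)) < e / 4].
  apply: filter_forall => k.
  apply: ((lP (tk k)).2 [set u | mdist (l (tk k)) u < e / 4]).
  by apply/nbhs_mdist; exists (e / 4).
have near_len : F [set h : geo X | geo_length h < L + 1].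
  have := cvg_mdist (lP zero01).2 (lP one01).2; move/(_ _ [set u | u < L + 1]); apply.
  by apply: open_nbhs_nbhs; split; [exact: open_lt|rewrite /= ltrDl].
apply: filterS (filterI near_grid near_len) => h [hk hL]; apply: gB.
apply: (@le_lt_trans _ _ (e / 2)); last by rewrite ltr_pdivrMr// ltr_pMr// ltr1n.
apply: geo_dist_le => t.
have [t0 t1] : 0 <= t%:num /\ t%:num <= 1 by [].
have n0 : 0 < (n.+1%:R : R) by [].
pose j := Num.truncn (t%:num * n.+1%:R).
have [j1 j2] : (j%:R : R) <= t%:num * n.+1%:R /\ t%:num * n.+1%:R < j.+1%:R.
  by have /andP[] := truncn_itv (mulr_ge0 t0 (ltW n0)).
have jn : (j < n.+2)%N.
  rewrite ltnS -(ler_nat R) (le_trans j1)// ler_piMl// ltW.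
have jt : `|t%:num - j%:R / n.+1%:R| <= n.+1%:R^-1.
  rewrite ger0_norm; last by rewrite subr_ge0 ler_pdivrMr.
  by rewrite lerBlDr -[X in _ <= X + _]mul1r -mulrDl ler_pdivlMr// nat1r ltW.
have := metric_triangle (g t) (g (tk (Ordinal jn))) (h t).
have := metric_triangle (g (tk (Ordinal jn))) (h (tk (Ordinal jn))) (h t).
have := hk (Ordinal jn).
have : mdist (g t) (g (tk (Ordinal jn))) <= (L + 1) / n.+1%:R.
  by rewrite geo_speed -[X in _ * X <= _]/L mulrC ler_pM// lerDl.
have : mdist (h (tk (Ordinal jn))) (h t) <= (L + 1) / n.+1%:R.
  rewrite geo_speed mulrC distrC; apply: ler_pM => //; first exact: mdist_ge0.
  exact: ltW.
move: nP; set c := (_ / _); set x1 := mdist _ _; set x2 := mdist _ _.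
move=> nP k1 k2 k3 k4 k5; rewrite (le_trans k5)//.
apply: (@le_trans _ _ (e / 8 + (e / 4 + e / 8))); last by lra.
apply: lerD; first exact: le_trans k2 (ltW nP).
apply: le_trans k4 _; apply: lerD; first exact: ltW.
exact: le_trans k1 (ltW nP).
Qed.

End geodesics.

(** * Charts and branching off a ray *)

Section charts.
Context {R : realType} {X : metricType R}.
Implicit Types (x y z q : X) (r : R) (phi : X -> R).

Definition isometry_on_ball x r phi := forall y z,
  mdist x y < r -> mdist x z < r -> `|phi y - phi z| = mdist y z.

Definition interior_point x := exists r phi, [/\ 0 < r, isometry_on_ball x r phi &
  forall u, `|u - phi x| < r -> exists2 y, mdist x y < r & phi y = u].

Definition boundary_point x := exists r phi, [/\ 0 < r, isometry_on_ball x r phi,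
  phi x = 0, forall y, mdist x y < r -> 0 <= phi y &
  forall u : R, 0 <= u < r -> exists2 y, mdist x y < r & phi y = u].

Definition unit_speed (l : R) (gam : R -> X) := forall a b : R,
  0 <= a <= l -> 0 <= b <= l -> mdist (gam a) (gam b) = `|a - b|.

Lemma isometric_interior_point x r : 0 < r ->
  isometric_to_open_interval (ball x r) -> interior_point x.
Proof.
move=> r0 [J [phi [oJ iJ phiJ iso]]].
have bx y : mdist x y < r -> ball x r y by rewrite ballEmdist.
have Jx : J (phi x) by rewrite -phiJ; exists x => //; exact: ballxx.
have /nbhs_ballP[e e0 eJ] : nbhs (phi x) J by exact: open_nbhs_nbhs.
have isom y z : mdist x y < r -> mdist x z < r -> `|phi y - phi z| = mdist y z.
  by move=> xy xz; apply: iso; rewrite inE; exact: bx.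
exists (Num.min r e), phi; split; first by rewrite lt_min r0.
  by move=> y z; rewrite !lt_min => /andP[? _] /andP[? _]; exact: isom.
move=> u ue; have : J u.
  by apply: eJ; rewrite /ball/= distrC (lt_le_trans ue)// ge_min lexx orbT.
rewrite -phiJ => -[y]; rewrite ballEmdist/= => xy uE; exists y => //.
by rewrite -isom ?mdistxx// distrC uE.
Qed.

Lemma interior_point_near x r phi y : isometry_on_ball x r phi ->
  (forall u, `|u - phi x| < r -> exists2 y, mdist x y < r & phi y = u) ->
  mdist x y < r -> interior_point y.
Proof.
move=> iso onto xy; exists (r - mdist x y), phi.
have near z : mdist y z < r - mdist x y -> mdist x z < r.
  by have := metric_triangle x y z; lra.
split; first by rewrite subr_gt0.
  by move=> z w /near ? /near ?; exact: iso.
move=> u uy; have x0 : mdist x x < r by rewrite mdistxx (le_lt_trans (mdist_ge0 x y)).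
have [|z xz zu] := onto u.
  have := ler_distD (phi y) u (phi x); rewrite (iso y x)// (metric_sym y x); lra.
by exists z => //; rewrite -iso// zu distrC.
Qed.

Lemma open_interior_point : open [set x | interior_point x].
Proof.
apply/open_mdist => x [r [phi [r0 iso onto]]]; exists r => // y xy.
exact: interior_point_near iso onto xy.
Qed.

Lemma boundary_point_near x : boundary_point x ->
  exists2 r : R, 0 < r & forall y, mdist x y < r -> y = x \/ interior_point y.
Proof.
move=> [r [phi [r0 iso phix ge0 onto]]]; exists r => // y xy.
have [->|yx] := eqVneq y x; [by left|right].
have x0 : mdist x x < r by rewrite mdistxx.
have phiy : phi y = mdist x y.
  by rewrite metric_sym -iso// phix subr0 ger0_norm// ge0.
have xy0 : 0 < mdist x y by rewrite mdist_gt0 eq_sym.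
pose s := Num.min (mdist x y) (r - mdist x y).
have near z : mdist y z < s -> mdist x z < r.
  rewrite lt_min => /andP[_]; have := metric_triangle x y z; lra.
exists s, phi; split; first by rewrite lt_min xy0 subr_gt0.
  by move=> z w /near ? /near ?; exact: iso.
move=> u; rewrite phiy => us; move: (us); rewrite lt_min => /andP[u1 u2].
have [|z xz zu] := onto u; first by move: u1 u2; rewrite !ltr_norml => /andP[? ?] /andP[? ?]; apply/andP; split; lra.
by exists z => //; rewrite -iso// zu phiy distrC.
Qed.

Lemma boundary_point_limit x : boundary_point x -> closure [set y | interior_point y] x.
Proof.
move=> bx; have [r0 r0_gt0 near0] := boundary_point_near bx.
move: bx => [r [phi [r_gt0 iso phix ge0 onto]]].
move=> B /nbhs_mdist[e e0 eB].
pose u := Num.min r (Num.min r0 e) / 2.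
have m0 : 0 < Num.min r (Num.min r0 e) by rewrite !lt_min r_gt0 r0_gt0.
have u0 : 0 < u by rewrite divr_gt0.
have : u < Num.min r (Num.min r0 e) by rewrite ltr_pdivrMr// ltr_pMr// ltr1n.
rewrite !lt_min => /and3P[ur ur0 ue].
have [|y xy yu] := onto u; first by rewrite ltW.
have xyu : mdist x y = u.
  by rewrite metric_sym -iso ?mdistxx// phix subr0 yu ger0_norm// ltW.
exists y; split; last by apply: eB; rewrite xyu.
have [|yx|//] := near0 y; first by rewrite xyu.
by move: xyu; rewrite yx mdistxx => uE; rewrite -uE ltxx in u0.
Qed.

(** Points of the geodesic at the same small distance on either side of [x] have the same chart
    value, namely that distance; an isometry would identify them. *)
Lemma boundary_point_no_geodesic x (l b : R) (gam : R -> X) :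
  boundary_point x -> unit_speed l gam -> 0 < b < l -> gam b != x.
Proof.
move=> [r [phi [r0 iso phix ge0 onto]]] ul /andP[b0 bl]; apply/eqP => bx.
pose s := Num.min (Num.min b (l - b)) r / 2.
have m0 : 0 < Num.min (Num.min b (l - b)) r by rewrite !lt_min b0 subr_gt0 bl r0.
have s0 : 0 < s by rewrite divr_gt0.
have : s < Num.min (Num.min b (l - b)) r by rewrite ltr_pdivrMr// ltr_pMr// ltr1n.
rewrite !lt_min => /andP[/andP[sb sl] sr].
have d1 : mdist x (gam (b - s)) = s.
  rewrite -bx ul ?opprB; first by rewrite addrC subrK gtr0_norm.
    by apply/andP; split; lra.
  by apply/andP; split; lra.
have d2 : mdist x (gam (b + s)) = s.
  rewrite -bx ul; first by rewrite opprD addrA subrr sub0r normrN gtr0_norm.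
    by apply/andP; split; lra.
  by apply/andP; split; lra.
have phiE y : mdist x y < r -> phi y = mdist x y.
  by move=> xy; rewrite metric_sym -iso ?mdistxx// phix subr0 ger0_norm// ge0.
have : mdist (gam (b - s)) (gam (b + s)) = 0.
  by rewrite -iso ?d1 ?d2// !phiE ?d1 ?d2// subrr normr0.
rewrite ul; first by move/normr0_eq0; lra.
  by apply/andP; split; lra.
by apply/andP; split; lra.
Qed.

Lemma geo_unit_speed (g : geo X) : 0 < geo_length g ->
  exists gam, [/\ unit_speed (geo_length g) gam, gam 0 = geo_start g,
    gam (geo_length g) = geo_end g & forall t : {i01 R}, g t = gam (t%:num * geo_length g)].
Proof.
move=> L0; pose L := geo_length g.
have ex (a : R) : exists t : {i01 R}, 0 <= a <= L -> t%:num = a / L.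
  have [aL|aL] := boolP (0 <= a <= L); last by exists 0%:i01.
  have aL' : 0 <= a / L <= 1.
    by case/andP: aL => ? ?; rewrite divr_ge0//= ?(ltW L0)// ler_pdivrMr// mul1r.
  by exists (Itv01 (proj1 (andP aL')) (proj2 (andP aL'))).
have [t tP] := choice ex.
have LL : 0 <= L <= L by rewrite lexx ltW.
have L00 : (0 : R) <= 0 <= L by apply/andP; split=> //; exact: ltW.
exists (g \o t); split.
- move=> a b aL bL /=; rewrite geo_speed -[X in _ * X]/L !tP//.
  by rewrite -mulrBl normrM (gtr0_norm (_ : 0 < L^-1)) ?invr_gt0// divfK// gt_eqF.
- by rewrite /= /geo_start; congr (g _); apply/val_inj => /=; rewrite tP// mul0r.
- by rewrite /= /geo_end; congr (g _); apply/val_inj => /=; rewrite tP// divff// gt_eqF.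
- move=> s /=; congr (g _); apply/val_inj => /=; rewrite tP ?mulfK ?gt_eqF//.
  by rewrite mulr_ge0 ?(ltW L0)//= ler_piMl// ltW.
Qed.

End charts.

Section branch.
Context {R : realType} {X : metricType R}.
Variables (q : X) (l : R) (gam : R -> X).
Hypotheses (l0 : 0 < l) (ul : unit_speed l gam) (gam0 : gam 0 = q).
Hypothesis gam_int : forall a : R, 0 < a < l -> interior_point (gam a).

Definition on_curve (z : X) := exists2 a : R, 0 <= a <= l & z = gam a.

Lemma dist_gam (a : R) : 0 <= a <= l -> mdist q (gam a) = a.
Proof.
move=> /andP[a0 al]; rewrite -gam0 ul ?lexx ?(ltW l0) ?a0//.
by rewrite sub0r normrN ger0_norm.
Qed.

(** In an interval only two points lie at a given distance from the centre, and the curve already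
    passes through both. *)
Lemma gam_open (a : R) : 0 < a < l -> exists2 d : R, 0 < d & forall z, mdist (gam a) z < d ->
  exists2 b : R, 0 < b < l & z = gam b.
Proof.
move=> /[dup] al /andP[a0 al']; have [r [phi [r0 iso onto]]] := gam_int al.
exists (Num.min r (Num.min a (l - a))); first by rewrite !lt_min r0 a0 subr_gt0.
move=> z; rewrite !lt_min => /and3P[zr za zl].
have [u uE] : {u : R | mdist (gam a) z = u} by exists (mdist (gam a) z).
have u0 : 0 <= u by rewrite -uE mdist_ge0.
rewrite uE in za zl.
have aI : 0 <= a <= l by rewrite !ltW.
have i1 : 0 <= a + u <= l by apply/andP; split; lra.
have i2 : 0 <= a - u <= l by apply/andP; split; lra.
have d1 : mdist (gam a) (gam (a + u)) = u.
  by rewrite ul// opprD addrA subrr sub0r normrN ger0_norm.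
have d2 : mdist (gam a) (gam (a - u)) = u.
  by rewrite ul// opprB addrC subrK ger0_norm.
have d3 : mdist (gam (a - u)) (gam (a + u)) = u + u.
  by rewrite ul// opprD addrACA subrr add0r -opprD normrN ger0_norm// addr_ge0.
have aa : mdist (gam a) (gam a) < r by rewrite mdistxx.
have n1 := iso (gam a) z aa zr.
have n2 := iso (gam a) (gam (a + u)) aa; rewrite d1 in n2.
have n3 := iso (gam a) (gam (a - u)) aa; rewrite d2 in n3.
have n4 := iso (gam (a - u)) (gam (a + u)); rewrite d1 d2 d3 in n4.
have ur : u < r by rewrite -uE.
have {}n2 := n2 ur; have {}n3 := n3 ur; have {}n4 := n4 ur ur.
have : phi z = phi (gam (a + u)) \/ phi z = phi (gam (a - u)).
  move: n1 n2 n3 n4; rewrite uE.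
  set A := phi z; set B := phi (gam a); set C := phi (gam (a + u)); set D := phi _.
  move: A B C D => A B C D; clear -u0.
  by case: (ler0P (B - A)) => ?; case: (ler0P (B - C)) => ?; case: (ler0P (B - D)) => ?;
     case: (ler0P (D - C)) => ? *; lra.
have eq0 w : mdist (gam a) w < r -> phi z = phi w -> z = w.
  by move=> ar zw; apply: mdist_positivity; rewrite -iso// zw subrr normr0.
case=> /eq0 => [|]; rewrite ?d1 ?d2 => /(_ ur) zE.
  by exists (a + u) => //; apply/andP; split; lra.
by exists (a - u) => //; apply/andP; split; lra.
Qed.

(** The curve point to compare with [z] is the one at the same distance from [q], capped at [l]: any
    curve point close to [z] is close to that one too. *)
Lemma off_curve_open z : ~ on_curve z ->
  exists2 e : R, 0 < e & forall y, mdist z y < e -> ~ on_curve y.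
Proof.
move=> nz; pose t := Num.min (mdist q z) l.
have tl : 0 <= t <= l by rewrite le_min mdist_ge0 (ltW l0)/= ge_min lexx orbT.
have zt : 0 < mdist z (gam t).
  by rewrite mdist_gt0; apply/eqP => zE; apply: nz; exists t.
exists (mdist z (gam t) / 2); first by rewrite divr_gt0.
move=> y zy [a al yE].
have h1 := metric_triangle z (gam a) (gam t); rewrite (ul al tl) in h1.
have h2 := mdist_triangle_sub q z (gam a); rewrite (dist_gam al) in h2.
have h3 : `|a - t| <= `|mdist q z - a|.
  rewrite /t; case/andP: al => a0 al; case: (leP (mdist q z) l) => ql.
    by rewrite distrC.
  have -> : `|a - l| = l - a by rewrite ler0_norm ?opprB// subr_le0.
  by rewrite ger0_norm; lra.
rewrite yE in zy; lra.
Qed.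

Variables (m : R) (h : R -> X).
Hypotheses (m0 : 0 <= m) (uh : unit_speed m h).

(** Consider the last time at which [h] is on the curve. By [gam_open] it does not leave at an
    interior point, and leaving at [gam l] would be too long; so it leaves at [q], which it reaches
    after length [a]. *)
Lemma off_curve_dist (a : R) : 0 <= a <= l -> h 0 = gam a -> ~ on_curve (h m) ->
  a + mdist q (h m) < l -> m = mdist q (h m) + a /\ h a = q.
Proof.
move=> al h0 nm alt.
have mm : 0 <= m <= m by rewrite lexx m0.
have m00 : (0 : R) <= 0 <= m by apply/andP.
pose S := [set s | 0 <= s <= m /\ on_curve (h s)].
have S0 : S 0 by split => //; exists a.
have hS : has_sup S by split; [exists 0|exists m => s [/andP[]]].
pose s := sup S.
have s0 : 0 <= s by exact: (sup_upper_bound hS S0).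
have sm : s <= m by apply: ge_sup; [exists 0|move=> u [/andP[]]].
have sI : 0 <= s <= m by rewrite s0 sm.
have Ss : on_curve (h s).
  apply: contrapT => /off_curve_open[e e0 eP].
  have [u Su su] := sup_adherent e0 hS.
  case: (Su) => uI; apply: eP; rewrite uh//.
  have us : u <= s by exact: (sup_upper_bound hS Su).
  by rewrite ger0_norm ?subr_ge0//; rewrite -/s in su; lra.
have slt : s < m.
  by rewrite lt_neqAle sm andbT; apply/eqP => sE; apply: nm; rewrite -sE.
have [b bl sE] := Ss; have /andP[b0 bl'] := bl; have /andP[a0 al'] := al.
have nb : ~ (0 < b < l).
  move=> /gam_open[d d0 dP].
  pose u := Num.min (d / 2) (m - s).
  have u0 : 0 < u by rewrite lt_min divr_gt0// subr_gt0.
  have um : u <= m - s by rewrite /u ge_min lexx orbT.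
  have ud : u < d.
    by apply: (@le_lt_trans _ _ (d / 2)); [rewrite /u ge_min lexx|rewrite ltr_pdivrMr// ltr_pMr// ltr1n].
  have : S (s + u).
    have suI : 0 <= s + u <= m by apply/andP; split; lra.
    split=> //; have [|c /andP[c0 cl] cE] := dP (h (s + u)).
      by rewrite -sE uh// opprD addrA subrr sub0r normrN gtr0_norm.
    by exists c => //; rewrite !ltW.
  by move=> /(sup_upper_bound hS); rewrite -/s; lra.
have d1 : mdist (gam a) (gam b) = s.
  by rewrite -h0 -sE uh// sub0r normrN ger0_norm.
have d2 : mdist (gam b) (h m) = m - s.
  by rewrite -sE uh// distrC ger0_norm// subr_ge0.
have d3 : mdist (gam a) (h m) = m by rewrite -h0 uh// sub0r normrN ger0_norm.
have tr := metric_triangle (gam a) q (h m); rewrite d3 metric_sym dist_gam// in tr.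
have [bE|b0'] := eqVneq b 0.
  rewrite bE gam0 in d1 d2 sE; rewrite metric_sym dist_gam// in d1.
  by split; [lra|rewrite d1].
have bE : b = l.
  apply/eqP; rewrite eq_le bl'/= leNgt; apply/negP => bl2; apply: nb.
  by rewrite lt_neqAle eq_sym b0' b0.
rewrite ul// bE ler0_norm ?subr_le0// in d1.
have := metric_triangle q (h m) (gam b); rewrite dist_gam// (metric_sym (h m)) d2 bE => tr2.
by exfalso; lra.
Qed.

End branch.

Section dichotomy.
Context {R : realType} {X : metricType R}.
Variables (q : X) (l : R) (gam : R -> X).
Hypotheses (l0 : 0 < l) (ul : unit_speed l gam) (gam0 : gam 0 = q).
Hypothesis gam_int : forall a : R, 0 < a < l -> interior_point (gam a).

Lemma unit_speed_of_geo (y z : X) (g : geo X) : geo_start g = y -> geo_end g = z ->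
  exists h, [/\ unit_speed (mdist y z) h, h 0 = y & h (mdist y z) = z].
Proof.
move=> gy gz; have lE : geo_length g = mdist y z by rewrite /geo_length gy gz.
have [yz|yz] := eqVneq y z.
  exists (fun=> y); rewrite yz mdistxx; split=> // a b.
  rewrite -!eq_le => /eqP<- /eqP<-; by rewrite mdistxx subrr normr0.
have [|h [uh h0 h1 _]] := @geo_unit_speed R X g; first by rewrite lE mdist_gt0.
by exists h; rewrite -lE -gy -gz.
Qed.

Variable r : R.
Hypothesis r0 : 0 < r.
Hypothesis geo_ex : forall y z, mdist q y < r -> mdist q z < r ->
  exists g : geo X, geo_start g = y /\ geo_end g = z.

Lemma branch_dist z (a : R) : ~ on_curve l gam z -> mdist q z < r -> a < r ->
  0 <= a -> a + mdist q z < l -> mdist (gam a) z = mdist q z + a.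
Proof.
move=> nz zr ar a0 azl.
have al : 0 <= a <= l by have := mdist_ge0 q z; rewrite a0 /=; lra.
have [|//|g [gs ge]] := geo_ex (y := gam a) (z := z).
  by rewrite (dist_gam l0 ul gam0).
have [h [uh h0 h1]] := unit_speed_of_geo gs ge.
have [||E _] := off_curve_dist l0 ul gam0 gam_int (mdist_ge0 _ _) uh al h0.
- by rewrite h1.
- by rewrite h1.
by rewrite {1}E h1.
Qed.

(** If all points near [q] lie on the curve, the distance from [q] is a boundary chart. Otherwise a
    geodesic [eta] from [q] to an off-curve point stays off the curve; if the curve and [eta] fill a
    neighbourhood, they join to an interval around [q]. If not, a point missed by both is paired
    with the point of [eta] at the same distance from [q]. *)
Lemma branch_dichotomy : [\/ interior_point q, boundary_point q |
  forall e : R, 0 < e -> exists w1 w2, [/\ w1 != w2, mdist q w1 = mdist q w2,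
    0 < mdist q w1 < e, ~ on_curve l gam w1 & ~ on_curve l gam w2]].
Proof.
have [[e e0 eP]|H1] := pselect (exists2 e : R, 0 < e &
    forall z, mdist q z < e -> on_curve l gam z).
  apply: Or32; pose s := Num.min e l.
  have s0 : 0 < s by rewrite lt_min e0.
  have onc z : mdist q z < s -> on_curve l gam z.
    by rewrite lt_min => /andP[ze _]; exact: eP.
  have dE := dist_gam l0 ul gam0.
  exists s, (mdist q); split => //.
  - by move=> _ _ /onc[a al ->] /onc[b bl ->]; rewrite !dE// ul.
  - by rewrite mdistxx.
  - by move=> y _; exact: mdist_ge0.
  - move=> u /andP[u0]; rewrite lt_min => /andP[ue ul'].
    have uI : 0 <= u <= l by rewrite u0 ltW.
    by exists (gam u); rewrite dE// lt_min ue.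
have {}H1 (e : R) : 0 < e -> exists2 z, mdist q z < e & ~ on_curve l gam z.
  move=> e0; apply: contrapT => H; apply: H1; exists e => // z ze.
  by apply: contrapT => nz; apply: H; exists z.
have m4 : 0 < Num.min r (l / 2) by rewrite lt_min r0 divr_gt0.
have [z1 + n1] := H1 _ m4; rewrite lt_min => /andP[z1r z1l].
have nq z : ~ on_curve l gam z -> 0 < mdist q z.
  move=> nz; rewrite mdist_gt0; apply/eqP => qz; apply: nz; exists 0.
    by rewrite lexx ltW.
  by rewrite gam0.
pose T := mdist q z1; have T0 : 0 < T by exact: nq.
have [|//|g [gs ge]] := geo_ex (y := q) (z := z1); first by rewrite mdistxx.
have [eta [ueta eta0 etaT]] := unit_speed_of_geo gs ge; rewrite -/T in ueta etaT.
have T00 : (0 : R) <= 0 <= T by apply/andP; split=> //; exact: ltW.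
have TT : 0 <= T <= T by rewrite lexx ltW.
have deta (b : R) : 0 <= b <= T -> mdist q (eta b) = b.
  by move=> /[dup] bT /andP[b0 _]; rewrite -eta0 ueta// sub0r normrN ger0_norm.
have eta_off (b : R) : 0 < b <= T -> ~ on_curve l gam (eta b).
  move=> /andP[b0 bT] [a al aE].
  have bI : 0 <= b <= T by rewrite bT ltW.
  have ab : a = b by rewrite -(deta b bI) aE (dist_gam l0 ul gam0).
  have D : mdist (eta b) z1 = T - b.
    by rewrite -{1}etaT ueta// ler0_norm ?subr_le0// opprB.
  have := branch_dist (a := a) n1 z1r; rewrite -aE D -/T => H.
  have /H : a < r by rewrite ab (le_lt_trans bT).
  have za : a + T < l by rewrite ab; move: z1l; rewrite -/T; lra.
  by move=> /(_ ltac:(lra) za); lra.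
have [[e e0 eP]|H2] := pselect (exists2 e : R, 0 < e & forall z, mdist q z < e ->
    on_curve l gam z \/ exists2 b : R, 0 <= b <= T & z = eta b).
  apply: Or31.
  pose s := Num.min (Num.min e r) (Num.min T (l / 2)).
  have s0 : 0 < s by rewrite !lt_min e0 r0 T0 divr_gt0.
  have onc z : mdist q z < s -> (exists2 a : R, 0 <= a <= l /\ a < s & z = gam a) \/
      (exists2 b : R, 0 < b <= T /\ b < s & z = eta b).
    move=> zs; have := zs; rewrite !lt_min => /andP[/andP[ze _] _].
    have [[a al zE]|[b bT zE]] := eP z ze.
      by left; exists a => //; split => //; rewrite -(dist_gam l0 ul gam0 al) -zE.
    have [b00|b0] := eqVneq b 0.
      left; exists 0; first by rewrite lexx (ltW l0).
      by rewrite zE b00 eta0 gam0.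
    right; exists b => //; case/andP: bT => b0' bT; split; last first.
      by rewrite -(deta b) ?b0'// -zE.
    by apply/andP; split=> //; rewrite lt_neqAle eq_sym b0.
  have cross (a b : R) : 0 <= a <= l -> a < s -> 0 < b <= T -> b < s ->
      mdist (gam a) (eta b) = a + b.
    move=> /andP[a0 al]; rewrite !lt_min => /andP[/andP[ae ar] /andP[aT al2]] bT.
    move=> /andP[/andP[be br] /andP[bT' bl2]].
    have bI : 0 <= b <= T by case/andP: bT => ? ->; rewrite ltW.
    by rewrite branch_dist ?deta//; [rewrite addrC|exact: eta_off|lra].
  (* The chart is the distance from [q] with a negative sign along the curve; [cross] makes it an
     isometry. *)
  pose phi z := if asbool (on_curve l gam z) then - mdist q z else mdist q z.
  have phi1 (a : R) : 0 <= a <= l -> phi (gam a) = - a.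
    move=> al; rewrite /phi; case: asboolP => [_|]; first by rewrite (dist_gam l0 ul gam0).
    by case; exists a.
  have phi2 (b : R) : 0 < b <= T -> phi (eta b) = b.
    move=> bT; rewrite /phi; case: asboolP => [/eta_off//|_].
    by rewrite deta//; case/andP: bT => ? ->; rewrite ltW.
  have phiq : phi q = 0 by rewrite -gam0 phi1 ?oppr0// lexx ltW.
  exists s, phi; split => //.
    move=> _ _ /onc[[a [al as_] ->]|[a [al as_] ->]] /onc[[b [bl bs] ->]|[b [bl bs] ->]].
    - by rewrite !phi1// ul// opprK addrC distrC.
    - rewrite phi1// phi2// cross// -opprD normrN ger0_norm//.
      by case/andP: al => ? _; case/andP: bl => ? _; rewrite addr_ge0// ltW.
    - rewrite phi1// phi2// metric_sym cross// opprK addrC ger0_norm//.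
      by case/andP: al => ? _; case/andP: bl => ? _; rewrite addr_ge0// ltW.
    - rewrite !phi2// ueta//.
        by case/andP: al => ? ->; rewrite ltW.
      by case/andP: bl => ? ->; rewrite ltW.
  move=> u; rewrite phiq subr0 ltr_norml => /andP[us1 us2].
  have us : `|u| < s by rewrite ltr_norml us1.
  have [u0|u0] := leP u 0.
    have uI : 0 <= - u <= l.
      by move: us; rewrite ler0_norm// !lt_min => /andP[_ /andP[_ ?]]; lra.
    exists (gam (- u)); last by rewrite phi1// opprK.
    by rewrite (dist_gam l0 ul gam0)//; lra.
  have uI : 0 < u <= T.
    by move: us; rewrite gtr0_norm// !lt_min => /andP[_ /andP[? _]]; lra.
  exists (eta u); last by rewrite phi2.
  by rewrite deta//; case/andP: uI => ? ->; rewrite ltW.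
apply: Or33 => e e0.
have m0 : 0 < Num.min e T by rewrite lt_min e0.
have [z2 [+ nz2 nz2']] : exists z2, [/\ mdist q z2 < Num.min e T,
    ~ on_curve l gam z2 & ~ exists2 b : R, 0 <= b <= T & z2 = eta b].
  apply: contrapT => H; apply: H2; exists (Num.min e T) => // z ze.
  by apply: contrapT => /not_orP[nz1 nz]; apply: H; exists z.
rewrite lt_min => /andP[z2e z2T].
have t0 := nq _ nz2.
have tI : 0 <= mdist q z2 <= T by rewrite mdist_ge0 ltW.
exists z2, (eta (mdist q z2)); split => //.
- by apply/eqP => zE; apply: nz2'; exists (mdist q z2).
- by rewrite deta.
- by rewrite t0.
- by apply: eta_off; rewrite t0 ltW.
Qed.

End dichotomy.

(** * Charts at every point *)

Section manifold.
Context {R : realType} {X : metricType R}.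

Lemma separable_second_countable (D : set X) : countable D -> dense D ->
  @second_countable X.
Proof.
move=> cD dD; pose f (n : nat) (x : X) : set X := [set y | mdist x y < n.+1%:R^-1].
exists (\bigcup_n (f n @` D)); last split.
- apply: bigcup_countable => // n _.
  exact: sub_countable (card_image_le _ _) cD.
- by move=> _ [n _ [x _ <-]]; exact: open_mdist_lt.
- move=> x V /nbhs_mdist[e e0 eV].
  have e2 : 0 < e / 2 by rewrite divr_gt0.
  have [n nP] := invS_lt e2.
  have n0 : 0 < (n.+1%:R : R)^-1 by rewrite invr_gt0.
  have [w [/= wx Dw]] : [set y | mdist x y < n.+1%:R^-1] `&` D !=set0.
    apply: dD; last exact: open_mdist_lt.
    by exists x; rewrite /= mdistxx.
  exists (f n w).
    by split; [exists n => //; exists w|rewrite /f /= metric_sym].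
  move=> y; rewrite /f/= => wy; apply: eV.
  rewrite (le_lt_trans (metric_triangle x w y))// (splitr e) ltrD//; exact: lt_trans nP.
Qed.

Lemma isometry_homeomorphic (U : set X) (B : set R) (f : X -> R) (x0 : X) :
  (forall y z, U y -> U z -> `|f y - f z| = mdist y z) -> f @` U = B ->
  homeomorphic_sets U B.
Proof.
move=> iso fU.
have ex (u : R) : exists y, B u -> U y /\ f y = u.
  have [|nB] := pselect (B u); last by exists x0.
  by rewrite -fU => -[y Uy yu]; exists y.
have [g gP] := choice ex.
exists f, g; split.
- split; first by move=> y Uy; rewrite -fU; exists y.
  by move=> u /gP[].
- move=> y; rewrite inE => Uy.
  have [Ug fg] : U (g (f y)) /\ f (g (f y)) = f y by apply: gP; rewrite -fU; exists y.
  by apply: mdist_positivity; rewrite -iso// fg subrr normr0.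
- by move=> u; rewrite inE => /gP[].
- apply/subspace_continuousP => y Uy; apply/cvgrPdist_lt => e e0.
  rewrite near_withinE; apply/nbhs_mdist; exists e => // z yz Uz.
  by rewrite iso.
- apply/subspace_continuousP => u Bu.
  apply/(@metricType_numDomainType.cvgrPdist_lt _ X) => e e0.
  rewrite near_withinE; apply/nbhs_ballP; exists e => // v uv Bv.
  have [Uu fu] := gP u Bu; have [Uv fv] := gP v Bv.
  by rewrite -iso// fu fv.
Qed.

Lemma one_manifold_of_charts (D : set X) : countable D -> dense D ->
  (forall x : X, interior_point x \/ boundary_point x) ->
  one_manifold_with_boundary R X.
Proof.
move=> cD dD H; split.
- exact: metric_hausdorff.
- exact: separable_second_countable cD dD.
move=> x; have [[r [phi [r0 iso onto]]]|[r [phi [r0 iso phix ge0 onto]]]] := H x.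
  (* The chart is shifted so that its image avoids the end of the half-line; at a boundary point,
     []-1, r[] will cut [[0, r[] out of the half-line. *)
  exists [set y | mdist x y < r], `]0, 2 * r[%classic; split.
  - by split; [exact: open_mdist_lt|rewrite /= mdistxx].
  - exact: interval_open.
  - apply: (@isometry_homeomorphic _ _ (fun y => phi y - phi x + r) x).
      by move=> y z /= xy xz; rewrite -iso//; congr `|_|; ring.
    have x0 : mdist x x < r by rewrite mdistxx.
    apply/seteqP; split=> [_ [y /= xy <-]|u [/=]].
      have := iso y x xy x0; rewrite metric_sym => E; rewrite !in_itv/=.
      have : `|phi y - phi x| < r by rewrite E.
      by rewrite ltr_norml => /andP[? ?]; split; apply/andP; split; lra.
    rewrite !in_itv/= => /andP[u0 ur] _.
    have [|y xy yE] := onto (u + phi x - r).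
      by rewrite ltr_norml; apply/andP; split; lra.
    by exists y => //; rewrite yE; ring.
exists [set y | mdist x y < r], `]-1, r[%classic; split.
- by split; [exact: open_mdist_lt|rewrite /= mdistxx].
- exact: interval_open.
- apply: (@isometry_homeomorphic _ _ phi x) => //.
  have x0 : mdist x x < r by rewrite mdistxx.
  apply/seteqP; split=> [_ [y /= xy <-]|u [/=]].
    have := iso y x xy x0; rewrite phix subr0 metric_sym ger0_norm ?ge0// => E.
    by rewrite !in_itv/= E mdist_ge0; split=> //; rewrite xy andbT (lt_le_trans (ltrN10 _))// mdist_ge0.
  rewrite !in_itv/= andbT => /andP[u1 ur] u0.
  by have [|y xy yE] := onto u; [rewrite u0|exists y].
Qed.

Hypothesis lX : length_space X.
Hypothesis lcX : locally_compact [set: X].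

Lemma local_compact_ball (p : X) :
  exists2 r : R, 0 < r & compact [set y | mdist p y <= r].
Proof.
have [U] := lcX (x := p) I; rewrite /within/= => /nbhs_mdist[e e0 eU] [cU _].
exists (e / 2); first by rewrite divr_gt0.
apply: subclosed_compact cU _; first exact: closed_mdist_le.
by move=> y /= ye; apply: eU => //; rewrite (le_lt_trans ye)// ltr_pdivrMr// ltr_pMr// ltr1n.
Qed.

Lemma local_geodesics (p : X) : exists2 r : R, 0 < r &
  forall y z, mdist p y < r -> mdist p z < r ->
  exists g : geo X, geo_start g = y /\ geo_end g = z.
Proof.
(* Points no farther from [y] than [z] is lie within [r / 3 + 2 * r / 3] of [p]. *)
have [r r0 cr] := local_compact_ball p; exists (r / 3); first by rewrite divr_gt0.
move=> y z py pz; apply: geodesic_exists cr _ => // w /= yw.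
have := metric_triangle p y w; have := metric_triangle y p z.
rewrite (metric_sym y p); lra.
Qed.

(** Curvature enters the construction of charts only here: it rules out the third case of
    [branch_dichotomy]. *)
Hypothesis core : forall (q : X) (l : R) (gam : R -> X), 0 < l ->
  unit_speed l gam -> gam 0 = q ->
  (forall a : R, 0 < a < l -> interior_point (gam a)) ->
  ~ (forall e : R, 0 < e -> exists w1 w2, [/\ w1 != w2, mdist q w1 = mdist q w2,
    0 < mdist q w1 < e, ~ on_curve l gam w1 & ~ on_curve l gam w2]).

Lemma interior_ray_end (q : X) (l : R) (gam : R -> X) : 0 < l ->
  unit_speed l gam -> gam 0 = q ->
  (forall a : R, 0 < a < l -> interior_point (gam a)) ->
  interior_point q \/ boundary_point q.
Proof.
move=> l0 ul g0 gi; have [r r0 geo_ex] := local_geodesics q.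
have [|?|/(core l0 ul g0 gi)//] := branch_dichotomy l0 ul g0 gi r0 geo_ex; by [left|right].
Qed.

(** On a geodesic from [p] to an interior point take the last point that is not interior. It ends a
    ray of interior points, so it is a boundary point; no boundary point is inside a geodesic, hence
    it is [p] itself. *)
Lemma interior_closure (p : X) : closure [set x : X | interior_point x] p ->
  interior_point p \/ boundary_point p.
Proof.
move=> clp; have [ip|nip] := pselect (interior_point p); first by left.
have [r r0 geo_ex] := local_geodesics p.
have [y [/= iy py]] : [set x : X | interior_point x] `&` [set y | mdist p y < r] !=set0.
  by apply: clp; apply/nbhs_mdist; exists r.
have [|//|g [gs ge]] := geo_ex p y; first by rewrite mdistxx.
have [gam [ul gam0 gamL]] := unit_speed_of_geo gs ge.
pose L := mdist p y; rewrite -/L in ul gamL.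
have L0 : 0 < L by rewrite mdist_gt0; apply/eqP => pyE; rewrite pyE in nip.
pose S := [set a : R | 0 <= a <= L /\ ~ interior_point (gam a)].
have S0 : S 0 by split; [rewrite lexx ltW|rewrite gam0].
have hS : has_sup S by split; [exists 0|exists L => s [/andP[]]].
pose b := sup S.
have b0 : 0 <= b by exact: (sup_upper_bound hS S0).
have bL : b <= L by apply: ge_sup; [exists 0|move=> u [/andP[]]].
have bI : 0 <= b <= L by rewrite b0 bL.
have nb : ~ interior_point (gam b).
  have /open_mdist oI := @open_interior_point R X.
  move=> /oI[e e0 eI]; have [u Su su] := sup_adherent e0 hS.
  case: (Su) => uI; apply; apply: eI; rewrite ul//.
  have us : u <= b by exact: (sup_upper_bound hS Su).
  by rewrite ger0_norm ?subr_ge0//; rewrite -/b in su; lra.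
have bltL : b < L.
  by rewrite lt_neqAle bL andbT; apply/eqP => bE; apply: nb; rewrite bE gamL.
have gi (a : R) : 0 < a < L - b -> interior_point (gam (b + a)).
  move=> /andP[a0 aL]; apply: contrapT => na.
  have /(sup_upper_bound hS) : S (b + a) by split=> //; apply/andP; split; lra.
  by rewrite -/b; lra.
have [||||//|bq] := @interior_ray_end (gam b) (L - b) (fun a => gam (b + a)).
- by rewrite subr_gt0.
- move=> u v /andP[? ?] /andP[? ?]; rewrite ul; first by rewrite opprD addrACA subrr add0r.
    by apply/andP; split; lra.
  by apply/andP; split; lra.
- by rewrite addr0.
- exact: gi.
have [b00|b0'] := eqVneq b 0; first by right; rewrite -gam0 -b00.
have /eqP : gam b != gam b.
  by apply: (boundary_point_no_geodesic bq ul); rewrite bltL lt_neqAle eq_sym b0' b0.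
by [].
Qed.

Lemma all_points_chart : (exists x : X, interior_point x) ->
  forall x : X, interior_point x \/ boundary_point x.
Proof.
move=> ex; pose A := [set x : X | interior_point x \/ boundary_point x].
have AE : A = closure [set x : X | interior_point x].
  apply/seteqP; split=> [x [ix|/boundary_point_limit//]|x /interior_closure//].
  exact: subset_closure.
have oA : open A.
  apply/open_mdist => x [ix|/[dup] bx /boundary_point_near[r r0 rP]].
    have /open_mdist oI := @open_interior_point R X.
    by have [e e0 eI] := oI x ix; exists e => // y /eI; left.
  by exists r => // y /rP[->|]; [right|left].
suff AT : A = [set: X] by move=> x; have : A x by rewrite AT.
apply: (length_space_connected lX).
- by case: ex => x ix; exists x; left.
- by exists A => //; rewrite setTI.
- by exists A; rewrite ?setTI// AE; exact: closed_closure.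
Qed.

End manifold.

(** * Inner regularity and measurable selection *)

Lemma borel_open (T : ptopologicalType) (A : set T) : open A ->
  measurable (A : set (borel T)).
Proof. by move=> oA; exact: sub_sigma_algebra. Qed.

Lemma borel_closed (T : ptopologicalType) (A : set T) : closed A ->
  measurable (A : set (borel T)).
Proof.
by move=> cA; rewrite -(setCK A); apply: measurableC; apply: borel_open; exact: closed_openC.
Qed.

Lemma measure_bigcap_small d (T : measurableType d) (R : realType)
    (mu : {measure set T -> \bar R}) (F : (set T)^nat) (e : \bar R) :
  (mu (F 0%N) < +oo)%E -> (forall n, measurable (F n)) -> nonincreasing_seq F ->
  (mu (\bigcap_n F n) < e)%E -> exists n, (mu (F n) < e)%E.
Proof.
move=> F0 mF niF Fe.
have mc : measurable (\bigcap_n F n) by exact: bigcap_measurableType.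
have /= cF := nonincreasing_cvg_mu F0 mF mc niF.
have : nbhs (mu (\bigcap_n F n)) (fun u => (u < e)%E) by exact: open_ereal_lt'.
by move=> /cF [n _ /(_ n (leqnn n))]; exists n.
Qed.

Section inner_regularity.
Context {R : realType} {T : pmetricType R}.
Variable mu : {finite_measure set (borel T) -> \bar R}.

(** Approximation from both sides, unlike inner approximation alone, is stable under complement and
    so suits an induction over the sigma-algebra. *)
Definition squeezed (A : set T) := measurable (A : set (borel T)) /\
  forall e : R, 0 < e -> exists F U : set T, [/\ closed F, open U, F `<=` A, A `<=` U &
    (mu (U `\` F) < e%:E)%E].

Let mu_fin (A : set T) : measurable (A : set (borel T)) -> (mu A < +oo)%E.
Proof. by move=> mA; rewrite ltey_eq fin_num_measure. Qed.

Lemma squeezed_open A : open A -> squeezed A.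
Proof.
move=> oA; split; first exact: borel_open.
move=> e e0; pose F (n : nat) := [set x | forall y, mdist x y < n.+1%:R^-1 -> A y].
have cF n : closed (F n).
  rewrite -(setCK (F n)); apply: open_closedC; apply/open_mdist => x.
  move=> /existsNP[y /not_implyP[xy nAy]].
  exists (n.+1%:R^-1 - mdist x y); first by rewrite subr_gt0.
  move=> z xz Fz; apply: nAy; apply: Fz.
  by rewrite (le_lt_trans (metric_triangle z x y))// metric_sym -ltrBrDr.
have mG n : measurable (A `\` F n : set (borel T)).
  by apply: measurableD; [exact: borel_open|exact: borel_closed].
have [||||n nP] := @measure_bigcap_small _ _ _ mu (fun n => A `\` F n) e%:E.
- exact: mu_fin.
- exact: mG.
- apply/nonincreasing_seqP => n; apply/subsetPset => x [Ax nF]; split => //.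
  apply: contra_not nF => Fx y xy; apply: Fx; apply: lt_le_trans xy _.
  by rewrite lef_pV2 ?posrE// ler_nat.
- rewrite (_ : \bigcap_n _ = set0) ?measure0//.
  apply/seteqP; split=> // x Gx; have [Ax _] := Gx 0%N I.
  have /open_mdist oA' := oA; have [d d0 dA] := oA' x Ax.
  have [n nP] := invS_lt d0.
  have [_] := Gx n I; apply => y xy; apply: dA; exact: lt_trans nP.
exists (F n), A; split => //.
by move=> x Fx; apply: Fx; rewrite mdistxx invr_gt0.
Qed.

Lemma squeezedC A : squeezed A -> squeezed (~` A).
Proof.
move=> [mA H]; split; first exact: measurableC.
move=> e /H[F [U [cF oU FA AU muUF]]]; exists (~` U), (~` F); split.
- exact: open_closedC.
- exact: closed_openC.
- exact: subsetC.
- exact: subsetC.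
- by rewrite setDE setCK setIC -setDE.
Qed.

Lemma squeezed_bigcup (A : (set T)^nat) : (forall n, squeezed (A n)) ->
  squeezed (\bigcup_n A n).
Proof.
move=> H; split; first by apply: bigcupT_measurable => n; case: (H n).
move=> e e0.
have eps n : 0 < e / 2 / (2 ^ n.+1)%:R.
  by rewrite divr_gt0 ?divr_gt0// ltr0n expn_gt0.
have ex n : exists FU : set T * set T, [/\ closed FU.1, open FU.2, FU.1 `<=` A n,
    A n `<=` FU.2 & (mu (FU.2 `\` FU.1) < (e / 2 / (2 ^ n.+1)%:R)%:E)%E].
  by have [_ /(_ _ (eps n))[F [U FU]]] := H n; exists (F, U).
have [FU FUP] := choice ex.
(* Only finitely many closed sets are united, to keep the union closed; continuity from above
   absorbs the remaining ones into the other half of [e]. *)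
pose U := \bigcup_n (FU n).2; pose G n := \bigcup_(i < n) (FU i).1.
have oU : open U by apply: bigcup_open => n _; case: (FUP n).
have cG n : closed (G n).
  by apply: closed_bigcup => // i _; case: (FUP i).
have mUG n : measurable (U `\` G n : set (borel T)).
  by apply: measurableD; [exact: borel_open|exact: borel_closed].
have mD n : measurable ((FU n).2 `\` (FU n).1 : set (borel T)).
  by case: (FUP n) => *; apply: measurableD; [exact: borel_open|exact: borel_closed].
have [||||n nP] := @measure_bigcap_small _ _ _ mu (fun n => U `\` G n) e%:E.
- exact: mu_fin.
- exact: mUG.
- apply/nonincreasing_seqP => n; apply/subsetPset => x [Ax nF]; split => //.
  by apply: contra_not nF => -[i /= ni Fi]; exists i => //=; rewrite ltnS ltnW.
- apply: (@le_lt_trans _ _ (e / 2)%:E); last first.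
    by rewrite lte_fin ltr_pdivrMr// ltr_pMr// ltr1n.
  apply: (@le_trans _ _ (\sum_(n <oo) mu ((FU n).2 `\` (FU n).1))%E).
    apply: measure_sigma_subadditive => //; first exact: bigcap_measurableType.
    move=> x Hx; have [[n _ Un] _] := Hx 0%N I.
    by exists n => //; split => // Fx; have [_] := Hx n.+1 I; apply; exists n => /=.
  apply: le_trans (epsilon_trick0 xpredT _); last by rewrite ltW// divr_gt0.
  apply: lee_nneseries => // n _; case: (FUP n) => _ _ _ _ /ltW; exact: le_trans.
exists (G n), U; split => //.
- by move=> x [i _ Fx]; exists i => //; case: (FUP i) => _ _ + _ _; apply.
- by move=> x [i _ Ax]; exists i => //; case: (FUP i) => _ _ _ + _; apply.
Qed.

Lemma inner_regular (A : set T) (e : R) : measurable (A : set (borel T)) -> 0 < e ->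
  exists F, [/\ closed F, F `<=` A & (mu (A `\` F) < e%:E)%E].
Proof.
move=> mA e0; have : squeezed A.
  apply: (@smallest_sub _ (sigma_algebra setT) (@open T) squeezed) A mA => //; last first.
    by move=> U; exact: squeezed_open.
  split.
  - exact: squeezed_open open0.
  - by move=> B sB; rewrite setTD; exact: squeezedC.
  - exact: squeezed_bigcup.
move=> [_ /(_ e e0)[F [U [cF oU FA AU muUF]]]]; exists F; split => //.
apply: le_lt_trans muUF; apply: le_measure; rewrite ?inE.
- by apply: measurableD => //; exact: borel_closed.
- by apply: measurableD; [exact: borel_open|exact: borel_closed].
- exact: setSD.
Qed.

End inner_regularity.

Section selection.
Context {R : realType} {T X : pmetricType R}.
Variables (K : set T) (f : T -> X).
Hypotheses (cK : compact K) (cf : continuous f).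

Lemma compact_net (e : R) : 0 < e -> exists c : seq T,
  forall y, K y -> exists2 i, (i < size c)%N & mdist (nth point c i) y <= e.
Proof.
move=> e0; move: cK; rewrite compact_cover => /(_ T setT (fun x => [set y | mdist x y < e])).
move=> [||D _ KD].
- by move=> x _; exact: open_mdist_lt.
- by move=> x Kx; exists x => //=; rewrite mdistxx.
exists (finmap.enum_fset D) => y /KD[x /= xD xy]; exists (index x (finmap.enum_fset D)).
  by rewrite index_mem.
by rewrite nth_index// ltW.
Qed.

Let eps (n : nat) : R := n.+1%:R^-1.
Let eps_gt0 n : 0 < eps n. Proof. by rewrite invr_gt0. Qed.

Let net := projT1 (choice (fun n => compact_net (eps_gt0 n))).
Let netP n y : K y -> exists2 i, (i < size (net n))%N &
  mdist (nth point (net n) i) y <= eps n.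
Proof. exact: (projT2 (choice (fun n => compact_net (eps_gt0 n))) n y). Qed.

(** The latest index stands at the head of the word, and the length of the tail tells which net it
    refers to. *)
Fixpoint cylinder (w : seq nat) : set T := if w is i :: w'
  then cylinder w' `&` [set y | mdist (nth point (net (size w')) i) y <= eps (size w')]
  else K.

Lemma cylinder_sub w : cylinder w `<=` K.
Proof. by elim: w => //= i w IH x [/IH]. Qed.

Lemma closed_cylinder w : closed (cylinder w).
Proof.
elim: w => [|i w IH] /=; first exact: compact_closed (@metric_hausdorff R T) cK.
by apply: closedI => //; exact: closed_mdist_le.
Qed.

Lemma compact_cylinder w : compact (cylinder w).
Proof. exact: subclosed_compact (@closed_cylinder w) cK (@cylinder_sub w). Qed.

(* The selected point over [z] is the limit of nested small pieces of [K] meeting the fibre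
   over [z], each chosen first in a finite list. *)
Let hit (z : X) (w : seq nat) := `[< (f @` cylinder w) z >].

Fixpoint word (n : nat) (z : X) : seq nat := if n is n'.+1
  then find (fun i => hit z (i :: word n' z)) (iota 0 (size (net n'))) :: word n' z
  else [::].

Lemma size_word n z : size (word n z) = n.
Proof. by elim: n => //= n ->. Qed.

Lemma measurable_hit w : measurable ([set z | hit z w] : set (borel X)).
Proof.
rewrite (_ : [set z | hit z w] = f @` cylinder w); last first.
  by apply/seteqP; split=> z /= /asboolP.
apply: borel_closed; apply: compact_closed; first exact: metric_hausdorff.
apply: continuous_compact; last exact: compact_cylinder.
exact: continuous_subspaceT.
Qed.

Lemma measurable_word n w : measurable ([set z | word n z = w] : set (borel X)).
Proof.
elim: n w => [|n IH] [|i w] /=.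
- by rewrite (_ : mkset _ = setT)//; apply/seteqP.
- by rewrite (_ : mkset _ = set0)//; apply/seteqP; split.
- by rewrite (_ : mkset _ = set0)//; apply/seteqP; split.
rewrite (_ : mkset _ = [set z | word n z = w] `&`
    [set z | find (fun j => hit z (j :: w)) (iota 0 (size (net n))) = i]); last first.
  apply/seteqP; split=> [z /= [<- <-]//|z /= [<- <-]//].
apply: measurableI => //.
elim: (iota _ _) i => [|j s IHs] [|i] /=.
- by rewrite (_ : mkset _ = setT)//; apply/seteqP.
- by rewrite (_ : mkset _ = set0)//; apply/seteqP; split.
- rewrite (_ : mkset _ = [set z | hit z (j :: w)]); first exact: measurable_hit.
  by apply/seteqP; split=> z /=; case: ifP.
- rewrite (_ : mkset _ = ~` [set z | hit z (j :: w)] `&`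
      [set z | find (fun j => hit z (j :: w)) s = i]).
    by apply: measurableI => //; apply: measurableC; exact: measurable_hit.
  apply/seteqP; split=> z /=; case: ifP => // hz.
  - by case=> <-.
  - by case=> /(_ isT).
  - by case=> _ ->.
Qed.

Lemma word_hit n z : (f @` K) z -> (f @` cylinder (word n z)) z.
Proof.
move=> Kz; elim: n => // n [y Cy yz] /=.
have [i isz iy] := netP n (cylinder_sub Cy).
have : has (fun i => hit z (i :: word n z)) (iota 0 (size (net n))).
  apply/hasP; exists i; first by rewrite mem_iota.
  by apply/asboolP; exists y => //=; split=> //; rewrite /= size_word.
move=> /[dup] hP /(nth_find 0%N); rewrite nth_iota -?has_find//; last first.
  by move: hP; rewrite has_find size_iota.
by rewrite add0n => /asboolP.
Qed.

(** The points realising the hits at all stages have a cluster point in [K]; it lies in each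
    cylinder and in the fibre, since both are closed. *)
Lemma word_limit z : (f @` K) z -> exists y, forall n, cylinder (word n z) y /\ f y = z.
Proof.
move=> Kz; have [x xP] := choice (fun n => let: ex_intro2 y a b := word_hit n Kz in
  ex_intro (fun y => cylinder (word n z) y /\ f y = z) y (conj a b)).
have mono n k : (n <= k)%N -> cylinder (word k z) `<=` cylinder (word n z).
  move=> /subnK <-; elim: (k - n)%N => [|j IH] //=.
  by move=> y [/IH].
have [|y [Ky clx]] := cK (F := x @ \oo) _.
  by exists 0%N => // n _; exact: cylinder_sub (xP n).1.
exists y => n; split.
  apply: closed_cylinder => B By.
  have [|w [Cw Bw]] := clx (cylinder (word n z)) B _ By; last by exists w.
  by exists n => // k /= nk; apply: mono nk _ _; exact: (xP k).1.
have : closed (f @^-1` [set z]).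
  apply: preimage_closed; first by move=> ? _; exact: cf.
  exact: (accessible_closed_set1 (hausdorff_accessible (@metric_hausdorff R X))).
apply => B By; have [|w [fw Bw]] := clx (f @^-1` [set z]) B _ By; last by exists w.
by exists 0%N => // k _; exact: (xP k).2.
Qed.

Lemma compact_selection : exists s : X -> T,
  measurable_fun [set: borel X] (s : borel X -> borel T) /\
  forall z, (f @` K) z -> K (s z) /\ f (s z) = z.
Proof.
have ex z : exists y, if `[< (f @` K) z >] then
    forall n, cylinder (word n z) y /\ f y = z else y = point.
  by case: asboolP => [/word_limit//|_]; exists point.
have [s sP] := choice ex.
have sK z n : (f @` K) z -> cylinder (word n z) (s z) /\ f (s z) = z.
  by move=> Kz; move: (sP z); rewrite asboolT// => /(_ n).
have mfK : measurable (f @` K : set (borel X)) by rewrite -[_ @` _](_ : [set z | hit z [::]] = _);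
  [exact: measurable_hit|apply/seteqP; split=> z /= /asboolP].
(* As the cylinders shrink to the selected point, that point is in [B] exactly when each of them
   meets [B]; and each word, out of countably many, is taken on a measurable set. *)
have mclosed (B : set T) : closed B -> measurable ((f @` K) `&` s @^-1` B : set (borel X)).
  move=> cB; rewrite (_ : _ `&` _ = (f @` K) `&` \bigcap_n \bigcup_(w in [set w |
      (cylinder w `&` B) !=set0]) [set z | word n z = w]); last first.
    apply/seteqP; split=> z [Kz].
      move=> /= Bs; split => // n _; exists (word n z) => //=.
      by exists (s z); split => //; case: (sK z n Kz).
    move=> Hz; split => //=; apply: cB => V /nbhs_mdist[e e0 eV].
    have [n nP] := invS_lt (divr_gt0 e0 (ltr0n _ 2)).
    have [w [b [Cb Bb]] /= wE] := Hz n.+1 I; exists b; split => //; apply: eV.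
    rewrite -wE /= in Cb; case: Cb => _ /= cb.
    have [/= [_ /= cs] _] := sK z n.+1 Kz.
    rewrite !size_word in cb cs.
    apply: le_lt_trans (metric_triangle _ (nth point (net n)
      (find (fun i => hit z (i :: word n z)) (iota 0 (size (net n))))) _) _.
    rewrite (splitr e) ltrD//; last exact: le_lt_trans cb nP.
    rewrite metric_sym; exact: le_lt_trans cs nP.
  apply: measurableI => //; apply: bigcapT_measurable => n.
  rewrite (_ : \bigcup_(_ in _) _ = \bigcup_w (if `[< (cylinder w `&` B) !=set0 >] then
     [set z | word n z = w] else set0)); last first.
    apply/seteqP; split=> z [w].
      by move=> hw /= wz; exists w => //; rewrite asboolT.
    by move=> _; case: asboolP => // hw wz; exists w.
  apply: countable_bigcupT_measurable; first exact: countableP.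
  by move=> w; case: asboolP => // _; exact: measurable_word.
exists s; split; last first.
  by move=> z Kz; split; [have [] := sK z 0%N Kz|have [] := sK z 0%N Kz].
apply: (@measurability _ _ (borel X) (borel T) setT s (@open T)) => //.
move=> _ [V oV <-]; rewrite setTI.
(* Off the image of [K] the selection is the constant [point]. *)
rewrite (_ : s @^-1` V = ((f @` K) `\` ((f @` K) `&` s @^-1` (~` V))) `|`
   (if `[< V point >] then ~` (f @` K) else set0)).
  apply: measurableU.
    by apply: measurableD => //; apply: mclosed; exact: open_closedC.
  by case: asboolP => // _; exact: measurableC.
apply/seteqP; split=> z /=.
  move=> Vz; have [Kz|nKz] := pselect ((f @` K) z).
    by left; split => // -[_]; exact.
  right; have := sP z; rewrite asboolF// => sz.
  by rewrite -sz asboolT.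
case=> [[Kz nz]|].
  by apply: contrapT => nV; apply: nz.
by case: asboolP => // Vp nKz; have := sP z; rewrite asboolF// => ->.
Qed.

End selection.

(** * Densities and level sets *)

Section push.
Local Open Scope ereal_scope.
Context d1 d2 (T1 : measurableType d1) (T2 : measurableType d2) (R : realType).

(* The measurability proof is an argument so that the measure structure can be inferred. *)
Definition push (m : {measure set T1 -> \bar R}) (f : T1 -> T2)
  & measurable_fun [set: T1] f : set T2 -> \bar R := pushforward m f.

Section measure.
Variables (m : {measure set T1 -> \bar R}) (f : T1 -> T2) (mf : measurable_fun [set: T1] f).
Let pm := @measure_function_pushforward__canonical__measure_function_Measure _ _ T1 T2 R m f mf.
Let push0 : push m mf set0 = 0. Proof. exact: (measure0 pm). Qed.
Let push_ge0 A : 0 <= push m mf A. Proof. exact: (measure_ge0 pm). Qed.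
Let push_sigma : semi_sigma_additive (push m mf).
Proof. exact: (@measure_semi_sigma_additive _ _ _ pm). Qed.
HB.instance Definition _ := isMeasure.Build _ _ _ (push m mf) push0 push_ge0 push_sigma.

Lemma ge0_integral_push (g : T2 -> \bar R) : measurable_fun [set: T2] g ->
  (forall x, 0 <= g x) -> \int[push m mf]_x g x = \int[m]_x g (f x).
Proof. by move=> mg g0; rewrite /push ge0_integral_pushforward. Qed.
End measure.

Section finite.
Variables (m : {finite_measure set T1 -> \bar R}) (f : T1 -> T2) (mf : measurable_fun [set: T1] f).
Let push_fin : fin_num_fun (push m mf).
Proof.
move=> A mA; apply: fin_num_measure.
by rewrite -[X in measurable X]setTI; exact: (mf measurableT mA).
Qed.
HB.instance Definition _ := Measure_isFinite.Build _ _ _ (push m mf) push_fin.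
End finite.

Section probability.
Variables (m : probability T1 R) (f : T1 -> T2) (mf : measurable_fun [set: T1] f).
Let push_prob : push m mf setT = 1.
Proof. by rewrite /push/= /pushforward preimage_setT probability_setT. Qed.
HB.instance Definition _ := Measure_isProbability.Build _ _ _ (push m mf) push_prob.
End probability.
End push.

Section density.
Local Open Scope ereal_scope.
Context d (T : measurableType d) (R : realType).
Implicit Types m nu : {measure set T -> \bar R}.

Import HBNNSimple.

(** By monotone convergence it is enough to treat the simple functions approximating [g], where
    linearity reduces the identity to [nuE]. *)
Lemma ge0_integral_density m nu (f g : T -> \bar R) :
  measurable_fun [set: T] f -> (forall x, 0 <= f x) -> (forall x, f x \is a fin_num) ->
  (forall A, measurable A -> nu A = \int[m]_(x in A) f x) ->
  measurable_fun [set: T] g -> (forall x, 0 <= g x) ->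
  \int[nu]_x g x = \int[m]_x (g x * f x).
Proof.
move=> mf f0 ffin nuE mg g0; pose h := nnsfun_approx measurableT mg.
have cvg_h x : (EFin \o h n) x @[n --> \oo] --> g x by exact: cvg_nnsfun_approx.
have ndh x : {homo (fun n => (EFin \o h n) x) : a b / (a <= b)%N >-> a <= b}.
  by move=> a b ab; rewrite /= lee_fin; exact/lefP/nd_nnsfun_approx.
have -> : \int[nu]_x g x = limn (fun n => \int[nu]_x (EFin \o h n) x).
  rewrite -monotone_convergence//.
  - by apply: eq_integral => x _; apply/esym/cvg_lim => //.
  - by move=> n; apply/measurable_EFinP.
  - by move=> n x _ /=; rewrite lee_fin.
have -> : \int[m]_x (g x * f x) = limn (fun n => \int[m]_x ((EFin \o h n) x * f x)).
  rewrite -monotone_convergence//.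
  - apply: eq_integral => x _; apply/esym/cvg_lim => //.
    by apply: cvgeZr => //; exact: cvg_h.
  - by move=> n; apply: emeasurable_funM => //; exact/measurable_EFinP.
  - by move=> n x _; rewrite mule_ge0//= lee_fin.
  - by move=> x _ a b ab; rewrite lee_wpmul2r//; exact: ndh.
congr (limn _); apply/funext => n.
rewrite integralT_nnsfun sintegralE.
transitivity (\int[m]_x (\sum_(y \in range (h n)) (y * \1_(h n @^-1` [set y]) x)%:E * f x)); last first.
  apply: eq_integral => x _; rewrite -ge0_mule_fsuml; last by move=> y; exact: nnfun_muleindic_ge0.
  by rewrite fsumEFin// -(fimfunE _ x).
rewrite ge0_integral_fsum//; last 2 first.
- move=> y; apply: emeasurable_funM => //; apply/measurable_EFinP.
  exact: measurable_funM.
- by move=> y x _; rewrite mule_ge0// nnfun_muleindic_ge0.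
apply: eq_fsbigr => y; rewrite inE => -[t _ yE].
have mh : measurable (h n @^-1` [set y]) by exact: measurable_sfunP.
have y0 : (0 <= y)%R by rewrite -yE.
under eq_integral do rewrite EFinM -muleA.
rewrite ge0_integralZl//.
2: by apply: emeasurable_funM => //; apply/measurable_EFinP.
2: by move=> x _; rewrite mule_ge0.
congr (_ * _); rewrite nuE// integral_mkcond.
by apply: eq_integral => x _; rewrite epatch_indic muleC.
Qed.

Lemma ge0_integral_mrestr m (W : set T) (mW : measurable W) (g : T -> \bar R) D :
  measurable D -> measurable_fun [set: T] g -> (forall x, 0 <= g x) ->
  \int[mrestr m mW]_(x in D) g x = \int[m]_(x in D `&` W) g x.
Proof.
move=> mD mg g0; rewrite [LHS]integral_mkcond.
rewrite (@ge0_integral_density m (mrestr m mW) (EFin \o \1_W))//.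
- rewrite [RHS]integral_mkcond; apply: eq_integral => x _.
  rewrite !patchE in_setI /= indicE.
  by case: (x \in D); case: (x \in W); rewrite ?mule1 ?mule0.
- by apply/measurable_EFinP.
- by move=> x; rewrite lee_fin.
- by move=> A mA; rewrite /= integral_indic//= /mrestr setIC.
- by apply: (measurable_restrictT _ mD).1; exact: measurable_funTS.
- by move=> x; rewrite patchE; case: ifP.
Qed.

Lemma ge0_subset_integralT m D (g : T -> \bar R) :
  measurable D -> measurable_fun [set: T] g -> (forall x, 0 <= g x) ->
  \int[m]_(x in D) g x <= \int[m]_x g x.
Proof. by move=> mD mg g0; exact: ge0_subset_integral. Qed.

End density.

Section level_sets.
Local Open Scope ereal_scope.
Context {R : realType}.
Local Notation mu := (@lebesgue_measure R).

Lemma lebesgue_affine (a c : R) (A : set R) : (0 < c)%R -> measurable A ->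
  mu A = c%:E * mu ((fun v => a + c * v)%R @^-1` A).
Proof.
move=> c0 mA; pose f (v : R) : measurableTypeR R := (a + c * v)%R.
have mf : @measurable_fun _ _ (measurableTypeR R) (measurableTypeR R) setT f.
  by apply: measurable_funD => //; exact: measurable_funM.
pose nu : {measure set (measurableTypeR R) -> \bar R} := mscale (NngNum (ltW c0)) (push mu mf).
rewrite (@lebesgue_measure_unique R nu)//.
move=> _ [[x y]] _ <-.
have -> : nu `]x, y]%classic = c%:E * mu `]((x - a) / c)%R, ((y - a) / c)%R]%classic.
  rewrite /nu /= /mscale /= /push /pushforward; congr (_ * mu _).
  apply/seteqP; split=> v /=; rewrite !in_itv/= => /andP[h1 h2]; apply/andP.
    by rewrite ltr_pdivrMr// ler_pdivlMr// ltrBlDl lerBrDl ![(v * _)%R]mulrC.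
  by move: h1 h2; rewrite ltr_pdivrMr// ler_pdivlMr// ltrBlDl lerBrDl ![(v * _)%R]mulrC.
rewrite !lebesgue_measure_itv/= !lte_fin ltr_pM2r ?invr_gt0// ltrD2r.
case: ifP => _; last by rewrite mule0.
by rewrite -!EFinB -EFinM; congr EFin; rewrite -mulrBl opprB addrA subrK mulrC mulfVK ?gt_eqF.
Qed.

(** Fubini for the pairs [(z, v)] such that [L] contains [(1 - lam) * E z + lam * v]: the sections
    at fixed [v] are null in [B], so the section at some [z] of [B] is Lebesgue-null, and an affine
    change of variable turns [v] into the height. *)
Lemma level_null d (T : measurableType d) (m : {measure set T -> \bar R})
    (B : set T) (E : T -> R) (lam v1 : R) (L : set R) :
  measurable B -> 0 < m B -> m B < +oo -> measurable_fun [set: T] E ->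
  (0 < lam)%R -> measurable L ->
  (forall v, (0 <= v <= v1)%R ->
    m (B `&` [set z | L ((1 - lam) * E z + lam * v)%R]) = 0) ->
  exists2 z, B z & mu (L `&` `[((1 - lam) * E z)%R, ((1 - lam) * E z + lam * v1)%R]%classic) = 0.
Proof.
move=> mB B0 Boo mE lam0 mL H.
pose mm : {finite_measure set T -> \bar R} := mfrestr mB Boo.
pose g (p : T * measurableTypeR R) : R := ((1 - lam) * E p.1 + lam * p.2)%R.
have mg : measurable_fun [set: T * measurableTypeR R] g.
  apply: measurable_funD; apply: measurable_funM => //.
  exact: (measurableT_comp mE).
pose P := (g @^-1` L) `&` (snd @^-1` `[0%R, v1]%classic).
have mP : measurable P.
  by apply: measurableI; rewrite -[X in measurable X]setTI; [exact: mg|exact: measurable_snd].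
have mI : measurable_fun [set: T * measurableTypeR R] (EFin \o \1_P : T * measurableTypeR R -> \bar R) by exact/measurable_EFinP.
have I0 p : 0 <= (EFin \o \1_P : T * measurableTypeR R -> \bar R) p by rewrite lee_fin.
have := @fubini_tonelli _ _ T (measurableTypeR R) R mm lebesgue_measure (EFin \o \1_P) mI I0.
rewrite [RHS in _ = RHS -> _](_ : _ = 0); last first.
  rewrite -[RHS](integral0 mu setT); apply: eq_integral => v _.
  rewrite -[LHS](_ : \int[mm]_x (\1_[set z | P (z, v)] x)%:E = _)//.
  have mPv : measurable [set z | P (z, v)].
    rewrite (_ : mkset _ = ysection P v); last by rewrite ysectionE.
    exact: measurable_ysection.
  rewrite integral_indic// setIT /= /mfrestr /mrestr.
  have [v01|v01] := boolP (0 <= v <= v1)%R.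
    rewrite -[RHS](H v v01); congr (m _).
    apply/seteqP; split=> z /=; first by move=> [[? _] ?].
    by move=> [Bz Lz]; split => //; split => //=; rewrite in_itv.
  rewrite (_ : _ `&` _ = set0) ?measure0//.
  by apply/seteqP; split=> // z /= [[_]]/=; rewrite in_itv/= (negbTE v01).
have mF := measurable_fun_fubini_tonelli_F (m2 := mu) _ mI I0.
move=> F0; have : \int[mm]_x `|\int[mu]_y (EFin \o \1_P) (x, y)| = 0.
  rewrite -F0; apply: eq_integral => x _; rewrite gee0_abs//.
  exact: integral_ge0.
move/(ae_eq_integral_abs mm measurableT mF) => -[N [mN N0 subN]].
have [z [Bz nNz]] : exists z, B z /\ ~ N z.
  apply: contrapT => nex; move: N0; rewrite /= /mfrestr /mrestr => N0.
  have BN : B `<=` N `&` B.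
    by move=> z Bz; split => //; apply: contrapT => nN; apply: nex; exists z.
  have : m B <= m (N `&` B) by apply: le_measure; rewrite ?inE//; exact: measurableI.
  by rewrite N0 leNgt B0.
exists z => //.
have : \int[mu]_y (\1_P (z, y))%:E = 0.
  by apply: contrapT => nz; apply: nNz; apply: subN => /=; apply/not_implyP.
have mPz : measurable [set v | P (z, v)].
  rewrite (_ : mkset _ = xsection P z); last by rewrite xsectionE.
  exact: measurable_xsection.
rewrite -[LHS in LHS = _ -> _](_ : \int[mu]_y (\1_[set v | P (z, v)] y)%:E = _)//.
rewrite integral_indic// setIT => Pz.
rewrite (lebesgue_affine ((1 - lam) * E z) lam0); last by apply: measurableI.
rewrite (_ : _ @^-1` _ = [set v | P (z, v)]) ?Pz ?mule0//.
apply/seteqP; split=> v /=; rewrite /P /g /= !in_itv/= lerDl lerD2l (pmulr_rge0 _ lam0).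
  by rewrite (ler_pM2l lam0).
by rewrite (ler_pM2l lam0).
Qed.

(** The hypothesis makes Lebesgue measure on [Q] absolutely continuous with respect to the law of
    [E] on [W]. Its Radon-Nikodym density, composed with [E], reweights [m] so that the law of [E]
    becomes Lebesgue measure on [Q]. *)
Lemma density_transport d (T : measurableType d) (m : {measure set T -> \bar R})
    (W : set T) (E : T -> R) (Q : set R) :
  measurable W -> m W < +oo -> measurable_fun [set: T] E -> measurable Q -> mu Q < +oo ->
  (forall L, measurable L -> L `<=` Q -> m (W `&` E @^-1` L) = 0 -> mu L = 0) ->
  exists h : T -> \bar R, [/\ measurable_fun [set: T] h, forall z, 0 <= h z &
    forall A, measurable A -> \int[m]_(z in W `&` E @^-1` A) h z = mu (A `&` Q)].
Proof.
move=> mW Woo mE mQ Qoo H.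
pose mm : {finite_measure set T -> \bar R} := mfrestr mW Woo.
have mE' : @measurable_fun _ _ T (measurableTypeR R) setT E by exact: mE.
pose nu : {finite_measure set (measurableTypeR R) -> \bar R} := push mm mE'.
have mQ' : @measurable _ (measurableTypeR R) Q by exact: mQ.
pose sig : {finite_measure set (measurableTypeR R) -> \bar R} := mfrestr mQ' Qoo.
have dom : sig `<< nu.
  apply/null_content_dominatesP => A mA nuA.
  apply: H.
  - exact: measurableI.
  - exact: subIsetr.
  - apply/eqP; rewrite eq_le measure_ge0 andbT -nuA.
    apply: le_measure; rewrite ?inE.
    + apply: measurableI => //; rewrite -[X in measurable X]setTI; apply: mE => //.
      exact: measurableI.
    + by apply: measurableI => //; rewrite -[X in measurable X]setTI; exact: (mE' measurableT _ mA).
    + by move=> z [Wz [Az _]]; split.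
have [f [f0 ffin fint fE]] := radon_nikodym_sigma_finite dom.
have mf : measurable_fun [set: measurableTypeR R] f by exact: measurable_int fint.
exists (f \o E); split => //.
- exact: (measurableT_comp mf).
- by move=> z; exact: f0.
move=> A mA; rewrite -[RHS]/(sig A) fE//.
have mEA : measurable (E @^-1` A) by rewrite -[X in measurable X]setTI; exact: (mE' measurableT _ mA).
rewrite setIC -(@ge0_integral_mrestr _ _ _ m W mW)//; last 2 first.
- exact: (measurableT_comp mf).
- by move=> z; exact: f0.
rewrite /nu /= /push ge0_integral_pushforward//.
exact: measurable_funTS.
Qed.

End level_sets.

(** * Lebesgue decomposition *)

Section lebesgue_decomposition.
Local Open Scope ereal_scope.
Context {R : realType} {X : pmetricType R}.

(** The singular part sits on an [m]-null set of greatest [nu]-mass, obtained by exhaustion; off it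
    [nu] is absolutely continuous. Radon-Nikodym is applied to the restriction of [m] to [B], a
    finite measure, and the density is cut off outside [B]. *)
Lemma lebesgue_decomposition_exists (m : {measure set (borel X) -> \bar R})
    (nu : {finite_measure set (borel X) -> \bar R}) (B : set X) :
  measurable (B : set (borel X)) -> m B < +oo -> nu (~` B) = 0 ->
  exists rho S, lebesgue_decomposition m nu rho S /\ (forall x, ~ B x -> rho x = 0%R).
Proof.
move=> mB Boo nuB.
pose N := [set S : set X | measurable (S : set (borel X)) /\ m S = 0].
pose c := ereal_sup [set nu S | S in N].
have N0 : N set0 by split; [exact: measurable0|exact: measure0].
have cle S : N S -> nu S <= c by move=> NS; apply: ereal_sup_ubound; exists S.
have cfin : c \is a fin_num.
  rewrite ge0_fin_numE; last by rewrite -(measure0 nu); exact: cle.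
  apply: (@le_lt_trans _ _ (nu setT)); last by rewrite ltey_eq fin_num_measure.
  by apply: ge_ereal_sup => _ [S [mS _] <-]; apply: le_measure; rewrite ?inE.
have ex n : exists S, N S /\ c - (n.+1%:R^-1)%:E < nu S.
  have n0 : (0 < (n.+1%:R : R)^-1)%R by rewrite invr_gt0.
  by have [_ [S NS <-] ?] := ub_ereal_sup_adherent n0 cfin; exists S.
have [S SP] := choice ex.
pose S0 := \bigcup_n S n.
have NS0 : N S0.
  split; first by apply: bigcupT_measurable => n; case: (SP n) => -[].
  apply/eqP; rewrite eq_le measure_ge0 andbT.
  apply: (@le_trans _ _ (\sum_(n <oo) m (S n))).
    apply: measure_sigma_subadditive => //.
    - by move=> n; case: (SP n) => -[].
    - by apply: bigcupT_measurable => n; case: (SP n) => -[].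
  by rewrite eseries0// => n _ _; case: (SP n) => -[].
have cS0 : c <= nu S0.
  apply/lee_addgt0Pr => e e0.
  have [n nP] := invS_lt e0.
  have [[mS _] cS] := SP n.
  rewrite -leeBlDr// (@le_trans _ _ (nu (S n)))//.
    by rewrite (le_trans _ (ltW cS))// leeB// lee_fin ltW.
  by apply: le_measure; rewrite ?inE//; [exact: NS0.1|exact: bigcup_sup].
have nuC (A : set X) : measurable (A : set (borel X)) -> m A = 0 -> nu (A `&` ~` S0) = 0.
  move=> mA A0.
  have mAS : measurable (A `&` ~` S0 : set (borel X)).
    by apply: measurableI => //; apply: measurableC; exact: NS0.1.
  have NU : N (S0 `|` (A `&` ~` S0)).
    split; first by apply: measurableU => //; exact: NS0.1.
    rewrite measureU0//; [exact: NS0.2|exact: NS0.1|].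
    by apply: subset_measure0 A0 => //; exact: subIsetl.
  have := le_trans (cle _ NU) cS0.
  rewrite measureU//; [|exact: NS0.1|by rewrite setICA setICr setI0].
  rewrite -[leRHS]adde0 leeD2lE ?fin_num_measure//; last exact: NS0.1.
  by move=> ?; apply/eqP; rewrite eq_le measure_ge0 andbT.
have mS0C : measurable (~` S0 : set (borel X)) by apply: measurableC; exact: NS0.1.
have nuoo : nu (~` S0) < +oo by rewrite ltey_eq fin_num_measure.
pose nu' : {finite_measure set (borel X) -> \bar R} := mfrestr mS0C nuoo.
pose mm : {finite_measure set (borel X) -> \bar R} := mfrestr mB Boo.
have dom : nu' `<< mm.
  apply/null_content_dominatesP => A mA; rewrite /= /mfrestr /mrestr => A0.
  apply/eqP; rewrite eq_le measure_ge0 andbT.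
  have mBC : measurable (~` B : set (borel X)) by exact: measurableC.
  have mAB : measurable (A `&` B : set (borel X)) by exact: measurableI.
  apply: (@le_trans _ _ (nu ((A `&` B) `&` ~` S0 `|` ~` B))).
    apply: le_measure; rewrite ?inE.
    - exact: measurableI.
    - by apply: measurableU => //; exact: measurableI.
    - by move=> x [Ax Sx]; have [Bx|nBx] := pselect (B x); [left|right].
  rewrite (le_trans (measureU2 _ _ _))//; first exact: measurableI.
  by rewrite [X in X + _]nuC// [X in _ + X]nuB adde0.
have [f [f0 ffin fint fE]] := radon_nikodym_sigma_finite dom.
have mf : measurable_fun [set: borel X] f by exact: measurable_int fint.
pose rho x : R := (fine (f x) * \1_B x)%R.
have mrho : measurable_fun [set: borel X] rho.
  by apply: measurable_funM => //; exact: measurableT_comp.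
exists rho, S0; split; last by move=> x nBx; rewrite /rho indicE memNset// mulr0.
split => //.
- by move=> x; rewrite /rho mulr_ge0// fine_ge0.
- exact: NS0.1.
- exact: NS0.2.
move=> A mA.
have mAS : measurable (A `&` S0 : set (borel X)) by apply: measurableI => //; exact: NS0.1.
have mASC : measurable (A `&` ~` S0 : set (borel X)) by apply: measurableI.
have -> : nu A = nu (A `&` ~` S0) + nu (A `&` S0).
  rewrite -measureU//; first by rewrite -setIUr setUC setUv setIT.
  by rewrite setIACA setIC setIid setICl set0I.
congr (_ + _); rewrite -[LHS]/(nu' A) fE//.
rewrite (@ge0_integral_mrestr _ _ _ m B mB)// integral_mkcondr.
apply: eq_integral => x _; rewrite /rho EFinM fineK//.
by rewrite epatch_indic.
Qed.

Lemma finite_lebesgue_decomposition (m nu : {measure set (borel X) -> \bar R}) (B : set X) : nu setT < +oo ->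
  measurable (B : set (borel X)) -> m B < +oo -> nu (~` B) = 0 ->
  exists rho S, lebesgue_decomposition m nu rho S /\ (forall x, ~ B x -> rho x = 0%R).
Proof.
move=> nuoo mB Boo nuB.
have [|rho [S [H1 H2]]] := @lebesgue_decomposition_exists m
  (mfrestr measurableT nuoo) B mB Boo.
  by rewrite /= /mfrestr /mrestr setIT.
exists rho, S; split => //; case: H1 => a b c d e; split => // A mA.
have := e A mA; rewrite /= /mfrestr /mrestr /= !setIT; exact.
Qed.

End lebesgue_decomposition.

Section distortion_bounds.
Context {R : realType}.
Implicit Types K N Th n t x theta : R.

(** * Distortion coefficients *)

(** Concavity of the sine on [[0, pi]]: by the mean value theorem its average slope before [t * x]
    is at least the one after. *)
Lemma sin_ge_scale t x : 0 <= t <= 1 -> 0 <= x <= pi -> t * sin x <= sin (t * x).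
Proof.
move=> /andP[t0 t1] /andP[x0 xpi].
have tx0 : 0 <= t * x by rewrite mulr_ge0.
have txx : t * x <= x by rewrite ler_piMl.
have cs (a b : R) : {within `[a, b], continuous (@sin R)}.
  by apply: continuous_subspaceT => ?; exact: continuous_sin.
have [xi] := MVT_segment txx (fun y _ => is_derive_sin y) (cs _ _).
rewrite in_itv/= => /andP[xi1 xi2] E1.
have [eta] := MVT_segment tx0 (fun y _ => is_derive_sin y) (cs _ _).
rewrite in_itv/= sin0 !subr0 => /andP[eta1 eta2] E2.
have cos_le : cos xi <= cos eta.
  rewrite leNgt ltr_cos ?in_itv/=; first by rewrite -leNgt (le_trans eta2).
    by rewrite (le_trans tx0 xi1) (le_trans xi2).
  by rewrite eta1 (le_trans eta2)// (le_trans txx).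
have h : (1 - t) * x * t * cos xi <= (1 - t) * x * t * cos eta.
  by rewrite ler_wpM2l// !mulr_ge0// subr_ge0.
rewrite -subr_ge0; have -> : sin (t * x) - t * sin x =
   (1 - t) * sin (t * x) - t * (sin x - sin (t * x)) by ring.
rewrite E1 E2; lra.
Qed.

(** As [sinh] is convex on the half-line, an exponential factor has to pay for the comparison. Up to
    such factors [sinh x] is [1 - expR (- (2 * x))], which is concave. *)
Lemma sinh_ge_scale t x : 0 <= t <= 1 -> 0 <= x ->
  t * expR (- ((1 - t) * x)) * sinh x <= sinh (t * x).
Proof.
move=> /andP[t0 t1] x0; rewrite /sinh.
have cvx : expR (- (2 * (t * x))) <= (1 - t) + t * expR (- (2 * x)).
  have := convex_expR (Itv01 t0 t1) (- (2 * x)) 0.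
  rewrite !convRE /= expR0 mulr1 mulr0 addr0 addrC.
  by rewrite mulrN mulrCA [in X in _ -> _ <= X]addrC; congr (_ <= _); rewrite addrC.
have -> : expR (t * x) - expR (- (t * x)) = expR (t * x) * (1 - expR (- (2 * (t * x)))).
  by rewrite mulrBr mulr1 -expRD; congr (_ - expR _); ring.
have -> : expR x - expR (- x) = expR x * (1 - expR (- (2 * x))).
  by rewrite mulrBr mulr1 -expRD; congr (_ - expR _); ring.
have -> : t * expR (- ((1 - t) * x)) * (expR x * (1 - expR (- (2 * x))) / 2) =
    expR (t * x) * (t * (1 - expR (- (2 * x)))) / 2.
  have -> : expR (t * x) = expR (- ((1 - t) * x)) * expR x by rewrite -expRD; congr expR; ring.
  ring.
rewrite ler_pM2r ?invr_gt0// ler_pM2l ?expR_gt0//; lra.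
Qed.

Lemma sinh_gt0 x : 0 < x -> 0 < sinh x.
Proof. by move=> x0; rewrite divr_gt0// subr_gt0 ltr_expR; lra. Qed.

(* [Num.sqrt] vanishes on negative numbers, so the exponential is 1 if K >= 0. *)
Definition contr_coeff K N Th t : R := t * expR (- ((1 - t) * (Num.sqrt (- K / (N - 1)) * Th))).

Lemma sigma_coeff_ge K n t theta : 0 < n -> 0 <= t <= 1 -> 0 <= theta ->
  ((t * expR (- ((1 - t) * (Num.sqrt (- K / n) * theta))))%:E
    <= sigma_coeff K n t theta)%E.
Proof.
move=> n0 /[dup] t01 /andP[t0 t1] th0; rewrite /sigma_coeff.
have le_t : t * expR (- ((1 - t) * (Num.sqrt (- K / n) * theta))) <= t.
  by rewrite ler_piMr// -[X in _ <= X]expR0 ler_expR oppr_le0 !mulr_ge0 ?subr_ge0 ?sqrtr_ge0.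
case: ifPn => [_|]; first by rewrite leey.
rewrite -ltNge => lt_pi; case: ifPn => [K0|].
  have th : 0 < theta.
    by rewrite lt_neqAle th0 andbT; apply/eqP => E; move: K0; rewrite -E expr0n/= mulr0 ltxx.
  have {}K0 : 0 < K by rewrite -(pmulr_lgt0 _ (exprn_gt0 2 th)).
  set x := theta * Num.sqrt (K / n).
  have Kn : 0 < K / n by rewrite divr_gt0.
  have x0 : 0 < x by rewrite mulr_gt0// sqrtr_gt0.
  have xpi : x < pi.
    rewrite -(@ltr_pXn2r _ 2)// ?nnegrE ?(ltW x0) ?pi_ge0//.
    rewrite exprMn sqr_sqrtr ?(ltW Kn)// mulrA ltr_pdivrMr// mulrC [ltRHS]mulrC //.
  rewrite lee_fin -mulrA -/x ler_pdivlMr; last by apply: sin_gt0_pi; rewrite x0.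
  apply: le_trans (sin_ge_scale t01 _); last by rewrite (ltW x0) (ltW xpi).
  by rewrite ler_wpM2r// sin_ge0_pi// (ltW x0) (ltW xpi).
rewrite -leNgt => K0; case: ifPn => [_|Kn0]; first by rewrite lee_fin.
have {K0 Kn0} K0 : K * theta ^+ 2 < 0 by rewrite lt_neqAle Kn0.
have th : 0 < theta.
  by rewrite lt_neqAle th0 andbT; apply/eqP => E; move: K0; rewrite -E expr0n/= mulr0 ltxx.
have {}K0 : K < 0 by move: K0; rewrite pmulr_llt0// exprn_gt0.
set x := theta * Num.sqrt (- K / n).
have x0 : 0 < x by rewrite mulr_gt0// sqrtr_gt0 divr_gt0// oppr_gt0.
rewrite lee_fin -mulrA -/x ler_pdivlMr ?sinh_gt0//.
by rewrite [Num.sqrt _ * _]mulrC; apply: sinh_ge_scale => //; exact: ltW.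
Qed.

(** The exponents of [t] in the two factors add up to 1, and an exponential at most 1 does not
    decrease when raised to the power [(N - 1) / N]. *)
Lemma tau_coeff_ge K N Th t theta : 1 < N -> 0 <= t <= 1 -> 0 <= theta <= Th ->
  ((contr_coeff K N Th t)%:E <= tau_coeff K N t theta)%E.
Proof.
move=> N1 /[dup] t01 /andP[t0 t1] /andP[th0 thTh]; rewrite /tau_coeff /contr_coeff.
have n0 : 0 < N - 1 by rewrite subr_gt0.
have N0 : 0 < N by lra.
set k := Num.sqrt (- K / (N - 1)); have k0 : 0 <= k by exact: sqrtr_ge0.
have p0 : 0 <= (N - 1) / N by rewrite divr_ge0// ltW.
have p1 : (N - 1) / N <= 1 by rewrite ler_pdivrMr// mul1r; lra.
have s := sigma_coeff_ge K n0 t01 th0; rewrite -/k in s.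
set e := expR (- ((1 - t) * (k * theta))) in s.
have e0 : 0 < e by exact: expR_gt0.
have e1 : e <= 1 by rewrite -expR0 ler_expR oppr_le0 !mulr_ge0// subr_ge0.
have te0 : 0 <= t * e by rewrite mulr_ge0// ltW.
have := @gt0_ler_poweR R _ p0 (t * e)%:E (sigma_coeff K (N - 1) t theta).
have s0 : (0 <= sigma_coeff K (N - 1) t theta)%E by apply: le_trans s; rewrite lee_fin.
rewrite !in_itv/= !lee_fin te0 s0 !leey => /(_ isT isT s) s2.
apply: (@le_trans _ _ ((t `^ N^-1)%:E * (t * e)%:E `^ ((N - 1) / N))%E); last first.
  by rewrite lee_wpmul2l// lee_fin powR_ge0.
rewrite poweR_EFin -EFinM lee_fin powRM// ?(ltW e0)// [X in _ <= X]mulrA.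
have -> : t `^ N^-1 * t `^ ((N - 1) / N) = t.
  have E : N^-1 + (N - 1) / N = 1 by field; rewrite gt_eqF.
  by rewrite -powRD E ?powRr1// oner_eq0.
apply: ler_wpM2l => //.
apply: (@le_trans _ _ e).
  by rewrite ler_expR lerN2 !ler_wpM2l// subr_ge0.
rewrite -{1}[e]powRr1 ?(ltW e0)// /powR gt_eqF// ler_expR.
by apply: ler_wnM2r => //; apply: ln_le0.
Qed.

Lemma contr_coeff_gt0 K N Th t : 0 < t -> 0 < contr_coeff K N Th t.
Proof. by move=> t0; rewrite mulr_gt0// expR_gt0. Qed.

Lemma contr_coeff_cvg1 K N Th (e : R) : e < 1 ->
  exists2 d, 0 < d & forall t, 1 - d < t -> t <= 1 -> e < contr_coeff K N Th t.
Proof.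
move=> e1; have c : {for 1, continuous (contr_coeff K N Th)}.
  move=> /=; rewrite /contr_coeff; apply: cvgM; first exact: cvg_id.
  apply: continuous_cvg; first exact: continuous_expR.
  apply: cvgN; apply: cvgM; last exact: cvg_cst.
  by apply: cvgB; [exact: cvg_cst|exact: cvg_id].
have : \forall t \near (1 : R), e < contr_coeff K N Th t.
  apply: (c [set u | e < u]); apply: open_nbhs_nbhs; split; first exact: open_gt.
  by rewrite /contr_coeff /= subrr mul0r oppr0 expR0 mulr1.
move=> /nbhs_ballP[d d0 dP]; exists d => // t t1 t2; apply: dP.
by rewrite /ball/= ger0_norm ?subr_ge0// ltrBlDr -ltrBlDl.
Qed.

End distortion_bounds.

(** * Entropy under the curvature-dimension inequality *)

(** Either [x] to the power [- p] is at most [eta], and the first term dominates, or [x] is at most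
    [eta] to the power [- p^-1], and the second one does. *)
Lemma young_powR {R : realType} (eta x p : R) : (0 < eta) -> (0 <= x) -> (0 < p < 1) ->
  (x `^ (1 - p) <= eta * x + eta `^ (1 - p^-1)).
Proof.
move=> eta0 x0 /andP[p0 p1].
have p1' : (0 < 1 - p) by rewrite subr_gt0.
have [->|xn0] := eqVneq x 0.
  by rewrite powR0 ?gt_eqF// mulr0 add0r powR_ge0.
have {x0 xn0} x0 : (0 < x) by rewrite lt_neqAle eq_sym xn0.
have [le|/ltW lt] := leP (x `^ (- p)) eta.
  rewrite powRD ?powRr1 ?(ltW x0)//; last by rewrite (gt_eqF x0) implybT.
  apply: (@le_trans _ _ (eta * x)); last by rewrite lerDl powR_ge0.
  by rewrite mulrC ler_wpM2r// ltW.
apply: (@le_trans _ _ (eta `^ (1 - p^-1))); last first.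
  by rewrite lerDr mulr_ge0// ltW.
have xle : (x <= eta `^ (- p^-1)).
  have -> : x = ((x `^ (- p)) `^ (- p^-1)).
    by rewrite -powRrM mulrNN mulfV ?gt_eqF// powRr1// ltW.
  rewrite (powRN (x `^ _)) (powRN eta) lef_pV2 ?posrE ?powR_gt0//.
  apply: ge0_ler_powR => //; first by rewrite invr_ge0 ltW.
  - by rewrite nnegrE ltW.
  - by rewrite nnegrE powR_ge0.
have := ge0_ler_powR (ltW p1') _ _ xle; rewrite !nnegrE (ltW x0) powR_ge0 => /(_ isT isT).
by rewrite -powRrM (_ : - p^-1 * (1 - p) = 1 - p^-1)//; field; rewrite gt_eqF.
Qed.


Section integral_extra.
Local Open Scope ereal_scope.
Context d (T : measurableType d) (R : realType).

(* No measurability: the integral of a nonnegative function is a supremum. *)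
Lemma ge0_le_integral_nonmeas (m : {measure set T -> \bar R}) (D : set T) (f g : T -> \bar R) :
  (forall x, D x -> 0 <= f x) -> (forall x, D x -> f x <= g x) ->
  \int[m]_(x in D) f x <= \int[m]_(x in D) g x.
Proof.
move=> f0 fg; have g0 x : D x -> 0 <= g x by move=> Dx; exact: le_trans (f0 x Dx) (fg x Dx).
rewrite !ge0_integralE//; apply: le_ereal_sup => _ [h hf <-]; exists h => // x.
apply: le_trans (hf x) _; rewrite !patchE; case: ifPn => //; rewrite inE; exact: fg.
Qed.

Section dens.
Variables (m : {measure set T -> \bar R}) (f : T -> R).

(** As for [push], the proofs are arguments so that the measure structure can be inferred. *)
Definition dens & measurable_fun [set: T] f & (forall x, (0 <= f x)%R) : set T -> \bar R :=
  reweight m (EFin \o f).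

Variables (mf : measurable_fun [set: T] f) (f0 : forall x, (0 <= f x)%R).
Let mf' : measurable_fun [set: T] (EFin \o f). Proof. exact/measurable_EFinP. Qed.
Let f0' x : 0 <= (EFin \o f) x. Proof. by rewrite lee_fin. Qed.
Let dm := @Defs_reweight__canonical__measure_function_Measure _ T R m _ mf' f0'.
Let dens0 : dens mf f0 set0 = 0. Proof. exact: (measure0 dm). Qed.
Let dens_ge0 A : 0 <= dens mf f0 A. Proof. exact: (measure_ge0 dm). Qed.
Let dens_sigma : semi_sigma_additive (dens mf f0).
Proof. exact: (@measure_semi_sigma_additive _ _ _ dm). Qed.
HB.instance Definition _ := isMeasure.Build _ _ _ (dens mf f0) dens0 dens_ge0 dens_sigma.

Lemma dens_dominated (A : set T) : measurable A -> m A = 0 -> dens mf f0 A = 0.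
Proof.
move=> mA A0; rewrite /dens /reweight.
by apply: null_set_integral => //; exact: measurable_funTS.
Qed.

End dens.

End integral_extra.

Section entropy.
Local Open Scope ereal_scope.
Context {R : realType} {X : pmetricType R}.
Implicit Types (m nu : {measure set (borel X) -> \bar R}) (rho : X -> R) (S B : set X).

(** The Renyi entropy functional with the sign that makes it grow as mass spreads out. *)
Definition entropy m (N : R) rho : \bar R := \int[m]_x (rho x `^ (1 - N^-1))%R%:E.

(** Its use is to show that a density living on a set of small [m]-measure has small entropy: first
    [eta] is fixed, then [B] is taken small. It is [young_powR] integrated over [B]. *)
Lemma entropy_le m nu (N eta : R) rho S B : (1 < N)%R -> (0 < eta)%R ->
  measurable (B : set (borel X)) -> lebesgue_decomposition m nu rho S ->
  (forall x, ~ B x -> rho x = 0%R) ->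
  entropy m N rho <= eta%:E * nu setT + (eta `^ (1 - N))%:E * m B.
Proof.
move=> N1 eta0 mB [mrho rho0 mS S0 nuE] rhoB.
have N00 : (0 < N)%R by lra.
have N0 : (0 < N^-1 < 1)%R by rewrite invr_gt0 invf_lt1 ?N00.
have mrho' : measurable_fun [set: borel X] (EFin \o rho) by exact/measurable_EFinP.
have m1 : measurable_fun [set: borel X] (fun x => eta%:E * (rho x)%:E).
  exact: emeasurable_funM.
have m2 : measurable_fun [set: borel X] (fun x => (eta `^ (1 - N))%:E * (\1_B x)%:E).
  by apply: emeasurable_funM => //; exact/measurable_EFinP.
have h1 x : 0 <= eta%:E * (rho x)%:E by rewrite -EFinM lee_fin mulr_ge0// ltW.
have h2 x : 0 <= (eta `^ (1 - N))%:E * (\1_B x)%:E.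
  by rewrite -EFinM lee_fin mulr_ge0// powR_ge0.
apply: (@le_trans _ _ (\int[m]_x (eta%:E * (rho x)%:E + (eta `^ (1 - N))%:E * (\1_B x)%:E))).
  apply: ge0_le_integral_nonmeas => x _; first by rewrite lee_fin powR_ge0.
  rewrite -!EFinM -EFinD lee_fin.
  have [Bx|nBx] := pselect (B x).
    by rewrite indicE mem_set// mulr1; have := young_powR eta0 (rho0 x) N0; rewrite invrK.
  rewrite rhoB// powR0 ?mulr0 ?add0r ?mulr_ge0 ?powR_ge0//.
  by rewrite subr_eq0 eq_sym lt_eqF//; case/andP: N0.
rewrite ge0_integralD//; apply: leeD.
  rewrite ge0_integralZl//; [|by move=> x _; rewrite lee_fin|by rewrite lee_fin ltW].
  apply: lee_wpmul2l; first by rewrite lee_fin ltW.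
  by rewrite (nuE _ measurableT) leeDl.
rewrite ge0_integralZl//; [|exact/measurable_EFinP|by rewrite lee_fin powR_ge0].
by rewrite integral_indic// setIT.
Qed.

Lemma integral_decomposition m nu rho S (g : X -> R) : lebesgue_decomposition m nu rho S ->
  measurable_fun [set: borel X] g -> (forall x, 0 <= g x)%R ->
  \int[nu]_x (\1_(~` S) x * g x)%:E = \int[m]_x (g x * rho x)%:E.
Proof.
move=> [mrho rho0 mS S0 nuE] mg g0.
have mSC : measurable (~` S : set (borel X)) by exact: measurableC.
transitivity (\int[mrestr nu mSC]_x (g x)%:E).
  rewrite ge0_integral_mrestr//; last exact/measurable_EFinP.
  rewrite setTI [RHS]integral_mkcond; apply: eq_integral => x _.
  by rewrite epatch_indic EFinM muleC.
rewrite (@ge0_integral_density _ _ _ m (mrestr nu mSC) (EFin \o rho))//.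
- exact/measurable_EFinP.
- move=> A mA; rewrite /= /mrestr nuE; last exact: measurableI.
  rewrite -setIA setICl setI0 measure0 adde0.
  have -> : \int[m]_(x in A) (EFin \o rho) x = \int[m]_(x in A `\` S) (rho x)%:E.
    by apply: ge0_negligible_integral => //;
      first [by apply: measurable_funTS; exact/measurable_EFinP|by move=> x _; rewrite lee_fin].
  by rewrite setDE.
- exact/measurable_EFinP.
Qed.

Lemma integral_density_power m nu rho S (p : R) : lebesgue_decomposition m nu rho S ->
  (p < 0)%R -> (1 + p)%R != 0%R ->
  \int[nu]_x (density_power rho S p x)%:E = \int[m]_x (rho x `^ (1 + p))%:E.
Proof.
move=> dec p0 p1; have [mrho rho0 _ _ _] := dec.
rewrite (integral_decomposition dec); last by move=> x; exact: powR_ge0.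
  apply: eq_integral => x _; congr EFin.
  (* Where [rho] vanishes both sides do: a power of 0 with nonzero exponent is 0, negative exponents
     included. *)
  have [r0|r0] := eqVneq (rho x) 0%R; first by rewrite r0 mulr0 powR0.
  by rewrite powRD ?r0 ?implybT// powRr1// mulrC.
exact: (measurableT_comp (measurable_powR p) mrho).
Qed.

End entropy.

Lemma geo_length_continuous {R : realType} {X : metricType R} :
  continuous (@geo_length R X : geo X -> R).
Proof.
move=> g; apply: (@cvg_mdist R X _ (nbhs g) _ (geo_eval zero01) (geo_eval one01)).
  exact: geo_eval_continuous.
exact: geo_eval_continuous.
Qed.

Lemma measurable_long {R : realType} {X : pmetricType R} (Th : R) :
  measurable ([set g | Th < geo_length g] : set (borel (geo X))).
Proof.
apply: borel_open; rewrite (_ : mkset _ = @geo_length R X @^-1` [set u | Th < u])//.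
by apply: open_comp; [move=> ? _; exact: geo_length_continuous|exact: open_gt].
Qed.

Lemma measurable_slice {R : realType} {X : pmetricType R} (A : set X) (t : {i01 R}) : measurable (A : set (borel X)) ->
  measurable ([set g | A (g t)] : set (borel (geo X))).
Proof.
move=> mA; rewrite -[mkset _]setTI.
exact: (measurable_funPT (geo_eval t : borel (geo X) -> borel X)).
Qed.

Section curvature_dimension.
Local Open Scope ereal_scope.
Context {R : realType} {X : pmetricType R}.
Variables (m : {measure set (borel X) -> \bar R}) (K N Th : R) (B : set X).
Hypotheses (N1 : (1 < N)%R) (mB : measurable (B : set (borel X))) (Boo : m B < +oo).
Variable q : {measure set (borel (geo X)) -> \bar R}.
Hypotheses (qoo : q setT < +oo) (cd : CD_inequality m K N q).
Hypothesis qB : forall t : {i01 R}, q [set g | ~ B (g t)] = 0.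
Hypothesis qTh : q [set g | Th < geo_length g]%R = 0.

Let ev t := pushforward q (geo_eval t : borel (geo X) -> borel X).

Lemma eval_decomposition (t : {i01 R}) : exists rho S,
  lebesgue_decomposition m (ev t) rho S /\ (forall x, ~ B x -> rho x = 0%R).
Proof.
have met : measurable_fun [set: borel (geo X)] (geo_eval t : borel (geo X) -> borel X).
  exact: measurable_funPT.
exact: (@finite_lebesgue_decomposition R X m (push q met) B qoo mB Boo (qB t)).
Qed.

Lemma nonneg_density_power rho S p x : (0 <= density_power (X := X) rho S p x)%R.
Proof. by rewrite mulr_ge0// powR_ge0. Qed.

Lemma tau_coeff_ge0 (t theta : R) : (0 <= t <= 1)%R -> (0 <= theta)%R ->
  0 <= tau_coeff K N t theta.
Proof.
move=> t01 th0; have thth : (0 <= theta <= theta)%R by rewrite th0 lexx.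
apply: le_trans (tau_coeff_ge K N1 t01 thth).
by rewrite lee_fin mulr_ge0 ?expR_ge0//; case/andP: t01.
Qed.

(* [w] is either endpoint map. *)
Let weighted_bound (w : geo X -> X) (rho : X -> R) (S : set X) (t : R)
    (G : geo X -> \bar R) :
  measurable_fun [set: borel (geo X)] (w : borel (geo X) -> borel X) ->
  lebesgue_decomposition m (pushforward q (w : borel (geo X) -> borel X)) rho S ->
  (0 <= t <= 1)%R ->
  (forall g, tau_coeff K N t (geo_length g) *
     (density_power rho S (- N^-1) (w g))%:E <= G g) ->
  (contr_coeff K N Th t)%:E * entropy m N rho <= \int[q]_g G g.
Proof.
move=> mw dec t01 HG; have [mrho rho0 mS _ _] := dec.
have N00 : (0 < N)%R by exact: lt_trans ltr01 N1.
have c0 : (0 <= contr_coeff K N Th t)%R.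
  by rewrite mulr_ge0 ?expR_ge0//; case/andP: t01.
have mdp : measurable_fun [set: borel X] (density_power rho S (- N^-1)).
  rewrite /density_power; apply: measurable_funM => //.
    by apply: measurable_indic; exact: measurableC.
  exact: (measurableT_comp (measurable_powR (- N^-1)%R) mrho).
have G0 g : 0 <= G g.
  apply: le_trans (HG g); rewrite mule_ge0 ?tau_coeff_ge0 ?mdist_ge0//.
  by rewrite lee_fin nonneg_density_power.
have mdpw : measurable_fun [set: borel (geo X)]
    (fun g : borel (geo X) => (density_power rho S (- N^-1) (w g))%:E).
  by apply/measurable_EFinP; exact: (measurableT_comp mdp mw).
have -> : entropy m N rho = \int[q]_g (density_power rho S (- N^-1) (w g))%:E.
  rewrite -(@ge0_integral_push _ _ _ _ _ q _ mw (fun x => (density_power rho S (- N^-1) x)%:E)).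
  - rewrite (@integral_density_power _ _ m (push q mw) rho S (- N^-1)%R)//.
    + by rewrite oppr_lt0 invr_gt0.
    + by rewrite subr_eq0 eq_sym invr_eq1 gt_eqF.
  - exact/measurable_EFinP.
  - by move=> x; rewrite lee_fin nonneg_density_power.
rewrite -ge0_integralZl//; [|by move=> g _; rewrite lee_fin nonneg_density_power].
rewrite (ge0_negligible_integral (measurable_long Th))//; last first.
- by move=> g _; rewrite mule_ge0 ?lee_fin// nonneg_density_power.
- exact: emeasurable_funM.
apply: (@le_trans _ _ (\int[q]_(g in setT `\` [set g | Th < geo_length g]%R) G g)).
  apply: ge0_le_integral_nonmeas => g [_ /=].
    by move=> _; rewrite mule_ge0 ?lee_fin// nonneg_density_power.
  move=> /negP; rewrite -leNgt => gTh; apply: le_trans (HG g).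
  apply: lee_wpmul2r; first by rewrite lee_fin nonneg_density_power.
  by apply: tau_coeff_ge => //; rewrite mdist_ge0.
rewrite [leLHS]integral_mkcond; apply: ge0_le_integral_nonmeas => g _.
  by rewrite patchE; case: ifP.
by rewrite patchE; case: ifP.
Qed.

Let ev_measurable (t : {i01 R}) :
  measurable_fun [set: borel (geo X)] (geo_eval t : borel (geo X) -> borel X).
Proof. exact: measurable_funPT. Qed.

(** The CD inequality asks for decompositions at all times at once, so the two given ones are
    completed by arbitrary choices; of its two nonnegative terms only that of the initial density is
    kept. *)
Lemma CD_start (t : {i01 R}) rho0 S0 rhot St : (0 < t%:num)%R ->
  lebesgue_decomposition m (ev zero01) rho0 S0 -> lebesgue_decomposition m (ev t) rhot St ->
  (contr_coeff K N Th (1 - t%:num))%:E * entropy m N rho0 <= entropy m N rhot.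
Proof.
move=> t0 d0 dt; have [r rP] := choice eval_decomposition.
have [T TP] := choice rP.
pose rho (s : {i01 R}) := if s == zero01 then rho0 else if s == t then rhot else r s.
pose S (s : {i01 R}) := if s == zero01 then S0 else if s == t then St else T s.
have H s : lebesgue_decomposition m (ev s) (rho s) (S s).
  rewrite /rho /S; case: eqP => [->//|_]; case: eqP => [->//|_].
  by case: (TP s).
have := cd H t (lexx N).
have tE : rho t = rhot.
  rewrite /rho eqxx; case: eqP => // tz; move: t0; rewrite tz /=; by rewrite ltxx.
rewrite tE; apply: le_trans.
have t01 : (0 <= 1 - t%:num <= 1)%R.
  by rewrite subr_ge0 lerBlDr lerDl; apply/andP.
apply: (@weighted_bound (@geo_start R X) rho0 S0 _ _ (ev_measurable zero01) d0 t01) => g.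
have rE : rho zero01 = rho0 by rewrite /rho eqxx.
have sE : S zero01 = S0 by rewrite /S eqxx.
rewrite -rE -sE; apply: leeDl; apply: mule_ge0.
  by apply: tau_coeff_ge0; [apply/andP|exact: mdist_ge0].
by rewrite lee_fin nonneg_density_power.
Qed.

Lemma CD_end (t : {i01 R}) rho1 S1 rhot St : (t%:num < 1)%R ->
  lebesgue_decomposition m (ev one01) rho1 S1 -> lebesgue_decomposition m (ev t) rhot St ->
  (contr_coeff K N Th t%:num)%:E * entropy m N rho1 <= entropy m N rhot.
Proof.
move=> t0 d1 dt; have [r rP] := choice eval_decomposition.
have [T TP] := choice rP.
pose rho (s : {i01 R}) := if s == one01 then rho1 else if s == t then rhot else r s.
pose S (s : {i01 R}) := if s == one01 then S1 else if s == t then St else T s.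
have H s : lebesgue_decomposition m (ev s) (rho s) (S s).
  rewrite /rho /S; case: eqP => [->//|_]; case: eqP => [->//|_].
  by case: (TP s).
have := cd H t (lexx N).
have tE : rho t = rhot.
  rewrite /rho eqxx; case: eqP => // tz; move: t0; rewrite tz /=; by rewrite ltxx.
rewrite tE; apply: le_trans.
have t01 : (0 <= t%:num <= 1)%R by apply/andP.
apply: (@weighted_bound (@geo_end R X) rho1 S1 _ _ (ev_measurable one01) d1 t01) => g.
have rE : rho one01 = rho1 by rewrite /rho eqxx.
have sE : S one01 = S1 by rewrite /S eqxx.
rewrite -rE -sE; apply: leeDr; apply: mule_ge0.
  apply: tau_coeff_ge0; [|exact: mdist_ge0].
  by rewrite subr_ge0 lerBlDr lerDl; apply/andP.
by rewrite lee_fin nonneg_density_power.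
Qed.

End curvature_dimension.

(** * Plans of very strict CD spaces do not branch *)

Lemma countable_open_separation (R : realType) (X : metricType R) (D : set X) :
  countable D -> dense D -> exists V : nat -> set X,
    (forall n, open (V n)) /\ forall x y : X, x != y -> exists n, V n x /\ ~ V n y.
Proof.
move=> cD dD; have [B /countable_injP[f finj] [Bo Bb]] := separable_second_countable cD dD.
exists (fun n => \bigcup_(U in [set U | B U /\ f U = n]) U); split.
  by move=> n; apply: bigcup_open => U [BU _]; exact: Bo.
move=> x y xy; have d0 : 0 < mdist x y by rewrite mdist_gt0.
have [|U [BU Ux] Uy] := Bb x [set z | mdist x z < mdist x y].
  by apply/nbhs_mdist; exists (mdist x y).
exists (f U); split; first by exists U.
move=> [W [BW /finj fWU] Wy].
move: Wy; rewrite fWU ?inE// => /Uy /=; by rewrite ltxx.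
Qed.

Lemma ge0_integral0_null d (T : measurableType d) (R : realType)
    (m : {measure set T -> \bar R}) (f : T -> R) :
  measurable_fun [set: T] f -> (forall x, 0 <= f x) -> (\int[m]_x (f x)%:E = 0)%E ->
  m [set x | 0 < f x] = 0%E.
Proof.
move=> mf f0 If.
have mf' : measurable_fun [set: T] (EFin \o f) by exact/measurable_EFinP.
have /(ae_eq_integral_abs m measurableT mf')[Z [mZ Z0 Zsub]] :
    (\int[m]_x `|(EFin \o f) x| = 0)%E.
  by rewrite -[RHS]If; apply: eq_integral => x _; rewrite gee0_abs// lee_fin.
apply: (subset_measure0 _ mZ _ Z0) => [|x /= fx].
  by rewrite -[mkset _]setTI; exact: measurable_fun_ltr.
by apply: Zsub => /= /(_ I) [fx0]; move: fx; rewrite fx0 ltxx.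
Qed.

Lemma null_integral0 d (T : measurableType d) (R : realType)
    (m : {measure set T -> \bar R}) (f : T -> R) :
  measurable_fun [set: T] f -> (forall x, 0 <= f x) -> m [set x | 0 < f x] = 0%E ->
  (\int[m]_x (f x)%:E = 0)%E.
Proof.
move=> mf f0 m0; have mf' : measurable_fun [set: T] (EFin \o f) by exact/measurable_EFinP.
have mP : measurable [set x | 0 < f x] by rewrite -[mkset _]setTI; exact: measurable_fun_ltr.
rewrite (ge0_negligible_integral mP)//; last by move=> x _; rewrite lee_fin.
rewrite integral0_eq// => x [_ /= /negP]; rewrite -leNgt => fx.
by congr EFin; apply/eqP; rewrite eq_le fx f0.
Qed.

(** Zero entropy forces the density to vanish almost everywhere, leaving only a singular part, which
    absolute continuity excludes. *)
Lemma entropy_gt0 {R : realType} {X : pmetricType R}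
    (m nu : {measure set (borel X) -> \bar R}) (N : R) rho S : 1 < N ->
  lebesgue_decomposition m nu rho S ->
  (forall A : set (borel X), measurable A -> m A = 0%E -> nu A = 0%E) ->
  (0 < nu setT)%E -> (0 < entropy m N rho)%E.
Proof.
move=> N1 [mrho rho0 mS S0 nuE] ac nuT.
have N0 : 0 < N by exact: lt_trans ltr01 N1.
have mp : measurable_fun [set: borel X] (fun x => (rho x `^ (1 - N^-1))%:E).
  by apply/measurable_EFinP; exact: (measurableT_comp (measurable_powR (1 - N^-1)) mrho).
rewrite lt0e integral_ge0 ?andbT; last by move=> x _; rewrite lee_fin powR_ge0.
apply/negP => /eqP H0; move: nuT.
rewrite (nuE _ measurableT) setTI (ac S)// adde0 null_integral0 ?ltxx//.
rewrite -[RHS](ge0_integral0_null _ _ H0).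
- congr (m _); apply/seteqP; split => x /=; first by move=> r0; rewrite powR_gt0.
  move=> h; rewrite lt_neqAle rho0 andbT; apply/eqP => rx.
  move: h; rewrite -rx powR0 ?ltxx// subr_eq0 eq_sym invr_eq1 gt_eqF//.
- exact/measurable_EFinP.
- by move=> x; exact: powR_ge0.
Qed.

Section decomposition.
Local Open Scope ereal_scope.
Context {R : realType} {X : pmetricType R}.
Implicit Types (m nu : {measure set (borel X) -> \bar R}) (rho : X -> R) (S B : set X).

Lemma eq_lebesgue_decomposition m (nu nu' : set (borel X) -> \bar R) rho S :
  (forall A : set (borel X), measurable A -> nu A = nu' A) ->
  lebesgue_decomposition m nu rho S -> lebesgue_decomposition m nu' rho S.
Proof.
move=> nuE [mrho rho0 mS S0 H]; split => // A mA.
rewrite -nuE// -nuE; last exact: measurableI.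
exact: H.
Qed.

Lemma avg_lebesgue_decomposition m (nu nu1 nu2 : {measure set (borel X) -> \bar R})
    rho1 S1 rho2 S2 :
  (forall A : set (borel X), measurable A -> nu A = (2^-1)%:E * (nu1 A + nu2 A)) ->
  lebesgue_decomposition m nu1 rho1 S1 -> lebesgue_decomposition m nu2 rho2 S2 ->
  lebesgue_decomposition m nu (fun x => 2^-1 * (rho1 x + rho2 x))%R (S1 `|` S2).
Proof.
move=> nuE [mrho1 rho10 mS1 S10 nu1E] [mrho2 rho20 mS2 S20 nu2E].
have mS : measurable (S1 `|` S2 : set (borel X)) by exact: measurableU.
have S0 : m (S1 `|` S2) = 0.
  apply/eqP; rewrite eq_le measure_ge0 andbT.
  by apply: le_trans (measureU2 m mS1 mS2) _; rewrite -[X in _ <= X](adde0 0) -{1}S10 -S20.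
(* Off its own singular set each measure has a density, so the null set of the other one adds no
   mass. *)
have part (nu' : {measure set (borel X) -> \bar R}) rho' S' (A : set (borel X)) :
    measurable A -> measurable (S' : set (borel X)) ->
    measurable_fun [set: borel X] rho' -> S' `<=` S1 `|` S2 ->
    (forall A : set (borel X), measurable A ->
      nu' A = \int[m]_(x in A) (rho' x)%:E + nu' (A `&` S')) ->
    nu' (A `&` (S1 `|` S2)) = nu' (A `&` S').
  move=> mA mS' mrho' sub H; rewrite H; last exact: measurableI.
  rewrite null_set_integral ?add0e.
  - by rewrite -setIA (setIidr sub).
  - exact: measurableI.
  - by apply: measurable_funTS; exact/measurable_EFinP.
  - apply/eqP; rewrite eq_le measure_ge0 andbT -[leRHS]S0.
    by apply: le_measure; rewrite ?inE//; exact: measurableI.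
split => //.
- by apply: measurable_funM => //; exact: measurable_funD.
- by move=> x; rewrite mulr_ge0 ?addr_ge0.
- move=> A mA; rewrite !nuE//; last exact: measurableI.
  rewrite (part nu1 rho1 S1)// (part nu2 rho2 S2)//.
  under [in RHS]eq_integral do rewrite EFinM EFinD.
  rewrite ge0_integralZl//; first last.
  - by move=> x _; rewrite adde_ge0// lee_fin.
  - by apply: measurable_funTS; apply: emeasurable_funD; exact/measurable_EFinP.
  rewrite ge0_integralD//.
  + rewrite -ge0_muleDr.
    * by congr (_ * _); rewrite addeACA -nu1E// -nu2E.
    * by apply: adde_ge0; apply: integral_ge0 => x _; rewrite lee_fin.
    * by apply: adde_ge0; exact: measure_ge0.
  + by move=> x _; rewrite lee_fin.
  + by apply: measurable_funTS; exact/measurable_EFinP.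
  + by move=> x _; rewrite lee_fin.
  + by apply: measurable_funTS; exact/measurable_EFinP.
Qed.

(** At each point one density vanishes, so the power of the sum is the sum of the powers. The factor
    exceeds the 1/2 of a plain mean by 2^(1/N). *)
Lemma entropy_avg m (N : R) rho1 rho2 : (1 < N)%R ->
  measurable_fun [set: borel X] rho1 -> measurable_fun [set: borel X] rho2 ->
  (forall x, 0 <= rho1 x)%R -> (forall x, 0 <= rho2 x)%R ->
  (forall x, rho1 x = 0 \/ rho2 x = 0)%R ->
  entropy m N (fun x => 2^-1 * (rho1 x + rho2 x))%R =
  (2^-1 `^ (1 - N^-1))%:E * (entropy m N rho1 + entropy m N rho2).
Proof.
move=> N1 mrho1 mrho2 rho10 rho20 disj.
have N0 : (0 < N)%R by exact: lt_trans ltr01 N1.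
have p0 : (1 - N^-1 != 0)%R by rewrite subr_eq0 eq_sym invr_eq1 gt_eqF.
have mp rho : measurable_fun [set: borel X] rho ->
    measurable_fun [set: borel X] (fun x => (rho x `^ (1 - N^-1))%:E).
  move=> mrho; apply/measurable_EFinP.
  exact: (measurableT_comp (measurable_powR (1 - N^-1)) mrho).
rewrite /entropy -ge0_integralD//; first last.
- exact: mp.
- by move=> x _; rewrite lee_fin powR_ge0.
- exact: mp.
- by move=> x _; rewrite lee_fin powR_ge0.
rewrite -ge0_integralZl//; first last.
- by move=> x _; rewrite adde_ge0// lee_fin powR_ge0.
- by apply: emeasurable_funD; exact: mp.
apply: eq_integral => x _; rewrite -EFinD -EFinM; congr EFin.
by case: (disj x) => ->; rewrite powR0// ?add0r ?addr0 powRM.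
Qed.

End decomposition.

(** The two coefficients are the losses of [CD_forward] and [CD_backward] between these times; the
    last condition says that together they do not use up the gain 2^(1/N) of [entropy_avg]. *)
Definition close_times {R : realType} (K N Th : R) (s1 s2 : {i01 R}) :=
  [/\ 0 < s1%:num, s1%:num < s2%:num, s2%:num < 1 &
   1 < 2 `^ N^-1 * (contr_coeff K N Th ((1 - s2%:num) / (1 - s1%:num))
                    * contr_coeff K N Th (s1%:num / s2%:num))].

Lemma geo_eq_approx {R : realType} {X : metricType R} (g1 g2 : geo X) (s : {i01 R}) :
  (forall e, 0 < e -> exists u : {i01 R}, `|s%:num - u%:num| < e /\ g1 u = g2 u) ->
  g1 s = g2 s.
Proof.
move=> near; apply: mdist_positivity; apply/eqP; rewrite eq_le mdist_ge0 andbT.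
apply/ler_addgt0Pl => e e0; rewrite addr0.
pose L := geo_length g1 + geo_length g2 + 1.
have [l1 l2] : 0 <= geo_length g1 /\ 0 <= geo_length g2 by split; exact: mdist_ge0.
have L0 : 0 < L by rewrite /L; lra.
have [u [su gu]] := near (e / L) (divr_gt0 e0 L0).
apply: le_trans (metric_triangle _ (g1 u) _) _.
rewrite {2}gu (geo_speed g1) (geo_speed g2) (distrC u%:num) -mulrDr.
rewrite -[X in _ * X]/(geo_length g1 + geo_length g2).
apply: (@le_trans _ _ (e / L * L)); last by rewrite divfK// gt_eqF.
apply: ler_pM => //; [by rewrite addr_ge0|exact: ltW|by rewrite lerDl].
Qed.

Fact frac_subproof (R : realType) (a b : nat) : (0 <= a%:R / (a + b)%:R :> R) && (a%:R / (a + b)%:R <= 1 :> R).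
Proof.
rewrite divr_ge0//=; have [->|ab] := posnP (a + b); first by rewrite invr0 mulr0.
by rewrite ler_pdivrMr ?ltr0n// mul1r ler_nat leq_addr.
Qed.

(** Every rational of the unit interval arises from two natural numbers without side condition,
    which makes a countable family of times easy to index; [frac R 0 0] is 0. *)
Definition frac (R : realType) (a b : nat) : {i01 R} :=
  Itv01 (proj1 (andP (frac_subproof R a b))) (proj2 (andP (frac_subproof R a b))).

Lemma close_times_uniform {R : realType} (K N Th : R) : 1 < N ->
  exists2 d, 0 < d & forall s1 s2 : {i01 R}, 0 < s1%:num -> s1%:num < s2%:num ->
    s2%:num < 1 -> s2%:num - s1%:num < d * (1 - s1%:num) ->
    s2%:num - s1%:num < d * s2%:num -> close_times K N Th s1 s2.
Proof.
move=> N1; have N0 : 0 < N by exact: lt_trans ltr01 N1.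
pose r : R := 2 `^ N^-1.
have r1 : 1 < r.
  have : 1 `^ N^-1 < r by apply: gt0_ltr_powR; rewrite ?nnegrE ?invr_gt0// ltr1n.
  by rewrite powR1.
have r0 : 0 < r by exact: lt_trans r1.
(* Both coefficients will exceed [1 - x], and [r * (1 - x) ^+ 2] is above [r - 2 * (r * x)], the
   mean of [r] and 1. *)
pose x := (r - 1) / (4 * r).
have x0 : 0 < x by rewrite divr_gt0 ?subr_gt0 ?mulr_gt0.
have xr : r * x = (r - 1) / 4 by rewrite /x; field; rewrite gt_eqF.
have e1 : 1 - x < 1 by rewrite ltrBlDl ltrDr.
have x1 : 0 < 1 - x.
  rewrite subr_gt0 /x ltr_pdivrMr ?mulr_gt0// mul1r; lra.
have [d d0 dP] := contr_coeff_cvg1 K N Th e1.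
exists d => // s1 s2 s10 s12 s21 h1 h2; split => //.
have s110 : 0 < 1 - s1%:num by rewrite subr_gt0 (lt_trans s12).
have s20 : 0 < s2%:num by exact: lt_trans s12.
have c1 : 1 - x < contr_coeff K N Th ((1 - s2%:num) / (1 - s1%:num)).
  apply: dP; last by rewrite ler_pdivrMr// mul1r lerD2l lerN2 ltW.
  by rewrite ltr_pdivlMr//; nra.
have c2 : 1 - x < contr_coeff K N Th (s1%:num / s2%:num).
  apply: dP; last by rewrite ler_pdivrMr// mul1r ltW.
  by rewrite ltr_pdivlMr//; nra.
rewrite -/r; move: c1 c2; set a := contr_coeff _ _ _ _; set b := contr_coeff _ _ _ _ => c1 c2.
have ab : (1 - x) * (1 - x) < a * b.
  by apply: ltr_pM => //; exact: ltW.
apply: (@lt_trans _ _ (r * ((1 - x) * (1 - x)))); last by rewrite ltr_pM2l.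
have -> : r * ((1 - x) * (1 - x)) = r - 2 * (r * x) + r * x * x by ring.
rewrite xr; have : 0 < (r - 1) / 4 * x by rewrite mulr_gt0// divr_gt0 ?subr_gt0.
lra.
Qed.

Section nonbranching_plan.
Local Open Scope ereal_scope.
Context {R : realType} {X : pmetricType R}.
Variables (m : {measure set (borel X) -> \bar R}) (K N Th : R) (B : set X).
Hypotheses (N1 : (1 < N)%R) (mB : measurable (B : set (borel X))) (Boo : m B < +oo).
Variable eta : probability (borel (geo X)) R.
Hypothesis cd : forall F : geo X -> R, measurable_fun [set: borel (geo X)] F ->
  (forall g, 0 <= F g)%R -> (exists M, forall g, F g <= M)%R -> \int[eta]_g (F g)%:E = 1 ->
  forall t1 t2 : {i01 R}, (t1%:num < t2%:num)%R ->
  CD_inequality m K N (pushforward (reweight eta (EFin \o F))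
    (geo_restr t1 t2 : borel (geo X) -> borel (geo X))).
Hypothesis etaB : forall t : {i01 R}, eta [set g | ~ B (g t)] = 0.
Hypothesis etaTh : eta [set g | Th < geo_length g]%R = 0.
Hypothesis ac0 : forall A : set (borel X), measurable A -> m A = 0 ->
  eta [set g | A (g zero01)] = 0.

Let ev_measurable (t : {i01 R}) :
  measurable_fun [set: borel (geo X)] (geo_eval t : borel (geo X) -> borel X).
Proof. exact: measurable_funPT. Qed.

Let restr_measurable (s t : {i01 R}) : measurable_fun [set: borel (geo X)]
  (geo_restr s t : borel (geo X) -> borel (geo X)).
Proof. exact: measurable_funPT. Qed.

Section weight.
Variables (F : geo X -> R) (mF : measurable_fun [set: borel (geo X)] F).
Hypotheses (F0 : forall g, (0 <= F g)%R) (FM : exists M, forall g, (F g <= M)%R).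
Hypothesis F1 : \int[eta]_g (F g)%:E = 1.

Let nu := dens eta mF F0.
Let q s t := push nu (restr_measurable s t).

Let nuT : nu setT = 1. Proof. exact: F1. Qed.

Let q_fin s t : q s t setT < +oo.
Proof. by rewrite -[q s t setT]/(nu setT) nuT ltry. Qed.

Let q_B s t (u : {i01 R}) : q s t [set g | ~ B (g u)] = 0.
Proof.
rewrite /q /push /pushforward /=; apply: dens_dominated; last exact: etaB.
by have := ev_measurable (conv01 s t u) measurableT (measurableC mB); rewrite setTI.
Qed.

Let q_len s t : q s t [set g | Th < geo_length g]%R = 0.
Proof.
rewrite /q /push /pushforward /=; apply: dens_dominated.
  by rewrite -[X in measurable X]setTI; apply: (restr_measurable s t) => //; exact: measurable_long.
apply: (@subset_measure0 _ _ _ eta _ [set g : geo X | Th < geo_length g]%R _ (measurable_long Th) _ etaTh) => [|g /=].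
  by rewrite -[X in measurable X]setTI; apply: (restr_measurable s t) => //; exact: measurable_long.
move=> /lt_le_trans; apply.
rewrite /geo_length /geo_start /geo_end /= geo_speed ler_piMl ?mdist_ge0//=.
have [s0 s1 t0 t1] : [/\ 0 <= s%:num, s%:num <= 1, 0 <= t%:num & t%:num <= 1 :> R]%R by [].
rewrite ler_norml; apply/andP; split; lra.
Qed.

Let evF t := push nu (ev_measurable t).

(** This is the CD inequality for the plan restricted to [[s1, 1]], at the relative time of [s2];
    [CD_backward] uses [[0, s2]] at the relative time of [s1]. The inequality bounds the entropy at
    an intermediate time by that at an end, so the restriction must extend beyond the pair of
    times. *)
Lemma CD_forward (s1 s2 : {i01 R}) rho1 S1 rho2 S2 : (s1%:num < s2%:num)%R ->
  lebesgue_decomposition m (evF s1) rho1 S1 -> lebesgue_decomposition m (evF s2) rho2 S2 ->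
  (contr_coeff K N Th ((1 - s2%:num) / (1 - s1%:num)))%:E * entropy m N rho1
    <= entropy m N rho2.
Proof.
move=> s12 d1 d2; have s21 : (s2%:num <= 1)%R by [].
have s1n : (1 - s1%:num != 0)%R by rewrite subr_eq0 gt_eqF// (lt_le_trans s12).
have l01 : (0 <= (s2%:num - s1%:num) / (1 - s1%:num) <= 1)%R.
  have d0 : (0 < 1 - s1%:num)%R by rewrite subr_gt0 (lt_le_trans s12).
  by rewrite ler_pdivrMr// mul1r lerD2r s21 divr_ge0 ?(ltW d0) ?subr_ge0 ?(ltW s12).
pose lam : {i01 R} := Itv01 (proj1 (andP l01)) (proj2 (andP l01)).
have c1 : conv01 s1 one01 lam = s2.
  apply/val_inj => /=; field; exact: s1n.
have c0 : conv01 s1 one01 zero01 = s1.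
  apply/val_inj => /=; ring.
have lam0 : (0 < lam%:num)%R by rewrite /= divr_gt0 ?subr_gt0// (lt_le_trans s12).
have s1one : (s1%:num < one01%:num :> R)%R by rewrite (lt_le_trans s12).
have := @CD_start R X m K N Th B N1 mB Boo (q s1 one01) (q_fin _ _)
  (cd mF F0 FM F1 s1one) (q_B _ _) (q_len _ _) lam rho1 S1 rho2 S2 lam0.
have -> : (1 - lam%:num = (1 - s2%:num) / (1 - s1%:num))%R by rewrite /=; field.
apply.
- by move: d1; rewrite -[in evF s1]c0.
- by move: d2; rewrite -[in evF s2]c1.
Qed.

Lemma CD_backward (s1 s2 : {i01 R}) rho1 S1 rho2 S2 : (s1%:num < s2%:num)%R ->
  lebesgue_decomposition m (evF s1) rho1 S1 -> lebesgue_decomposition m (evF s2) rho2 S2 ->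
  (contr_coeff K N Th (s1%:num / s2%:num))%:E * entropy m N rho2 <= entropy m N rho1.
Proof.
move=> s12 d1 d2; have s10 : (0 <= s1%:num)%R by [].
have s20 : (0 < s2%:num)%R by exact: le_lt_trans s12.
have s2n : (s2%:num != 0)%R by rewrite gt_eqF.
have l01 : (0 <= s1%:num / s2%:num <= 1)%R.
  by rewrite divr_ge0//= ler_pdivrMr ?mul1r// ltW.
pose lam : {i01 R} := Itv01 (proj1 (andP l01)) (proj2 (andP l01)).
have c1 : conv01 zero01 s2 lam = s1.
  apply/val_inj => /=; field; exact: s2n.
have c0 : conv01 zero01 s2 one01 = s2.
  apply/val_inj => /=; ring.
have lam0 : (lam%:num < 1)%R by rewrite /= ltr_pdivrMr ?mul1r.
have s2zero : (zero01%:num < s2%:num :> R)%R by [].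
have := @CD_end R X m K N Th B N1 mB Boo (q zero01 s2) (q_fin _ _)
  (cd mF F0 FM F1 s2zero) (q_B _ _) (q_len _ _) lam rho2 S2 rho1 S1 lam0.
apply.
- by move: d2; rewrite -[in evF s2]c0.
- by move: d1; rewrite -[in evF s1]c1.
Qed.

End weight.

Lemma CD_plan_entropy (t : {i01 R}) rho0 S0 rhot St : (0 < t%:num)%R ->
  lebesgue_decomposition m (pushforward eta (geo_eval zero01 : borel (geo X) -> borel X)) rho0 S0 ->
  lebesgue_decomposition m (pushforward eta (geo_eval t : borel (geo X) -> borel X)) rhot St ->
  (contr_coeff K N Th (1 - t%:num))%:E * entropy m N rho0 <= entropy m N rhot.
Proof.
move=> t0 d0 dt; pose F : geo X -> R := cst 1%R.
have mF : measurable_fun [set: borel (geo X)] F by exact: measurable_cst.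
have F0 g : (0 <= F g)%R by exact: ler01.
have FM : exists M, forall g, (F g <= M)%R by exists 1%R.
have FE (A : set (borel (geo X))) : measurable A -> \int[eta]_(g in A) (F g)%:E = eta A.
  move=> mA; rewrite (_ : \int[eta]_(g in A) (F g)%:E = \int[eta]_(g in A) 1)//.
  by rewrite integral_cst// mul1e.
have F1 : \int[eta]_g (F g)%:E = 1 by rewrite FE// probability_setT.
have := @CD_forward F mF F0 FM F1 zero01 t rho0 S0 rhot St t0.
rewrite /= subr0 divr1; apply.
- apply: eq_lebesgue_decomposition d0 => A mA; apply/esym/FE.
  exact: (measurable_slice zero01 mA).
- apply: eq_lebesgue_decomposition dt => A mA; apply/esym/FE.
  exact: (measurable_slice t mA).
Qed.

Let dens_fin (F : geo X -> R) mF F0 : \int[eta]_g (F g)%:E = 1 -> dens eta (f := F) mF F0 setT < +oo.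
Proof. by move=> F1; rewrite -[dens _ _ _ _]/(\int[eta]_g (F g)%:E) F1 ltry. Qed.

Let plan_decomposition (F : geo X -> R) mF F0 (F1 : \int[eta]_g (F g)%:E = 1) (s : {i01 R}) (V : set X) :
  measurable (V : set (borel X)) -> (forall g : geo X, ~ V (g s) -> F g = 0%R) ->
  exists rho S, lebesgue_decomposition m (push (dens eta (f := F) mF F0) (ev_measurable s)) rho S
    /\ (forall x, ~ (B x /\ V x) -> rho x = 0%R).
Proof.
move=> mV VF; pose nu := dens eta mF F0.
have mBV : measurable (B `&` V : set (borel X)) by exact: measurableI.
have [||||rho [S [dS rho0]]] := @finite_lebesgue_decomposition R X m (push nu (ev_measurable s)) (B `&` V).
- exact: (dens_fin mF F0 F1).
- exact: mBV.
- by apply: le_lt_trans Boo; apply: le_measure; rewrite ?inE.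
- have mVs : measurable ((fun g : geo X => ~ V (g s)) : set (borel (geo X))).
    by have := ev_measurable s measurableT (measurableC mV); rewrite setTI.
  have mBs : measurable ((fun g : geo X => ~ B (g s)) : set (borel (geo X))).
    by have := ev_measurable s measurableT (measurableC mB); rewrite setTI.
  have nB : nu [set g | ~ B (g s)] = 0 by apply: dens_dominated => //; exact: etaB.
  have nV : nu [set g | ~ V (g s)] = 0.
    rewrite -[nu _]/(\int[eta]_(g in [set g | ~ V (g s)]) (F g)%:E).
    by apply: integral0_eq => g /= /VF ->.
  apply/eqP; rewrite eq_le measure_ge0 andbT setCI.
  apply: (@le_trans _ _ (nu ([set g | ~ B (g s)] `|` [set g | ~ V (g s)]))) => //.
  have hB : nu [set g | ~ B (g s)] <= 0 by rewrite nB.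
  have hV : nu [set g | ~ V (g s)] <= 0 by rewrite nV.
  by apply: le_trans (measureU2 nu mBs mVs) _; rewrite -[leRHS](adde0 0); exact: leeD hB hV.
by exists rho, S; split.
Qed.

(* At time [s1] the weights [F1] and [F2] give the same law, at time [s2] their average has
   entropy [2 `^ N^-1] times the mean of two entropies bounded below by that at time [s1]. *)
Lemma CD_no_split (s1 s2 : {i01 R}) (V : set X) (F1 F2 : geo X -> R)
    (mF1 : measurable_fun [set: borel (geo X)] F1)
    (mF2 : measurable_fun [set: borel (geo X)] F2)
    (F10 : forall g, (0 <= F1 g)%R) (F20 : forall g, (0 <= F2 g)%R) :
  close_times K N Th s1 s2 -> measurable (V : set (borel X)) ->
  (exists M, forall g, F1 g <= M)%R -> (exists M, forall g, F2 g <= M)%R ->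
  \int[eta]_g (F1 g)%:E = 1 -> \int[eta]_g (F2 g)%:E = 1 ->
  (forall g : geo X, ~ V (g s2) -> F1 g = 0%R) -> (forall g : geo X, V (g s2) -> F2 g = 0%R) ->
  (forall A : set (borel X), measurable A ->
    \int[eta]_(g in [set g | A (g s1)]) (F1 g)%:E =
    \int[eta]_(g in [set g | A (g s1)]) (F2 g)%:E) -> False.
Proof.
move=> [s10 s12 s21 gap] mV [M1 F1M] [M2 F2M] I1 I2 V1 V2 FE.
have N00 : (0 < N)%R by exact: lt_trans ltr01 N1.
pose F g := (2^-1 * (F1 g + F2 g))%R.
have mF : measurable_fun [set: borel (geo X)] F.
  by apply: measurable_funM => //; exact: measurable_funD.
have F0 g : (0 <= F g)%R by rewrite mulr_ge0 ?addr_ge0.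
have FM : exists M, forall g, (F g <= M)%R.
  by exists (2^-1 * (M1 + M2))%R => g; rewrite ler_wpM2l ?lerD.
have FA (A : set (borel (geo X))) : measurable A -> \int[eta]_(g in A) (F g)%:E =
    (2^-1)%:E * (\int[eta]_(g in A) (F1 g)%:E + \int[eta]_(g in A) (F2 g)%:E).
  move=> mA; under eq_integral do rewrite EFinM EFinD.
  rewrite ge0_integralZl//; first last.
  - by move=> x _; rewrite adde_ge0// lee_fin.
  - by apply: measurable_funTS; apply: emeasurable_funD; exact/measurable_EFinP.
  rewrite ge0_integralD//.
  + by move=> x _; rewrite lee_fin.
  + by apply: measurable_funTS; exact/measurable_EFinP.
  + by move=> x _; rewrite lee_fin.
  + by apply: measurable_funTS; exact/measurable_EFinP.
have I0 : \int[eta]_g (F g)%:E = 1.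
  by rewrite FA// I1 I2 -EFinD -EFinM mulVf.
have [rho1 [S1 [d1 rho10]]] := plan_decomposition mF1 F10 I1 mV V1.
have [||rho2 [S2 [d2 rho20]]] := plan_decomposition (V := ~` V) mF2 F20 I2 (s := s2).
- exact: measurableC.
- by move=> g /= /contrapT; exact: V2.
(* [F1] and [F2], hence also [F], give the same law at [s1], so one decomposition serves all
   three. *)
have [rhob [Sb [db rhobB]]] := plan_decomposition (V := setT) (s := s1) mF1 F10 I1 measurableT (fun _ h => False_ind _ (h I)).
have db2 : lebesgue_decomposition m (push (dens eta mF2 F20) (ev_measurable s1)) rhob Sb.
  by apply: eq_lebesgue_decomposition db => A mA; exact: FE.
have dbF : lebesgue_decomposition m (push (dens eta mF F0) (ev_measurable s1)) rhob Sb.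
  apply: eq_lebesgue_decomposition db => A mA.
  rewrite -[RHS]/(\int[eta]_(g in [set g | A (g s1)]) (F g)%:E) FA.
    rewrite -FE// -[X in X = _]/(\int[eta]_(g in [set g | A (g s1)]) (F1 g)%:E).
    set u := integral _ _ _; case: u => [r||].
    - by rewrite -EFinD -EFinM; congr EFin; lra.
    - by rewrite gt0_muley// lte_fin.
    - by rewrite gt0_muleNy// lte_fin.
  by have := ev_measurable s1 measurableT mA; rewrite setTI.
pose rho x := (2^-1 * (rho1 x + rho2 x))%R.
have dF : lebesgue_decomposition m (push (dens eta mF F0) (ev_measurable s2)) rho (S1 `|` S2).
  apply: avg_lebesgue_decomposition d1 d2 => A mA.
  rewrite -[LHS]/(\int[eta]_(g in [set g | A (g s2)]) (F g)%:E) FA//.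
  by have := ev_measurable s2 measurableT mA; rewrite setTI.
have H1 := CD_forward (ex_intro _ M1 F1M) I1 s12 db d1.
have H2 := CD_forward (ex_intro _ M2 F2M) I2 s12 db2 d2.
have H3 := CD_backward FM I0 s12 dbF dF.
(* Nothing yet prevents the law at [s1] from being singular; positivity is carried over from time 0,
   where [ac0] gives absolute continuity. *)
have Ub : 0 < entropy m N rhob.
  have [rho0 [S0 [d0 _]]] := plan_decomposition (V := setT) (s := zero01) mF1 F10 I1 measurableT (fun _ h => False_ind _ (h I)).
  have := CD_forward (ex_intro _ M1 F1M) I1 (s10 : (zero01%:num < s1%:num)%R) d0 db.
  apply: lt_le_trans; apply: mule_gt0.
    rewrite lte_fin; apply: contr_coeff_gt0.
    by rewrite /= subr0 divr1 subr_gt0; exact: lt_trans s21.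
  apply: (entropy_gt0 N1 d0).
    move=> A mA A0; apply: dens_dominated; last exact: ac0.
    by have := ev_measurable zero01 measurableT mA; rewrite setTI.
  exact: (eq_ind_r (fun u => 0 < u) lte01 I1).
have Uoo : entropy m N rhob < +oo.
  apply: le_lt_trans (entropy_le N1 ltr01 mB db _) _.
    by move=> x nB; apply: rhobB => -[].
  by rewrite powR1 !mul1e lte_add_pinfty//; exact: (dens_fin mF1 F10 I1).
have [mr1 rp1 _ _ _] := d1; have [mr2 rp2 _ _ _] := d2.
have disj x : (rho1 x = 0 \/ rho2 x = 0)%R.
  have [Vx|nVx] := pselect (V x); [right; apply: rho20|left; apply: rho10].
    by move=> [_]; apply.
  by move=> [].
rewrite (entropy_avg m N1 mr1 mr2 rp1 rp2 disj) in H3.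
have [u uE] : exists u, entropy m N rhob = u%:E.
  by exists (fine (entropy m N rhob)); apply/esym/fineK; rewrite ge0_fin_numE;
    [exact: Uoo|exact: ltW].
move: H1 H2 H3 Ub; rewrite uE.
set a := contr_coeff _ _ _ _ in gap *; set b := contr_coeff _ _ _ _ in gap *.
set k := (2^-1 `^ _)%R => H1 H2 H3; rewrite lte_fin => u0.
have k0 : (0 < k)%R by rewrite powR_gt0// invr_gt0.
have b0 : (0 <= b)%R.
  by rewrite /b mulr_ge0 ?expR_ge0// divr_ge0.
have kE : (2 `^ N^-1 = 2 * k)%R.
  rewrite /k -(@powR_inv1 _ 2)// -powRrM mulN1r opprB powRB ?powRr1 ?pnatr_eq0 ?implybT//.
  by field.
(* Since [2 * k] is the gain 2^(1/N), the left-hand side is [u] times a number that [gap] puts above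
   1. *)
have : b%:E * (k%:E * ((a * u)%:E + (a * u)%:E)) <= u%:E.
  apply: le_trans H3; rewrite lee_wpmul2l ?lee_fin// lee_wpmul2l ?lee_fin ?(ltW k0)//.
  by rewrite EFinM; exact: leeD H1 H2.
rewrite -EFinD -!EFinM lee_fin leNgt => /negP; apply.
rewrite (_ : b * _ = u * (2 `^ N^-1 * (a * b)))%R; last by rewrite kE; ring.
by rewrite ltr_pMr.
Qed.



Let joint_integral (s1 s2 : {i01 R}) (W : set X) (mW : measurable (W : set (borel X)))
    (psi : X -> R) : measurable_fun [set: borel X] psi -> (forall x, 0 <= psi x)%R ->
  \int[eta]_g (psi (g s1) * \1_W (g s2))%:E =
  \int[push (mrestr eta (measurable_slice s2 mW)) (ev_measurable s1)]_x (psi x)%:E.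
Proof.
move=> mpsi psi0; have mpsi' : measurable_fun [set: borel X] (EFin \o psi).
  exact/measurable_EFinP.
rewrite ge0_integral_push// ge0_integral_mrestr//; last first.
- by move=> g; rewrite lee_fin.
- by apply/measurable_EFinP; exact: (measurableT_comp mpsi (ev_measurable s1)).
rewrite setTI [RHS]integral_mkcond; apply: eq_integral => g _.
by rewrite epatch_indic EFinM.
Qed.

(** Let [a1] and [a2] be the laws of [g s1] on the event [V (g s2)] and on its complement. If they
    are mutually singular, a set [S] of positions at [s1] decides about [V] at [s2] up to a null
    set. Otherwise their common part yields two weights that [CD_no_split] forbids; dividing by
    [1 + rho] keeps them bounded and [c] normalises them. *)
Lemma CD_separation (s1 s2 : {i01 R}) (V : set X) :
  close_times K N Th s1 s2 -> measurable (V : set (borel X)) ->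
  exists Z : set (geo X), [/\ measurable (Z : set (borel (geo X))), eta Z = 0 &
    forall g1 g2, ~ Z g1 -> ~ Z g2 -> g1 s1 = g2 s1 -> V (g1 s2) -> V (g2 s2)].
Proof.
move=> close mV; have mVC : measurable (~` V : set (borel X)) by exact: measurableC.
pose a1 := push (mrestr eta (measurable_slice s2 mV)) (ev_measurable s1).
pose a2 := push (mrestr eta (measurable_slice s2 mVC)) (ev_measurable s1).
have a_le1 W (mW : measurable (W : set (borel X))) :
    push (mrestr eta (measurable_slice s2 mW)) (ev_measurable s1) setT <= 1.
  by apply: (@probability_le1 _ _ _ eta); rewrite preimage_setT setTI; exact: measurable_slice.
have [||||rho [S [dS _]]] := @finite_lebesgue_decomposition R X a2 a1 setT.
- exact: le_lt_trans (a_le1 _ mV) (ltry _).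
- exact: measurableT.
- exact: le_lt_trans (a_le1 _ mVC) (ltry _).
- by rewrite setCT measure0.
have [mrho rho0 mS S0 a1E] := dS.
have mSC : measurable (~` S : set (borel X)) by exact: measurableC.
(* Off [S] the law of [g s1] on [V (g s2)] is [rho] times that on [~ V (g s2)], so weighting the
   former by [w] and the latter by [w * rho] makes them equal. *)
pose w x := ((1 + rho x) `^ (-1))%R.
have wE x : w x = ((1 + rho x)^-1)%R by rewrite /w powR_inv1// addr_ge0.
have w0 x : (0 < w x)%R by rewrite wE invr_gt0 ltr_pwDl.
have wr x : (0 <= w x * rho x)%R by rewrite mulr_ge0// ltW.
have w1 x : (w x <= 1)%R by rewrite wE invf_le1 ?lerDl// ltr_pwDl.
have wr1 x : (w x * rho x <= 1)%R.
  by rewrite wE mulrC ler_pdivrMr ?mul1r ?lerDr// ltr_pwDl.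
have mw : measurable_fun [set: borel X] w.
  by apply: (measurableT_comp (measurable_powR (-1)%R)); exact: measurable_funD.
have mwr : measurable_fun [set: borel X] (fun x => w x * rho x)%R by exact: measurable_funM.
have mnull W (mW : measurable (W : set (borel X))) : measurable_fun [set: borel X] (\1_W : X -> R).
  exact: measurable_indic.
pose b := \int[a2]_x (w x * rho x)%:E.
have b0 : 0 <= b by apply: integral_ge0 => x _; rewrite lee_fin.
have b1 : b <= 1.
  apply: le_trans (a_le1 _ mVC).
  rewrite -[leRHS]mul1e -integral_cst//; apply: ge0_le_integral => //.
  - by move=> x _; rewrite lee_fin.
  - exact/measurable_EFinP.
  - by move=> x _; rewrite lee_fin.
have [B0|Bp] := eqVneq b 0.
  have a1SC : a1 (~` S) = 0.
    have := a1E _ mSC; rewrite setICl measure0 adde0 => a1S.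
    apply: etrans a1S _; apply/eqP; rewrite eq_le integral_ge0 ?andbT; last first.
      by move=> x _; rewrite lee_fin.
    have <- : \int[a2]_x (rho x)%:E = 0.
      apply: null_integral0 => //; rewrite -[RHS](ge0_integral0_null mwr wr B0).
      congr (a2 _); apply/seteqP; split => x /=; first by move=> r0; rewrite mulr_gt0.
      by rewrite pmulr_rgt0.
    by apply: ge0_subset_integralT => //; exact/measurable_EFinP.
  exists ([set g | V (g s2)] `&` [set g | ~ S (g s1)] `|` [set g | ~ V (g s2)] `&` [set g | S (g s1)]).
  split.
  - by apply: measurableU; apply: measurableI; (exact: measurable_slice || exact: (measurable_slice _ mSC) || exact: (measurable_slice _ mVC)).
  - have m1 : measurable ([set g | V (g s2)] `&` [set g | ~ S (g s1)] : set (borel (geo X))).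
      by apply: measurableI; [exact: measurable_slice|exact: (measurable_slice _ mSC)].
    have m2 : measurable ([set g | ~ V (g s2)] `&` [set g | S (g s1)] : set (borel (geo X))).
      by apply: measurableI; [exact: (measurable_slice _ mVC)|exact: measurable_slice].
    have h1 : eta ([set g | V (g s2)] `&` [set g | ~ S (g s1)]) <= 0.
      by rewrite setIC; apply: (eq_ind_r (fun u => u <= 0) _ a1SC).
    have h2 : eta ([set g | ~ V (g s2)] `&` [set g | S (g s1)]) <= 0.
      by rewrite setIC; apply: (eq_ind_r (fun u => u <= 0) _ S0).
    apply/eqP; rewrite eq_le measure_ge0 andbT.
    by apply: le_trans (measureU2 eta m1 m2) _; rewrite -[leRHS](adde0 0); exact: leeD h1 h2.
  - move=> g1 g2 Z1 Z2 g12 V1; apply: contrapT => V2; apply: Z2; right; split => //=.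
    by rewrite -g12; apply: contrapT => nS; apply: Z1; left.
exfalso; pose c := (fine b)^-1%R.
have bE : b = (fine b)%:E by rewrite fineK// ge0_fin_numE// (le_lt_trans b1)// ltry.
have c0 : (0 <= c)%R by rewrite invr_ge0 fine_ge0.
have bn0 : fine b != 0%R by apply: contra Bp => /eqP h; rewrite bE h.
pose f1 x := (\1_(~` S) x * w x * c)%R; pose f2 x := (w x * rho x * c)%R.
have f10 x : (0 <= f1 x)%R by rewrite !mulr_ge0// ltW.
have f20 x : (0 <= f2 x)%R by rewrite mulr_ge0.
have mf1 : measurable_fun [set: borel X] f1.
  by apply: measurable_funM => //; apply: measurable_funM => //; exact: mnull.
have mf2 : measurable_fun [set: borel X] f2 by exact: measurable_funM.
pose F1 (g : geo X) := (f1 (g s1) * \1_V (g s2))%R.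
pose F2 (g : geo X) := (f2 (g s1) * \1_(~` V) (g s2))%R.
have F10 g : (0 <= F1 g)%R by rewrite mulr_ge0.
have F20 g : (0 <= F2 g)%R by rewrite mulr_ge0.
have mF1 : measurable_fun [set: borel (geo X)] F1.
  apply: measurable_funM; first exact: (measurableT_comp mf1 (ev_measurable s1)).
  exact: (measurableT_comp (mnull _ mV) (ev_measurable s2)).
have mF2 : measurable_fun [set: borel (geo X)] F2.
  apply: measurable_funM; first exact: (measurableT_comp mf2 (ev_measurable s1)).
  exact: (measurableT_comp (mnull _ mVC) (ev_measurable s2)).
have I12 (psi : X -> R) : measurable_fun [set: borel X] psi -> (forall x, 0 <= psi x)%R ->
    \int[a1]_x (psi x * f1 x)%:E = \int[a2]_x (psi x * f2 x)%:E.
  move=> mpsi psi0.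
  transitivity (\int[a1]_x (\1_(~` S) x * (psi x * (w x * c)))%:E).
    by apply: eq_integral => x _; congr EFin; rewrite /f1; ring.
  rewrite (integral_decomposition dS).
  - by apply: eq_integral => x _; congr EFin; rewrite /f2; ring.
  - by apply: measurable_funM => //; exact: measurable_funM.
  - by move=> x; rewrite !mulr_ge0// ltW.
have J1 (psi : X -> R) : measurable_fun [set: borel X] psi -> (forall x, 0 <= psi x)%R ->
    \int[eta]_g (psi (g s1) * F1 g)%:E = \int[a2]_x (psi x * f2 x)%:E.
  move=> mpsi psi0; rewrite -I12// -joint_integral//; last first.
  - by move=> x; rewrite mulr_ge0.
  - exact: measurable_funM.
  by apply: eq_integral => g _; rewrite /F1 mulrA.
have J2 (psi : X -> R) : measurable_fun [set: borel X] psi -> (forall x, 0 <= psi x)%R ->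
    \int[eta]_g (psi (g s1) * F2 g)%:E = \int[a2]_x (psi x * f2 x)%:E.
  move=> mpsi psi0; rewrite -joint_integral//; last first.
  - by move=> x; rewrite mulr_ge0.
  - exact: measurable_funM.
  by apply: eq_integral => g _; rewrite /F2 mulrA.
have JA (A : set X) (F : geo X -> R) :
    \int[eta]_(g in [set g | A (g s1)]) (F g)%:E = \int[eta]_g (\1_A (g s1) * F g)%:E.
  rewrite [LHS]integral_mkcond; apply: eq_integral => g _.
  by rewrite epatch_indic EFinM muleC.
have total : \int[a2]_x (1 * f2 x)%:E = 1.
  under eq_integral do rewrite mul1r /f2 EFinM.
  rewrite ge0_integralZr//; first last.
  - by move=> x _; rewrite lee_fin.
  - exact/measurable_EFinP.
  by rewrite -/b bE -EFinM mulfV.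
apply: (CD_no_split mF1 mF2 F10 F20 close mV).
- exists c => g; rewrite /F1 /f1 !indicE -mulrA (mulrC c) mulrA -[leRHS]mul1r ler_wpM2r//.
  by case: (_ \in _); case: (_ \in _); rewrite ?mul0r ?mul1r ?mulr1 ?mulr0.
- exists c => g; rewrite /F2 /f2 !indicE -mulrA (mulrC c) mulrA -[leRHS]mul1r ler_wpM2r//.
  by case: (_ \in _); rewrite ?mulr1 ?mulr0.
- rewrite -total -J1//; apply: eq_integral => g _; by rewrite mul1r.
- rewrite -total -J2//; apply: eq_integral => g _; by rewrite mul1r.
- by move=> g nV; rewrite /F1 indicE memNset// mulr0.
- by move=> g Vg; rewrite /F2 indicE memNset ?mulr0//; exact.
- by move=> A mA; rewrite !JA J1 ?J2//; exact: mnull.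
Qed.

(** [CD_separation] is applied to countably many pairs of rational times and open sets. Off the
    resulting null set, agreement passes from one time of a fine grid to the next, starting inside
    [[0, t]]; continuity gives all other times, in particular 1, which [close_times] does not
    reach. *)
Theorem CD_plan_non_branching (D : set X) : countable D -> dense D ->
  exists G : set (geo X), [/\ measurable (G : set (borel (geo X))),
    eta (~` G) = 0 & non_branching_set G].
Proof.
move=> cD dD; have [V [oV sepV]] := countable_open_separation cD dD.
pose idx := (nat * nat * (nat * nat) * nat)%type.
pose t1 (p : idx) := frac R p.1.1.1 p.1.1.2.
pose t2 (p : idx) := frac R p.1.2.1 p.1.2.2.
have ex (p : idx) : exists Z : set (geo X), [/\ measurable (Z : set (borel (geo X))), eta Z = 0 &
    close_times K N Th (t1 p) (t2 p) ->
    forall g1 g2, ~ Z g1 -> ~ Z g2 -> g1 (t1 p) = g2 (t1 p) ->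
      V p.2 (g1 (t2 p)) -> V p.2 (g2 (t2 p))].
  have [close|nclose] := pselect (close_times K N Th (t1 p) (t2 p)).
    have [Z [mZ Z0 ZP]] := CD_separation close (borel_open (oV p.2)).
    by exists Z.
  by exists set0; split.
have [Z ZP] := choice ex.
pose Zn n := if unpickle n is Some p then Z p else set0.
have mZn n : measurable (Zn n : set (borel (geo X))).
  by rewrite /Zn; case: (unpickle n) => [p|]; [case: (ZP p)|exact: measurable0].
have ZnE p : Zn (pickle p) = Z p by rewrite /Zn pickleK.
have mU : measurable (\bigcup_n Zn n : set (borel (geo X))).
  exact: bigcupT_measurable.
exists (~` (\bigcup_n Zn n)); split.
- exact: measurableC.
- rewrite setCK; apply/eqP; rewrite eq_le measure_ge0 andbT.
  apply: (@le_trans _ _ (\sum_(n <oo) eta (Zn n))).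
    exact: measure_sigma_subadditive.
  rewrite eseries0// => n _ _; rewrite /Zn.
  by case: (unpickle n) => [p|]; [case: (ZP p)|exact: measure0].
move=> g1 g2 G1 G2 t /andP[t0 tlt1] agree.
have nZ g : (~` (\bigcup_n Zn n)) g -> forall p, ~ Z p g.
  by move=> Gg p Zp; apply: Gg; exists (pickle p); rewrite ?ZnE.
have step (p : idx) : close_times K N Th (t1 p) (t2 p) -> g1 (t1 p) = g2 (t1 p) ->
    g1 (t2 p) = g2 (t2 p).
  move=> close eq1; apply/eqP/negPn/negP => neq.
  have [k [Vk nVk]] := sepV _ _ neq; apply: nVk.
  case: (ZP (p.1, k)) => _ _ /(_ close) H; exact: (H g1 g2 (nZ g1 G1 _) (nZ g2 G2 _) eq1 Vk).
have [d d0 dP] := close_times_uniform K Th N1.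
have lt1 (s : {i01 R}) : (s%:num < 1)%R -> g1 s = g2 s.
  move=> s1; apply: geo_eq_approx => e e0.
  (* The grid step must be smaller than [e], than the two relative bounds of [close_times_uniform]
     for times between [t] and [s], and than [t], so that the first time of the chain is
     positive. *)
  pose eps := Num.min e (Num.min (d * (1 - s%:num)) (Num.min (d * t%:num) t%:num))%R.
  have eps0 : (0 < eps)%R by rewrite !lt_min e0 t0 !mulr_gt0// subr_gt0.
  have [M MP] := invS_lt eps0.
  have M0 : (0 < M.+1%:R :> R)%R by [].
  move: MP; rewrite !lt_min => /and4P[Me Ms Mdt Mt].
  have grid j : (j <= M.+1)%N -> (j%:R / M.+1%:R <= s%:num)%R ->
      g1 (frac R j (M.+1 - j)) = g2 (frac R j (M.+1 - j)).
    have fracE i : (i <= M.+1)%N -> ((frac R i (M.+1 - i))%:num = i%:R / M.+1%:R)%R.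
      by move=> iM; rewrite /= subnKC.
    elim: j => [_ _|j IH jM js].
      by apply: agree; rewrite fracE// mul0r ltW.
    have [jt|tj] := leP (j.+1%:R / M.+1%:R)%R t%:num.
      by apply: agree; rewrite fracE.
    have jE : (j.+1%:R / M.+1%:R = j%:R / M.+1%:R + (M.+1%:R)^-1 :> R)%R.
      by rewrite -addn1 natrD mulrDl mul1r.
    have M0' : (0 < M.+1%:R^-1 :> R)%R by rewrite invr_gt0.
    apply: (step (j, (M.+1 - j)%N, (j.+1, (M.+1 - j.+1)%N), 0%N)).
      apply: dP; rewrite !fracE ?(ltnW jM)// ?jE; rewrite jE in js tj.
      + by move: tj Mt; set u := (j%:R / _)%R; set v := (_^-1)%R; lra.
      + by rewrite ltrDl.
      + by apply: le_lt_trans s1.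
      + rewrite addrAC subrr add0r; apply: lt_le_trans Ms _.
        by rewrite ler_wpM2l ?(ltW d0)// lerD2l lerN2 (le_trans _ js)// lerDl ltW.
      + rewrite addrAC subrr add0r; apply: lt_le_trans Mdt _.
        by rewrite ler_wpM2l ?(ltW d0)// ltW.
    apply: IH; first exact: ltnW.
    by apply: le_trans js; rewrite ler_wpM2r ?(ltW M0')// ler_nat.
  pose j := Num.truncn (s%:num * M.+1%:R).
  have sM0 : (0 <= s%:num * M.+1%:R)%R by rewrite mulr_ge0.
  have /andP[j1 j2] := truncn_itv sM0.
  have js : (j%:R / M.+1%:R <= s%:num)%R by rewrite ler_pdivrMr.
  have jM : (j <= M.+1)%N.
    rewrite -(ler_nat R); apply: le_trans j1 _.
    by rewrite -[leRHS]mul1r ler_wpM2r// ltW.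
  exists (frac R j (M.+1 - j)); split; last exact: grid.
  rewrite /= subnKC// ger0_norm ?subr_ge0//; apply: le_lt_trans Me.
  by rewrite -[leRHS]mul1r lerBlDl -mulrDl ler_pdivlMr// (ltW)// natr1.
apply: geo_eq => s; have [|s1] := ltP s%:num 1%R; first exact: lt1.
apply: geo_eq_approx => e e0.
have [n nP] := invS_lt e0.
have sE : s%:num = 1%R by apply/eqP; rewrite eq_le s1 andbT.
have uE : ((frac R n 1)%:num = 1 - (n.+1%:R)^-1)%R.
  by rewrite /= addn1 -[n.+1]addn1 natrD; field; rewrite natr1 pnatr_eq0.
exists (frac R n 1); split.
  by rewrite uE sE opprB addrC subrK ger0_norm// invr_ge0.
by apply: lt1; rewrite uE ltrBlDl ltrDr invr_gt0.
Qed.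

End nonbranching_plan.

(** * Contractions towards a point *)

Lemma continuous_measurable_real {R : realType} {X : ptopologicalType} (f : X -> R) :
  continuous f -> measurable_fun [set: borel X] f.
Proof.
move=> /continuousP cf; apply: (measurability _ (RGenOpens.measurableE R)).
by move=> _ [_ [a [b ->]] <-]; rewrite setTI; apply: borel_open; apply: cf; exact: interval_open.
Qed.

Section uniform.
Local Open Scope ereal_scope.
Context {R : realType} {X : pmetricType R}.
Implicit Types (m : {measure set (borel X) -> \bar R}).

Lemma bounded_second_moment (mu : probability (borel X) R) (p : X) (r : R) :
  mu [set x | r < mdist p x]%R = 0 -> finite_second_moment mu.
Proof.
move=> mu0; exists p.
have mD : measurable_fun [set: borel X] (fun x : borel X => mdist p x : R).
  exact: continuous_measurable_real (@mdist_continuous R X p).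
have mS : measurable ([set x | r < mdist p x]%R : set (borel X)).
  by rewrite -[mkset _]setTI; exact: measurable_fun_ltr.
rewrite (ge0_negligible_integral mS)//; last 2 first.
- by apply/measurable_EFinP; exact: measurable_funX.
- by move=> x _; rewrite lee_fin sqr_ge0.
apply: (@le_lt_trans _ _ (\int[mu]_(x in setT `\` [set x | r < mdist p x]%R) (r ^+ 2)%:E)).
  apply: ge0_le_integral_nonmeas => x [_ /= /negP]; first by rewrite lee_fin sqr_ge0.
  rewrite -leNgt => xr; rewrite lee_fin lerXn2r ?nnegrE ?mdist_ge0//.
  exact: le_trans (mdist_ge0 _ _) xr.
rewrite integral_cst ?setTD; last exact: measurableC.
rewrite lte_mul_pinfty ?lee_fin ?sqr_ge0//.
by apply: le_lt_trans (ltry 1); apply: probability_le1; exact: measurableC.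
Qed.

Lemma mnormalize_restrE m (A : set X) (mA : measurable (A : set (borel X)))
    (P : probability (borel X) R) (C : set X) : 0 < m A -> m A < +oo ->
  (mnormalize (mrestr m mA) P : probability (borel X) R) C = m (C `&` A) * ((fine (m A))^-1)%:E.
Proof.
move=> A0 Aoo; rewrite /= /mnormalize /= /mrestr setTI.
by rewrite gt_eqF//= lt_eqF.
Qed.

Lemma mnormalize_P2ac m (A : set X) (mA : measurable (A : set (borel X)))
    (P : probability (borel X) R) (p : X) (r : R) : 0 < m A -> m A < +oo ->
  A `<=` [set x | mdist p x <= r]%R -> P2ac m (mnormalize (mrestr m mA) P).
Proof.
move=> A0 Aoo Ar; split.
  apply: (@bounded_second_moment _ p r); rewrite mnormalize_restrE//.
  rewrite (_ : _ `&` _ = set0) ?measure0 ?mul0e//.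
  by apply/seteqP; split => // x [/= h /Ar /=]; rewrite leNgt h.
move=> C mC0 D mD DC; rewrite mnormalize_restrE//.
have D0 : m D = 0 by exact: mC0.
rewrite (_ : m _ = 0) ?mul0e//; apply: (subset_measure0 _ mD _ D0) => //.
exact: measurableI.
Qed.

End uniform.

Section optimal.
Local Open Scope ereal_scope.
Context {R : realType} {X : pmetricType R}.
Implicit Types (mu : probability (borel X) R) (eta : probability (borel (geo X)) R).

Lemma OptGeo_start mu0 mu1 eta (A : set X) : OptGeo mu0 mu1 eta ->
  measurable (A : set (borel X)) -> eta [set g | A (geo_start g)] = mu0 A.
Proof. by move=> [co _] /co[]. Qed.

Lemma OptGeo_end mu0 mu1 eta (A : set X) : OptGeo mu0 mu1 eta ->
  measurable (A : set (borel X)) -> eta [set g | A (geo_end g)] = mu1 A.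
Proof. by move=> [co _] /co[]. Qed.

Lemma OptGeo_null mu0 mu1 eta (A C : set X) (Z : set (geo X)) : OptGeo mu0 mu1 eta ->
  measurable (A : set (borel X)) -> measurable (C : set (borel X)) ->
  mu0 (~` A) = 0 -> mu1 (~` C) = 0 -> measurable (Z : set (borel (geo X))) ->
  (forall g, A (geo_start g) -> C (geo_end g) -> ~ Z g) -> eta Z = 0.
Proof.
move=> og mA mC A0 C0 mZ HZ.
have mA' := measurable_slice zero01 (measurableC mA).
have mC' := measurable_slice one01 (measurableC mC).
have ZA : eta [set g : geo X | (~` A) (g zero01)] = 0.
  by rewrite -A0; apply: (OptGeo_start og); exact: measurableC.
have ZC : eta [set g : geo X | (~` C) (g one01)] = 0.
  by rewrite -C0; apply: (OptGeo_end og); exact: measurableC.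
apply/eqP; rewrite eq_le measure_ge0 andbT -[leRHS](adde0 0) -{1}ZA -ZC.
apply: le_trans (measureU2 eta mA' mC').
apply: le_measure; rewrite ?inE//; first exact: measurableU.
move=> g Zg; apply: contrapT => /not_orP[/contrapT Ag /contrapT Cg].
exact: HZ Ag Cg Zg.
Qed.

End optimal.

Section local.
Local Open Scope ereal_scope.
Context {R : realType} {X : pmetricType R}.
Variables (m : {measure set (borel X) -> \bar R}) (p : X) (r : R).

(** Geodesics between points of the closed ball of radius [r] stay in that of radius [4 * r], so
    compactness and finite measure of the larger ball serve every transport inside the smaller
    one. *)
Definition good_radius := [/\ (0 < r)%R, compact [set y | mdist p y <= 4 * r]%R &
  m [set y | mdist p y <= 4 * r]%R < +oo].

Hypothesis good : good_radius.
Implicit Types (A C : set X) (g : geo X) (t : {i01 R}).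

Let cball := [set y | mdist p y <= r]%R.

Lemma geo_near g t : cball (geo_start g) -> cball (geo_end g) -> (mdist p (g t) <= 4 * r)%R.
Proof.
rewrite /cball /= => g0 g1; case: good => r0 _ _.
have := metric_triangle p (geo_start g) (g t).
have : (mdist (geo_start g) (g t) <= geo_length g)%R.
  rewrite /geo_start geo_speed ler_piMl ?mdist_ge0// /= sub0r normrN ger0_norm//.
have : (geo_length g <= 2 * r)%R.
  rewrite /geo_length; have := metric_triangle (geo_start g) p (geo_end g).
  by rewrite (metric_sym _ p); lra.
by lra.
Qed.

Lemma geo_near_length g : cball (geo_start g) -> cball (geo_end g) -> (geo_length g <= 2 * r)%R.
Proof.
rewrite /cball /geo_length /= => g0 g1; have := metric_triangle (geo_start g) p (geo_end g).
by rewrite (metric_sym _ p); lra.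
Qed.

Definition geos A C := [set g : geo X | A (geo_start g) /\ C (geo_end g)].

Lemma compact_geos A C : closed A -> closed C -> A `<=` cball -> C `<=` cball ->
  compact (geos A C).
Proof.
move=> cA cC Ar Cr; have [_ cK _] := good.
have -> : geos A C = [set g : geo X | forall t, mdist p (g t) <= 4 * r]%R `&`
    (geo_eval zero01 @^-1` A `&` geo_eval one01 @^-1` C).
  apply/seteqP; split => [g [Ag Cg]|g [_ [Ag Cg]]]; last by split.
  by split; [move=> t; apply: geo_near; [exact: Ar|exact: Cr]|split].
apply: compact_closedI; first exact: (geo_compact cK).
by apply: closedI; apply: preimage_closed => // g _; exact: geo_eval_continuous.
Qed.

Lemma compact_intermediate A C t : closed A -> closed C -> A `<=` cball -> C `<=` cball ->
  compact (geo_eval t @` geos A C).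
Proof.
move=> cA cC Ar Cr; apply: continuous_compact; last exact: compact_geos.
by apply: continuous_subspaceT => g; exact: geo_eval_continuous.
Qed.

End local.

Lemma good_radius_exists {R : realType} {X : pmetricType R}
    (m : {measure set (borel X) -> \bar R}) (p : X) (d : R) : metric_measure_space m ->
  0 < d -> exists2 r, good_radius m p r & r < d.
Proof.
move=> [[_ lcX _ _] fin _] d0; have [s s0 cs] := local_compact_ball lcX p.
have [e e0 me] := fin p.
pose r := Num.min (s / 4) (Num.min (e / 8) (d / 2)).
have r0 : 0 < r by rewrite !lt_min !divr_gt0.
have [rs re rd] : [/\ r <= s / 4, r <= e / 8 & r <= d / 2].
  by split; rewrite /r !ge_min lexx ?orbT.
exists r; last by lra.
split => //.
- apply: (subclosed_compact _ cs); first exact: closed_mdist_le.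
  by move=> y /=; lra.
- apply: le_lt_trans me; apply: le_measure; rewrite ?inE.
  + by apply: borel_closed; exact: closed_mdist_le.
  + by rewrite ballEmdist; apply: borel_open; exact: open_mdist_lt.
  + by move=> y /= py; rewrite ballEmdist /=; lra.
Qed.

Lemma closed_point {R : realType} {X : metricType R} (x : X) : closed [set x].
Proof. exact: (accessible_closed_set1 (hausdorff_accessible (@metric_hausdorff R X))). Qed.

Lemma intermediate_geos {R : realType} {X : pmetricType R} (t : {i01 R}) (A : set X) (o : X) :
  intermediate_points t A o = geo_eval t @` geos A [set o].
Proof.
apply/seteqP; split => [y [g [g0 g1 gt]]|y [g [g0 g1] gt]]; by exists g.
Qed.

Lemma compact_intermediate_points {R : realType} {X : pmetricType R}
    (m : {measure set (borel X) -> \bar R}) (p : X) (r : R) (A : set X) (o : X) (t : {i01 R}) :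
  good_radius m p r -> closed A -> A `<=` [set y | mdist p y <= r] -> mdist p o <= r ->
  compact (intermediate_points t A o).
Proof.
move=> good cA Ar or; rewrite intermediate_geos.
by apply: (compact_intermediate good cA (@closed_point R X o) Ar) => _ ->.
Qed.

(** For closed [A] the intermediate points form a compact set, on which the outer measure of the
    definition is [m] itself. *)
Lemma qnd_null {R : realType} {X : pmetricType R}
    (m : {measure set (borel X) -> \bar R}) (p : X) (r : R) (A : set X) (o : X) (t : {i01 R}) :
  qualitatively_non_degenerate m -> good_radius m p r ->
  closed A -> A `<=` [set y | mdist p y <= r] -> mdist p o <= r -> 0 < t%:num < 1 ->
  m (intermediate_points t A o) = 0%E -> m A = 0%E.
Proof.
move=> qnd good cA Ar or t01 m0.
have r0 : 0 < r by case: good.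
have [f [f0 _ fP]] := qnd p (2 * r) (mulr_gt0 (ltr0n _ 2) r0).
have sub : A `<=` ball p (2 * r).
  by move=> y /Ar /=; rewrite ballEmdist /=; lra.
have ob : ball p (2 * r) o by rewrite ballEmdist /=; lra.
have mI : measurable (intermediate_points t A o : set (borel X)).
  apply: borel_closed; apply: compact_closed; first exact: metric_hausdorff.
  exact: compact_intermediate_points good cA Ar or.
have := fP A (borel_closed cA) sub o ob t t01.
rewrite measurable_mu_extE// m0 pmule_rle0 ?lte_fin ?f0// => mA.
by apply/eqP; rewrite eq_le mA measure_ge0.
Qed.

(** Almost every geodesic has a distortion coefficient above a positive constant, so the
    intermediate points receive positive mass, while the MCP bound would leave them none. By [rK]
    the set [A] is within the radius required when [K] is positive. *)
Lemma mcp_null {R : realType} {X : pmetricType R}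
    (m : {measure set (borel X) -> \bar R}) (K N : R) (p : X) (r : R)
    (A : set X) (o : X) (t : {i01 R}) :
  1 < N -> MCP m K N -> (0 < K -> 2 * r < pi * Num.sqrt ((N - 1) / K)) -> good_radius m p r ->
  closed A -> A `<=` [set y | mdist p y <= r] -> mdist p o <= r -> 0 < t%:num < 1 ->
  m (intermediate_points t A o) = 0%E -> m A = 0%E.
Proof.
move=> N1 mcp rK good cA Ar or /andP[t0 t1] m0.
have [r0 _ moo] := good.
have N0 : 0 < N by exact: lt_trans ltr01 N1.
have mA : measurable (A : set (borel X)) by exact: borel_closed.
apply/eqP/negPn/negP; rewrite -measure_gt0 => A0.
have Aoo : (m A < +oo)%E.
  apply: le_lt_trans moo; apply: le_measure; rewrite ?inE//.
    by apply: borel_closed; exact: closed_mdist_le.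
  by move=> y /Ar /=; lra.
have Ad y : A y -> mdist o y <= 2 * r.
  by move=> /Ar /= yr; have := metric_triangle o p y; rewrite (metric_sym o p); lra.
have Ao : 0 < K -> A `<=` ball o (pi * Num.sqrt ((N - 1) / K)).
  by move=> K0 y /Ad yo; rewrite ballEmdist /=; exact: le_lt_trans (rK K0).
have [sm _] := @mnormalize_P2ac R X m A mA (dirac (o : borel X)) p r A0 Aoo Ar.
have [eta og push_le] := mcp o A mA A0 Aoo Ao sm.
have mI : measurable (intermediate_points t A o : set (borel X)).
  apply: borel_closed; apply: compact_closed; first exact: metric_hausdorff.
  exact: compact_intermediate_points good cA Ar or.
have := push_le t _ mI; rewrite m0 mule0; apply/negP; rewrite -ltNge.
pose Z := [set g : geo X | ~ intermediate_points t A o (g t)] `|`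
  [set g : geo X | 2 * r < geo_length g].
have mZ : measurable (Z : set (borel (geo X))).
  apply: measurableU; last exact: measurable_long.
  exact: (measurable_slice t (measurableC mI)).
have Z0 : eta Z = 0%E.
  apply: (OptGeo_null og mA (borel_closed (@closed_point R X o))) => //.
  - by rewrite mnormalize_restrE// setICl measure0 mul0e.
  - by rewrite /= /dirac /= indicE memNset//; apply.
  - move=> g Ag og'; apply/not_orP; split; first by apply; exists g.
    apply/negP; rewrite -leNgt /geo_length og' metric_sym; exact: Ad.
have Z1 : eta (~` Z) = 1%E by rewrite probability_setC// Z0 sube0.
pose c := contr_coeff K N (2 * r) (1 - t%:num).
have c0 : 0 < c by apply: contr_coeff_gt0; rewrite subr_gt0.
apply: (@lt_le_trans _ _ ((c `^ N)%:E)); first by rewrite lte_fin powR_gt0.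
have -> : ((c `^ N)%:E = \int[eta]_(g in ~` Z) (c `^ N)%:E)%E.
  rewrite integral_cst; last exact: measurableC.
  by rewrite -[X in (_ * X)%E]/(eta (~` Z)) Z1 mule1.
rewrite /pushforward /reweight integral_mkcond [leRHS]integral_mkcond.
apply: ge0_le_integral_nonmeas => g _; rewrite !patchE.
  by case: ifP => //; rewrite lee_fin powR_ge0.
case: ifPn => [|_]; last by case: ifPn => // _; exact: poweR_ge0.
rewrite inE => /not_orP[/contrapT Ig /negP]; rewrite -leNgt => gl.
rewrite mem_set// -poweR_EFin; apply: gt0_ler_poweR.
- exact: ltW.
- by rewrite in_itv /= lee_fin ltW// leey.
- rewrite in_itv /= leey andbT; apply: (tau_coeff_ge0 K N1); last exact: mdist_ge0.
  by rewrite subr_ge0 ltW//= lerBlDr lerDl ltW.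
- apply: tau_coeff_ge => //; last by rewrite mdist_ge0.
  by rewrite subr_ge0 ltW//= lerBlDr lerDl ltW.
Qed.

(* A limit of geodesics ending in smaller and smaller balls around [o] ends at [o]. *)
Lemma intermediate_bigcap {R : realType} {X : pmetricType R}
    (m : {measure set (borel X) -> \bar R}) (p : X) (r : R) (A : set X) (o : X)
    (t : {i01 R}) (C : (set X)^nat) : good_radius m p r -> closed A ->
  A `<=` [set y | mdist p y <= r] -> (forall n, closed (C n)) ->
  (forall n, C n `<=` [set y | mdist p y <= r]) -> nonincreasing_seq C ->
  \bigcap_n C n = [set o] ->
  \bigcap_n (geo_eval t @` geos A (C n)) = intermediate_points t A o.
Proof.
move=> good cA Ar cC Cr decC Co; apply/seteqP; split => y; last first.
  move=> [g [g0 g1 gt]] n _; exists g => //; split => //.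
  by have : [set o] (geo_end g) by []; rewrite -Co; apply.
move=> Sy; have ex n : exists g : geo X, geos A (C n) g /\ geo_eval t g = y.
  by have [g ? ?] := Sy n I; exists g.
have [g gP] := choice ex.
have [U UU oU] := oo_ultra.
have PU : ProperFilter U by exact: ultra_proper.
have [|l [l0 _] gl] := @ultra_cvg R (geo X) _ U UU g _ (compact_geos good cA (cC 0%N) Ar (@Cr 0%N)).
  apply: filterS (@filterT _ U _) => n _ /=; have [[g0 g1] _] := gP n; split => //.
  by have /subsetPset := decC _ _ (leq0n n); apply.
exists l; split => //.
- suff : [set o] (geo_end l) by [].
  rewrite -Co => n _; have cE : closed (geo_eval one01 @^-1` C n).
    by apply: preimage_closed => // h _; exact: geo_eval_continuous.
  apply: (closed_cvg (geo_eval one01 @^-1` C n) cE _ _ gl).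
  apply: oU; exists n => // k /= nk; have [[_ g1] _] := gP k.
  by have /subsetPset := decC _ _ nk; apply.
- have cE : closed (geo_eval t @^-1` [set y]).
    by apply: preimage_closed => [h _|]; [exact: geo_eval_continuous|exact: closed_point].
  apply: (closed_cvg (geo_eval t @^-1` [set y]) cE _ _ gl).
  by apply: filterS (@filterT _ U _) => n _ /=; case: (gP n).
Qed.

(** A Dirac target is not absolutely continuous, so it is replaced by uniform measures on balls
    [C n] shrinking to [o]. The entropy at time [t] has a lower bound independent of [n], while the
    sets [S n] carrying the law decrease to the intermediate points; if these were null,
    [entropy_le] would make the entropy too small. *)
Lemma cd_null {R : realType} {X : pmetricType R}
    (m : {measure set (borel X) -> \bar R}) (K N : R) (p : X) (r : R)
    (A : set X) (o : X) (t : {i01 R}) :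
  1 < N -> very_strict_CD m K N -> measure_support m = [set: X] -> good_radius m p r ->
  closed A -> A `<=` [set y | mdist p y <= r] -> mdist p o < r -> 0 < t%:num < 1 ->
  m (intermediate_points t A o) = 0%E -> m A = 0%E.
Proof.
move=> N1 cd spt good cA Ar or /andP[t0 t1] m0.
have [r0 cK moo] := good.
have mA : measurable (A : set (borel X)) by exact: borel_closed.
pose B := [set y | mdist p y <= 4 * r].
have mB : measurable (B : set (borel X)) by apply: borel_closed; exact: closed_mdist_le.
apply/eqP/negPn/negP; rewrite -measure_gt0 => A0.
have finr (C : set X) : measurable (C : set (borel X)) ->
    C `<=` [set y | mdist p y <= r] -> (m C < +oo)%E.
  move=> mC Cr; apply: le_lt_trans moo; apply: le_measure; rewrite ?inE//.
  by move=> y /Cr /=; lra.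
have Aoo := finr A mA Ar.
pose d := r - mdist p o; have d0 : 0 < d by rewrite subr_gt0.
pose C n := [set y | mdist o y <= d / n.+1%:R].
have cC n : closed (C n) by exact: closed_mdist_le.
have mC n : measurable (C n : set (borel X)) by exact: borel_closed.
have Cr n : C n `<=` [set y | mdist p y <= r].
  move=> y /= yo; have := metric_triangle p o y.
  have : mdist o y <= d.
    by apply: le_trans yo _; rewrite ler_pdivrMr// ler_peMr ?(ltW d0)// ler1n.
  by rewrite /d; lra.
have C0 n : (0 < m (C n))%E.
  have : measure_support m o by rewrite spt.
  have oU : open [set y | mdist o y < d / n.+1%:R] by exact: open_mdist_lt.
  move=> /(_ [set y | mdist o y < d / n.+1%:R]) h; apply: lt_le_trans (h _) _.
    by split => //=; rewrite mdistxx divr_gt0.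
  by apply: le_measure; rewrite ?inE//; [exact: borel_open|move=> y /= /ltW].
have Coo n := finr _ (mC n) (@Cr n).
pose mu0 : probability (borel X) R := mnormalize (mrestr m mA) (dirac (p : borel X)).
pose mu1 n : probability (borel X) R := mnormalize (mrestr m (mC n)) (dirac (p : borel X)).
have mu0ac : P2ac m mu0 by exact: (@mnormalize_P2ac R X m A mA _ p r A0 Aoo Ar).
have mu1ac n : P2ac m (mu1 n) by exact: (@mnormalize_P2ac R X m (C n) (mC n) _ p r (C0 n) (Coo n) (@Cr n)).
have mu0A : mu0 (~` A) = 0%E by rewrite mnormalize_restrE// setICl measure0 mul0e.
have mu1C n : mu1 n (~` C n) = 0%E by rewrite mnormalize_restrE// setICl measure0 mul0e.
have mu0oo : (mu0 setT < +oo)%E by rewrite probability_setT ltry.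
have mu0B : mu0 (~` B) = 0%E.
  apply/eqP; rewrite eq_le measure_ge0 andbT -mu0A; apply: le_measure; rewrite ?inE.
  - exact: measurableC.
  - exact: measurableC.
  - by apply: subsetC => y /Ar /=; rewrite /B /=; lra.
have [rho0 [S0 [dec0 _]]] := finite_lebesgue_decomposition mu0oo mB moo mu0B.
have ent0 : (0 < entropy m N rho0)%E.
  apply: (entropy_gt0 N1 dec0); last first.
    exact: (eq_ind_r (fun u => (0 < u)%E) lte01 (probability_setT mu0)).
  move=> Z mZ Z0; have [_ ac] := mu0ac.
  exact: (ac Z ((measure0_null_setP m mZ).2 Z0) Z mZ (@subset_refl _ Z)).
pose c := contr_coeff K N (2 * r) (1 - t%:num).
have c0 : 0 < c by apply: contr_coeff_gt0; rewrite subr_gt0.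
have [h h0 hle] : exists2 h : R, 0 < h & (h%:E <= c%:E * entropy m N rho0)%E.
  have : (0 < c%:E * entropy m N rho0)%E by rewrite mule_gt0.
  case: (c%:E * _)%E => [s||] // s0; first by exists s.
  by exists 1; rewrite ?leey // ltr01.
pose S n := geo_eval t @` geos A (C n).
have cS n : closed (S n).
  apply: compact_closed; first exact: metric_hausdorff.
  exact: (compact_intermediate good cA (cC n) Ar (@Cr n)).
have mS n : measurable (S n : set (borel X)) by exact: borel_closed.
have decC : nonincreasing_seq C.
  move=> a b ab; apply/subsetPset => y /= yb; apply: le_trans yb _.
  by rewrite ler_wpM2l ?(ltW d0)// lef_pV2 ?posrE// ler_nat.
have SB n : S n `<=` B.
  move=> _ [g [g0 g1] <-]; apply: (geo_near good); first exact: Ar.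
  exact: (@Cr n).
have Soo n : (m (S n) < +oo)%E.
  by apply: le_lt_trans moo; apply: le_measure; rewrite ?inE//; exact: SB.
(* With [h / 4] as the parameter of [entropy_le], a set of measure below [e] contributes less than
   [h / 4], and the unit mass contributes [h / 4]: together less than [h]. *)
pose e := (h / 4) `^ (N - 1) * (h / 4).
have e0 : 0 < e by rewrite mulr_gt0 ?powR_gt0 ?divr_gt0.
have [n nS] : exists n, (m (S n) < e%:E)%E.
  apply: (@measure_bigcap_small _ _ _ m S) => //.
    move=> a b ab; apply/subsetPset => _ [g [g0 g1] <-]; exists g => //; split => //.
    by have /subsetPset := decC _ _ ab; apply.
  rewrite /S (@intermediate_bigcap R X m p r A o t C good cA Ar cC Cr decC) ?m0 ?lte_fin//.
  apply/seteqP; split => [y Cy|_ -> k _]; last by rewrite /C /= mdistxx divr_ge0// ltW.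
  apply/esym/mdist_positivity/eqP; rewrite eq_le mdist_ge0 andbT.
  apply/ler_addgt0Pl => u u0; rewrite addr0.
  have [k kP] := invS_lt (divr_gt0 u0 d0).
  apply: le_trans (Cy k I) _; apply: ltW.
  by move: kP; rewrite ltr_pdivlMr// mulrC.
have [eta og cdF] := cd mu0 (mu1 n) mu0ac (mu1ac n).
have etaB (s : {i01 R}) : eta [set g | ~ B (g s)] = 0%E.
  apply: (OptGeo_null og mA (mC n) mu0A (mu1C n)).
    exact: (measurable_slice s (measurableC mB)).
  move=> g g0 g1; apply; apply: (geo_near good); first exact: Ar.
  exact: (@Cr n).
have etaTh : eta [set g | 2 * r < geo_length g] = 0%E.
  apply: (OptGeo_null og mA (mC n) mu0A (mu1C n) (measurable_long _)).
  move=> g g0 g1 /=; apply/negP; rewrite -leNgt; apply: (geo_near_length (p := p)); first exact: Ar.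
  exact: (@Cr n).
have ev : measurable_fun [set: borel (geo X)] (geo_eval t : borel (geo X) -> borel X).
  exact: measurable_funPT.
have [||rhot [St [dect rhoS]]] := @finite_lebesgue_decomposition R X m (push eta ev) (S n) _ (mS n) (Soo n).
- exact: (eq_ind_r (fun u => (u < +oo)%E) (ltry 1) (probability_setT eta)).
- apply: (OptGeo_null og mA (mC n) mu0A (mu1C n)).
    exact: (measurable_slice t (measurableC (mS n))).
  by move=> g g0 g1; apply; exists g.
have dec0' : lebesgue_decomposition m
    (pushforward eta (geo_eval zero01 : borel (geo X) -> borel X)) rho0 S0.
  apply: eq_lebesgue_decomposition dec0 => Z mZ; exact/esym/(OptGeo_start og mZ).
have := CD_plan_entropy N1 mB moo cdF etaB etaTh t0 dec0' dect.
have h4 : 0 < h / 4 by rewrite divr_gt0.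
have := entropy_le N1 h4 (mS n) dect rhoS.
have eT : push eta ev setT = 1%E by exact: (probability_setT eta).
move=> e1 e2; have := eq_ind _ (fun u => (entropy m N rhot <= (h / 4)%:E * u + _)%E) e1 _ eT.
rewrite mule1; move=> {e1} /(le_trans (le_trans hle e2)).
apply/negP; rewrite -ltNge.
apply: (@lt_trans _ _ ((h / 4)%:E + (h / 4)%:E)%E); last first.
  by rewrite -EFinD lte_fin; lra.
rewrite lteD2lE// [X in (_ < X%:E)%E](_ : _ = (h / 4) `^ (1 - N) * e).
  by rewrite EFinM lte_pmul2l// lte_fin powR_gt0.
by rewrite /e mulrA -powRD ?subrKA ?addrA ?subrK ?subrr ?powRr0 ?mul1r// (gt_eqF h4) implybT.
Qed.

(** The common consequence of the three curvature hypotheses. For closed [A] the intermediate points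
    form a compact set, so that their measure makes sense. *)
Definition contracting {R : realType} {X : pmetricType R}
    (m : {measure set (borel X) -> \bar R}) (p : X) (r : R) :=
  forall (A : set X) (o : X) (t : {i01 R}), closed A -> A `<=` [set y | mdist p y <= r] ->
  mdist p o < r -> 0 < t%:num < 1 -> m (intermediate_points t A o) = 0%E -> m A = 0%E.

Definition curvature_condition {R : realType} {X : pmetricType R}
    (m : {measure set (borel X) -> \bar R}) :=
  [\/ exists K N : R, 1 < N /\ very_strict_CD m K N,
      exists K N : R, [/\ 1 < N, essentially_non_branching m & MCP m K N]
    | essentially_non_branching m /\ qualitatively_non_degenerate m].

Lemma contracting_exists {R : realType} {X : pmetricType R}
    (m : {measure set (borel X) -> \bar R}) (p : X) : metric_measure_space m ->
  curvature_condition m ->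
  exists2 r0, 0 < r0 & forall r, r < r0 -> good_radius m p r -> contracting m p r.
Proof.
move=> [_ _ spt] [[K [N [N1 cd]]]|[K [N [N1 _ mcp]]]|[_ qnd]].
- exists 1 => // r _ good A o t cA Ar or t01; exact: cd_null N1 cd spt good cA Ar or t01.
(* Half the radius allowed by MCP, since two points of a ball of radius [r] may be [2 * r] apart. *)
- pose r0 := if 0 < K then pi * Num.sqrt ((N - 1) / K) / 2 else 1.
  exists r0.
    rewrite /r0; case: ifP => // K0.
    by rewrite divr_gt0// mulr_gt0 ?pi_gt0// sqrtr_gt0 divr_gt0// subr_gt0.
  move=> r rr0 good A o t cA Ar or t01; apply: (mcp_null N1 mcp _ good) => //; last exact: ltW.
  by move=> K0; move: rr0; rewrite /r0 K0 ltr_pdivlMr// mulrC.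
- by exists 1 => // r _ good A o t cA Ar /ltW or t01; exact: qnd_null qnd good cA Ar or t01.
Qed.

(** Absolute continuity of Lebesgue measure on [Q] with respect to the law of [E] on [W], not the
    converse: this is the form that [density_transport] takes. *)
Definition level_charging {R : realType} {X : pmetricType R}
    (m : {measure set (borel X) -> \bar R}) (W : set X) (E : X -> R) (Q : set R) :=
  forall L : set R, measurable L -> L `<=` Q -> m (W `&` E @^-1` L) = 0%E ->
  (@lebesgue_measure R) L = 0%E.

(* Points at time [lam] of geodesics from [z] to [o v] have height
   [(1 - lam) * E z + lam * v]; moving [v] sweeps an interval of heights. *)
Lemma contracting_level_charging {R : realType} {X : pmetricType R}
    (m : {measure set (borel X) -> \bar R}) (p e w : X) (r d v1 lam : R) (o : R -> X) :
  measure_support m = [set: X] -> good_radius m p r -> contracting m p r ->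
  0 < d -> 0 < v1 -> mdist p w + d <= r ->
  (forall v, 0 <= v <= v1 -> mdist p (o v) < r /\ mdist e (o v) <= v) ->
  (forall v z, 0 <= v <= v1 -> mdist w z <= d -> mdist z (o v) = mdist e z - v) ->
  0 < lam < 1 -> lam * (mdist e w + d) <= d / 2 ->
  level_charging m [set z | mdist w z <= d] (mdist e)
    `[(1 - lam) * mdist e w + lam * (v1 / 4), (1 - lam) * mdist e w + lam * (3 * v1 / 4)]%classic.
Proof.
move=> spt good con d0 v10 wr oP dist /andP[lam0 lam1] lamd.
have [r0 _ moo] := good.
set W := [set z | _]; set Q := `[_, _]%classic.
pose t : {i01 R} := Itv01 (ltW lam0) (ltW lam1).
have mE : measurable_fun [set: borel X] (mdist e : X -> R).
  exact: continuous_measurable_real (@mdist_continuous R X e).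
have mW : measurable (W : set (borel X)) by apply: borel_closed; exact: closed_mdist_le.
(* The bound [d / 2] keeps the contracted points in [W]. The bound [lam * (v1 / 4)] ensures that,
   whichever [z] in [B] Fubini returns, the heights swept from it cover [Q]. *)
pose rho := Num.min (d / 2) (lam * (v1 / 4)).
have rho0 : 0 < rho by rewrite lt_min divr_gt0// mulr_gt0// divr_gt0.
have [rhod rhov] : rho <= d / 2 /\ rho <= lam * (v1 / 4) by split; rewrite /rho ge_min lexx ?orbT.
pose B := [set z | mdist w z <= rho].
have cB : closed B by exact: closed_mdist_le.
have mB : measurable (B : set (borel X)) by exact: borel_closed.
have Br : B `<=` [set y | mdist p y <= r].
  by move=> z; rewrite /B /= => wz; have := metric_triangle p w z; lra.
have B0 : (0 < m B)%E.
  have : measure_support m w by rewrite spt.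
  move=> /(_ [set y | mdist w y < rho]) h; apply: lt_le_trans (h _) _.
    by split; [exact: open_mdist_lt|rewrite /= mdistxx].
  apply: le_measure; rewrite ?inE//; last by move=> y /= /ltW.
  by apply: borel_open; exact: open_mdist_lt.
have Boo : (m B < +oo)%E.
  apply: le_lt_trans moo; apply: le_measure; rewrite ?inE//.
    by apply: borel_closed; exact: closed_mdist_le.
  by move=> y /Br /=; lra.
have comp (L : set R) : closed L -> L `<=` Q -> m (W `&` mdist e @^-1` L) = 0%E ->
    (@lebesgue_measure R) L = 0%E.
  move=> cL LQ mL.
  have mLm : measurable L by exact: closed_measurable.
  have [|z Bz] := level_null mB B0 Boo mE lam0 mLm (v1 := v1).
    move=> v v01.
    have [ov eo] := oP v v01.
    have cA : closed (B `&` [set z | L ((1 - lam) * mdist e z + lam * v)]).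
      apply: closedI => //; apply: (preimage_closed (f := fun z => (1 - lam) * mdist e z + lam * v)) => //.
      move=> z _; apply: cvgD; last exact: cvg_cst.
      by apply: cvgMr; exact: mdist_continuous.
    have Ar : B `&` [set z | L ((1 - lam) * mdist e z + lam * v)] `<=` [set y | mdist p y <= r].
      by move=> z [/Br].
    apply: (con _ (o v) t cA Ar ov).
      by rewrite /= lam0.
    have mI := borel_closed (compact_closed (@metric_hausdorff R X)
      (compact_intermediate_points (t := t) good cA Ar (ltW ov))).
    apply: (subset_measure0 mI _ _ mL).
      apply: measurableI => //.
      by rewrite -[X in measurable X]setTI; exact: mE.
    move=> y [g [[g0 Lg] g1 gt]].
    have wg : mdist w (geo_start g) <= d by move: g0; rewrite /B /=; lra.
    have len : geo_length g = mdist e (geo_start g) - v by rewrite /geo_length g1 dist.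
    have gy : mdist (geo_start g) y = lam * geo_length g.
      by rewrite -gt /geo_start geo_speed /= sub0r normrN ger0_norm// ltW.
    have yo : mdist y (o v) = (1 - lam) * geo_length g.
      rewrite -gt -g1 /geo_end geo_speed /= distrC ger0_norm ?subr_ge0 ?ltW//.
    (* The triangle inequality through [o v] bounds the height from above, the one through the start
       of the geodesic from below, and [dist] makes the two bounds meet. *)
    have eE : mdist e y = (1 - lam) * mdist e (geo_start g) + lam * v.
      have h1 := metric_triangle e (o v) y; have h2 := metric_triangle e y (geo_start g).
      rewrite (metric_sym (o v)) yo len in h1.
      rewrite (metric_sym y) gy len in h2.
      by apply/eqP; rewrite eq_le; apply/andP; split; lra.
    split; last by rewrite /= eE.
    rewrite /W /=; apply: (le_trans (metric_triangle _ (geo_start g) _)); rewrite gy len.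
    have : mdist e (geo_start g) <= mdist e w + d.
      by apply: le_trans (metric_triangle _ w _) _; rewrite lerD2l.
    move: v01 g0 => /andP[v0 _]; rewrite /B /= => g0 ge.
    have : lam * (mdist e (geo_start g) - v) <= lam * (mdist e w + d).
      by rewrite ler_wpM2l ?(ltW lam0)//; lra.
    lra.
  rewrite (_ : L `&` _ = L)//; apply/setIidPl => u /LQ; rewrite /Q /= !in_itv /= => /andP[u1 u2].
  have := mdist_triangle_sub e z w; rewrite (metric_sym z) => h.
  have {}h : `|mdist e z - mdist e w| <= rho by apply: le_trans h Bz.
  move: h; rewrite ler_norml => /andP[h1 h2].
  have hh1 : (1 - lam) * (mdist e z - mdist e w) <= rho.
    by nra.
  have hh2 : - rho <= (1 - lam) * (mdist e z - mdist e w).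
    by nra.
  by apply/andP; split; nra.
(* A compact part of [L] missing less than its full Lebesgue measure reduces the general case to
   closed sets. *)
move=> L mL LQ mL0; apply/eqP/negPn/negP; rewrite -measure_gt0 => L0.
have Loo : ((@lebesgue_measure R) L < +oo)%E.
  apply: (@le_lt_trans _ _ ((@lebesgue_measure R) Q)).
    by apply: le_measure; rewrite ?inE//; exact: measurable_itv.
  by rewrite /Q lebesgue_measure_itv /=; case: ifP; rewrite -?EFinB ltry.
have LE : (@lebesgue_measure R) L = (fine ((@lebesgue_measure R) L))%:E.
  by rewrite fineK// ge0_fin_numE.
have Lf : 0 < fine ((@lebesgue_measure R) L) by rewrite -lte_fin -LE.
have [V [cV VL LV]] := lebesgue_regularity_inner mL Loo Lf.
have cV' : closed V by apply: compact_closed => //; exact: Rhausdorff.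
have mV : measurable V by exact: closed_measurable.
have mpre (Z : set R) : measurable Z -> measurable (W `&` mdist e @^-1` Z : set (borel X)).
  by move=> mZ; apply: measurableI => //; rewrite -[X in measurable X]setTI; exact: mE.
have V0 : (@lebesgue_measure R) V = 0%E.
  apply: comp => //; first exact: subset_trans VL LQ.
  by apply: (subset_measure0 (mpre _ mV) (mpre _ mL) _ mL0) => z [Wz /VL].
have := measureU2 (@lebesgue_measure R) mV (measurableD mL mV).
have V0' : ((@lebesgue_measure R) V <= 0)%E by rewrite V0.
rewrite setDUK// => /le_trans/(_ (leeD2r _ V0')); rewrite add0e; apply/negP.
by rewrite -ltNge; apply: lt_le_trans LV _; rewrite -LE.
Qed.

(** * Calibrated couplings *)

Section calibration.
Local Open Scope ereal_scope.
Context {R : realType} {X : pmetricType R}.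
Variables (e : X) (c : R) (mu0 mu1 : probability (borel X) R).
Implicit Types (s : probability (borel (X * X)) R) (eta : probability (borel (geo X)) R).

(* As [z |-> mdist e z] is 1-Lipschitz, the defect is nonnegative; it vanishes on pairs at
   distance [c] whose heights differ by [c]. *)
Definition defect (y z : X) : R :=
  ((mdist y z - c) ^+ 2 + 2 * c * (mdist y z - (mdist e z - mdist e y)))%R.

Hypotheses (c0 : (0 <= c)%R) (E0 : \int[mu0]_y (mdist e y)%:E < +oo).
Hypothesis E1 : \int[mu1]_z (mdist e z)%:E = \int[mu0]_y (mdist e y)%:E + c%:E.

Lemma defect_ge0 y z : (0 <= defect y z)%R.
Proof.
rewrite addr_ge0 ?sqr_ge0// mulr_ge0 ?mulr_ge0//.
by have := metric_triangle e y z; lra.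
Qed.

Lemma defect_le0 y z : (0 < c)%R -> (defect y z <= 0)%R ->
  mdist y z = c /\ (mdist e z - mdist e y = c)%R.
Proof.
move=> cp; rewrite /defect; have := metric_triangle e y z.
set d := mdist y z; set h := (mdist e z - mdist e y)%R => tri def.
have h1 : (0 <= 2 * c * (d - h))%R by rewrite mulr_ge0 ?mulr_ge0 ?(ltW cp)// /h; lra.
have h2 := sqr_ge0 (d - c)%R.
have /eqP : ((d - c) ^+ 2 = 0)%R by apply/eqP; rewrite eq_le h2 andbT; lra.
rewrite sqrf_eq0 subr_eq0 => /eqP dc; split => //.
have : (2 * c * (d - h) <= 0)%R by lra.
by rewrite pmulr_rle0 ?mulr_gt0// => h3; rewrite /h; rewrite /h in h3; lra.
Qed.

Let mE (f : X * X -> X) : continuous f ->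
  measurable_fun [set: borel (X * X)] (fun p : borel (X * X) => mdist e (f p) : R).
Proof.
move=> cf; apply: continuous_measurable_real => p.
exact: (continuous_comp (cf p) (@mdist_continuous R X e (f p))).
Qed.

Let md : measurable_fun [set: borel (X * X)] (fun p : borel (X * X) => mdist p.1 p.2 : R).
Proof.
apply: (@continuous_measurable_real R (X * X)%type (fun p => mdist p.1 p.2 : R)) => p.
by apply: (@cvg_mdist R X _ (nbhs p)); [exact: cvg_fst|exact: cvg_snd].
Qed.

Let mE1 : measurable_fun [set: borel (X * X)] (fun p : borel (X * X) => mdist e p.1 : R).
Proof. by apply: mE => p; exact: cvg_fst. Qed.

Let mE2 : measurable_fun [set: borel (X * X)] (fun p : borel (X * X) => mdist e p.2 : R).
Proof. by apply: mE => p; exact: cvg_snd. Qed.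

Lemma measurable_defect :
  measurable_fun [set: borel (X * X)] (fun p : borel (X * X) => defect p.1 p.2).
Proof.
apply: measurable_funD; first by apply: measurable_funX; exact: measurable_funB.
by apply: measurable_funM => //; apply: measurable_funB => //; exact: measurable_funB.
Qed.

Lemma coupling_integral s (f : X -> R) : coupling mu0 mu1 s ->
  measurable_fun [set: borel X] f -> (forall x, 0 <= f x)%R ->
  \int[s]_p (f p.1)%:E = \int[mu0]_y (f y)%:E /\ \int[s]_p (f p.2)%:E = \int[mu1]_z (f z)%:E.
Proof.
move=> co mf f0; have mf' : measurable_fun [set: borel X] (EFin \o f) by exact/measurable_EFinP.
have m1 : measurable_fun [set: borel (X * X)] (fst : borel (X * X) -> borel X).
  by apply: (@continuous_borel (X * X)%type X fst) => p; exact: cvg_fst.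
have m2 : measurable_fun [set: borel (X * X)] (snd : borel (X * X) -> borel X).
  by apply: (@continuous_borel (X * X)%type X snd) => p; exact: cvg_snd.
split.
- transitivity (\int[push s m1]_y (f y)%:E).
    by rewrite ge0_integral_push// => x; rewrite lee_fin.
  by apply: eq_measure_integral => A mA _; exact: (co A mA).1.
- transitivity (\int[push s m2]_y (f y)%:E).
    by rewrite ge0_integral_push// => x; rewrite lee_fin.
  by apply: eq_measure_integral => A mA _; exact: (co A mA).2.
Qed.

Lemma calibrated_cost s : coupling mu0 mu1 s ->
  transport_cost s = \int[s]_p (defect p.1 p.2)%:E + (c ^+ 2)%:E.
Proof.
move=> co; have mEX : measurable_fun [set: borel X] (mdist e : X -> R).
  exact: continuous_measurable_real (@mdist_continuous R X e).
have [I1 _] := coupling_integral co mEX (mdist_ge0 e).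
have [_ I2] := coupling_integral co mEX (mdist_ge0 e).
(* Adding [2 * c * mdist e p.2] to the defect leaves only nonnegative terms, so that no subtraction
   of extended integrals occurs; the marginals fix the integrals of both heights. *)
have lhs : \int[s]_p (defect p.1 p.2 + 2 * c * mdist e p.2)%:E =
    \int[s]_p (defect p.1 p.2)%:E + (2 * c)%:E * (\int[mu0]_y (mdist e y)%:E + c%:E).
  under eq_integral do rewrite EFinD EFinM.
  rewrite ge0_integralD//; first last.
  - by apply: emeasurable_funM => //; exact/measurable_EFinP.
  - by move=> p _; rewrite -EFinM lee_fin !mulr_ge0 ?mdist_ge0.
  - by apply/measurable_EFinP; exact: measurable_defect.
  - by move=> p _; rewrite lee_fin defect_ge0.
  rewrite ge0_integralZl//; first last.
  - by rewrite lee_fin mulr_ge0.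
  - by move=> p _; rewrite lee_fin mdist_ge0.
  - exact/measurable_EFinP.
  by rewrite I2 E1.
have rhs : \int[s]_p (defect p.1 p.2 + 2 * c * mdist e p.2)%:E =
    transport_cost s + (2 * c)%:E * \int[mu0]_y (mdist e y)%:E + (c ^+ 2)%:E.
  transitivity (\int[s]_p ((mdist p.1 p.2 ^+ 2)%:E + (2 * c)%:E * (mdist e p.1)%:E + (c ^+ 2)%:E)).
    by apply: eq_integral => p _; rewrite -EFinM -!EFinD; congr EFin; rewrite /defect; ring.
  have m1 : measurable_fun [set: borel (X * X)]
      (fun p : borel (X * X) => (mdist p.1 p.2 ^+ 2)%:E : \bar R).
    by apply/measurable_EFinP; exact: measurable_funX.
  have m2 : measurable_fun [set: borel (X * X)]
      (fun p : borel (X * X) => (2 * c)%:E * (mdist e p.1)%:E : \bar R).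
    by apply: emeasurable_funM => //; exact/measurable_EFinP.
  have g1 (p : X * X) : 0 <= (mdist p.1 p.2 ^+ 2)%:E :> \bar R by rewrite lee_fin sqr_ge0.
  have g2 (p : X * X) : 0 <= (2 * c)%:E * (mdist e p.1)%:E :> \bar R.
    by rewrite -EFinM lee_fin !mulr_ge0 ?mdist_ge0.
  rewrite ge0_integralD//; first last.
  - by move=> p _; rewrite lee_fin sqr_ge0.
  - exact: emeasurable_funD.
  - by move=> p _; rewrite adde_ge0.
  rewrite ge0_integralD// ge0_integralZl//; first last.
  - by rewrite lee_fin mulr_ge0.
  - by move=> p _; rewrite lee_fin mdist_ge0.
  - exact/measurable_EFinP.
  have -> : \int[s]__ (c ^+ 2)%:E = (c ^+ 2)%:E.
    transitivity ((c ^+ 2)%:E * s setT); first exact: integral_cst.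
    by rewrite (probability_setT s) mule1.
  by rewrite I1.
move: lhs; rewrite rhs; have [a ->] : exists a, \int[mu0]_y (mdist e y)%:E = a%:E.
  exists (fine (\int[mu0]_y (mdist e y)%:E)); apply/esym/fineK; rewrite ge0_fin_numE//.
  by apply: integral_ge0 => y _; rewrite lee_fin mdist_ge0.
rewrite -EFinD -!EFinM.
case: (transport_cost s) => [x||] //; case: (\int[s]_p _) => [y||] //.
by rewrite -!EFinD => -[h]; congr EFin; move: h; rewrite expr2; lra.
Qed.

Lemma calibrated_Opt s : coupling mu0 mu1 s ->
  \int[s]_p (defect p.1 p.2)%:E = 0 -> Opt mu0 mu1 s.
Proof.
move=> co D0; split => // s' co'.
rewrite !calibrated_cost// D0 add0e leeDr// integral_ge0// => p _.
by rewrite lee_fin defect_ge0.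
Qed.

(** One coupling of zero defect forces zero defect on every optimal coupling, in particular on that
    of a plan supplied by the very strict CD condition. *)
Lemma Opt_calibrated s s' : coupling mu0 mu1 s ->
  \int[s]_p (defect p.1 p.2)%:E = 0 -> Opt mu0 mu1 s' ->
  s' [set p | (0 < defect p.1 p.2)%R] = 0.
Proof.
move=> co D0 [co' /(_ _ co)]; rewrite !calibrated_cost// D0 add0e => le0.
apply: (ge0_integral0_null measurable_defect) => [p|]; first exact: defect_ge0.
apply/eqP; rewrite eq_le integral_ge0 ?andbT; last by move=> p _; rewrite lee_fin defect_ge0.
by move: le0; rewrite -[leRHS]add0e leeD2rE.
Qed.

End calibration.

(** * Excluding forks *)

Section null_sets.
Local Open Scope ereal_scope.
Context d (T : measurableType d) (R : realType) (nu : {measure set T -> \bar R}).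

Lemma null_setU2 (A B D : set T) : measurable A -> measurable B -> measurable D ->
  A `<=` B `|` D -> nu B = 0 -> nu D = 0 -> nu A = 0.
Proof.
move=> mA mB mD ABD B0 D0; have mBD : measurable (B `|` D) by exact: measurableU.
apply: (subset_measure0 mA mBD ABD).
apply/eqP; rewrite eq_le measure_ge0 andbT.
have B0' : nu B <= 0 by rewrite B0.
have D0' : nu D <= 0 by rewrite D0.
by apply: le_trans (measureU2 nu mB mD) _; rewrite -[leRHS](adde0 0); exact: leeD B0' D0'.
Qed.

Lemma eq_measure_off_null (A B N : set T) : measurable A -> measurable B -> measurable N ->
  nu N = 0 -> (forall x, ~ N x -> A x <-> B x) -> nu A = nu B.
Proof.
move=> mA mB mN N0 AB.
have part (D : set T) : measurable D -> nu D = nu (D `\` N).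
  move=> mD; have I0 : nu (D `&` N) = 0.
    by apply: (subset_measure0 _ mN _ N0) => //; exact: measurableI.
  transitivity (nu (D `\` N) + nu (D `&` N)); first exact: measureDI.
  by rewrite I0 adde0.
rewrite part// [RHS]part//; congr (nu _); apply/seteqP.
by split => x [/= h1 h2]; split => //; exact/(AB x h2).
Qed.

End null_sets.

Lemma measurable_path {R : realType} {X : pmetricType R} (f : R -> X) :
  continuous f -> measurable_fun [set: R] (f : R -> borel X).
Proof.
move=> /continuousP cf; apply: (@measurability _ _ R (borel X) setT f (@open X)) => //.
by move=> _ [B oB <-]; rewrite setTI; apply: open_measurable; exact: cf.
Qed.

Lemma P2ac_intro {R : realType} {X : pmetricType R} (m : {measure set (borel X) -> \bar R})
    (mu : probability (borel X) R) (p : X) (r : R) :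
  (forall A : set (borel X), measurable A -> m A = 0%E -> mu A = 0%E) ->
  mu (~` [set y | mdist p y <= r]) = 0%E -> P2ac m mu.
Proof.
move=> ac mu0; split; last by move=> A mA0 B mB BA; apply: ac => //; exact: mA0.
apply: (@bounded_second_moment _ _ mu p r); rewrite -[RHS]mu0; congr (mu _).
by apply/seteqP; split => y /=; rewrite ltNge => /negP.
Qed.

Section fork.
Local Open Scope ereal_scope.
Context {R : realType} {X : pmetricType R}.
Variables (m : {measure set (borel X) -> \bar R}) (p e : X) (r c u0 u1 : R).
(* [W true] and [W false] are neighbourhoods on the two branches, [W0] is a piece of the ray and
   [yc u] is the point of the ray at height [u]. *)
Variables (W : bool -> set X) (W0 : set X) (yc : R -> X).
Let mu := @lebesgue_measure R.
Let E := mdist e.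
Let Q1 := `[u0, u1]%classic : set R.
Let Q0 := `[(u0 - c)%R, (u1 - c)%R]%classic : set R.

Hypotheses (good : good_radius m p r) (c0 : (0 < c)%R) (u01 : (u0 < u1)%R).
Hypotheses (cW : forall b, closed (W b)) (Wr : forall b, W b `<=` [set y | mdist p y <= r]%R).
Hypothesis Wdisj : W true `&` W false = set0.
Hypothesis chargeW : forall b, level_charging m (W b) E Q1.
Hypothesis charge0 : level_charging m W0 E Q0.
Hypothesis yc_lip : forall u v, (mdist (yc u) (yc v) <= `|u - v|)%R.
Hypothesis yc_near : forall u, (mdist p (yc u) <= r)%R.
Hypothesis E_yc : forall u, Q0 u -> E (yc u) = u.
Hypothesis W0_yc : forall z, W0 z -> Q0 (E z) -> z = yc (E z).
Hypothesis mW0 : measurable (W0 : set (borel X)).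
Hypothesis dist_yc : forall b z u, W b z -> Q0 u -> mdist (yc u) z = (E z - u)%R.
Hypothesis geo_ex : forall y z, (mdist p y <= r)%R -> (mdist p z <= r)%R ->
  exists g : geo X, geo_start g = y /\ geo_end g = z.

Let T z := yc (E z - c)%R.
(** The density of the height on each branch: either branch carries mass 1/2, spread uniformly over
    [Q1]. *)
Let k : R := (2 * (u1 - u0))^-1%R.
Let C := (W true `|` W false) `&` E @^-1` Q1.

Let k0 : (0 < k)%R. Proof. by rewrite invr_gt0 mulr_gt0// subr_gt0. Qed.

Let mE : measurable_fun [set: borel X] (E : X -> R).
Proof. exact: continuous_measurable_real (@mdist_continuous R X e). Qed.

Let yc_continuous : continuous yc.
Proof.
move=> u; apply/(@metricType_numDomainType.cvgrPdist_lt _ _ _ (nbhs u)) => d d0.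
near=> v; apply: le_lt_trans (yc_lip _ _) _; near: v.
by have /cvgrPdist_lt := @cvg_id R (nbhs u); apply.
Unshelve. all: by end_near. Qed.

Let T_continuous : continuous T.
Proof.
move=> z; apply: (@continuous_comp _ _ _ (fun z => E z - c)%R yc); last exact: yc_continuous.
by apply: cvgB; [exact: mdist_continuous|exact: cvg_cst].
Qed.

Let mQ1 : measurable Q1. Proof. exact: measurable_itv. Qed.

Let muQ1 : mu Q1 = (u1 - u0)%:E.
Proof. by rewrite /mu /Q1 lebesgue_measure_itv /= lte_fin u01 EFinB. Qed.

Let mW b : measurable (W b : set (borel X)). Proof. exact: borel_closed. Qed.

Let mEL (L : set R) : measurable L -> measurable (E @^-1` L : set (borel X)).
Proof. by move=> mL; rewrite -[X in measurable X]setTI; exact: mE. Qed.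

Let mC : measurable (C : set (borel X)).
Proof. by apply: measurableI; [exact: measurableU|exact: mEL]. Qed.

Let Q0E z : Q1 (E z) -> Q0 (E z - c)%R.
Proof. by rewrite /Q1 /Q0 /= !in_itv /= !lerD2r. Qed.

Let finr (A : set X) : measurable (A : set (borel X)) ->
  A `<=` [set y | mdist p y <= r]%R -> m A < +oo.
Proof.
have [r0 _ moo] := good => mA Ar; apply: le_lt_trans moo; apply: le_measure; rewrite ?inE//.
  by apply: borel_closed; exact: closed_mdist_le.
by move=> y /Ar /=; lra.
Qed.

(** Each branch is reweighted by [density_transport]. Giving both the same height law is what lets
    them share their starting points. *)
Lemma fork_target : exists mu1 : probability (borel X) R, [/\
  forall A : set (borel X), measurable A -> m A = 0 -> mu1 A = 0,
  forall b (L : set R), measurable L -> mu1 (W b `&` E @^-1` L) = k%:E * mu (L `&` Q1) &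
  mu1 (~` C) = 0].
Proof.
have ex b : exists h : borel X -> \bar R, [/\ measurable_fun [set: borel X] h, forall z, 0 <= h z &
    forall A, measurable A -> \int[m]_(z in W b `&` E @^-1` A) h z = mu (A `&` Q1)].
  apply: density_transport => //; first exact: finr.
    by rewrite -/mu muQ1 ltry.
  by move=> L mL LQ; exact: chargeW.
have [h hP] := choice ex.
pose D b := W b `&` E @^-1` Q1.
have mD b : measurable (D b : set (borel X)) by apply: measurableI => //; exact: mEL.
pose f b z := h b z * (\1_(D b) z)%:E.
have f0 b z : 0 <= f b z by rewrite mule_ge0 ?lee_fin//; case: (hP b).
have mf b : measurable_fun [set: borel X] (f b).
  by apply: emeasurable_funM; [case: (hP b)|apply/measurable_EFinP; exact: measurable_indic].
pose F z := k%:E * (f true z + f false z).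
have F0 z : 0 <= F z by rewrite mule_ge0 ?adde_ge0// lee_fin ltW.
have mF : measurable_fun [set: borel X] F.
  by apply: emeasurable_funM => //; exact: emeasurable_funD.
pose nu := @Defs_reweight__canonical__measure_function_Measure _ _ R m _ mF F0.
have nuE A : measurable (A : set (borel X)) ->
    nu A = k%:E * (\int[m]_(z in A) f true z + \int[m]_(z in A) f false z).
  move=> mA; rewrite -[LHS]/(\int[m]_(z in A) (k%:E * (f true z + f false z))).
  rewrite ge0_integralZl ?lee_fin ?(ltW k0)//; last 2 first.
  - by apply: measurable_funTS; exact: emeasurable_funD.
  - by move=> z _; rewrite adde_ge0.
  by rewrite ge0_integralD//; exact: measurable_funTS.
have fE b (A : set X) : measurable (A : set (borel X)) ->
    \int[m]_(z in A) f b z = \int[m]_(z in A `&` D b) h b z.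
  move=> mA; rewrite [LHS]integral_mkcond [RHS]integral_mkcond; apply: eq_integral => z _.
  rewrite !patchE in_setI /f indicE; case: (z \in A); case: (z \in D b); rewrite /= ?mule1 ?mule0//.
have fW b (L : set R) : measurable L -> \int[m]_(z in W b `&` E @^-1` L) f b z = mu (L `&` Q1).
  move=> mL; rewrite fE; last by apply: measurableI => //; exact: mEL.
  have [_ _ H] := hP b; have := H (L `&` Q1) (measurableI _ _ mL mQ1).
  have -> : mu (L `&` Q1 `&` Q1) = mu (L `&` Q1) by rewrite -setIA setIid.
  by move=> <-; rewrite preimage_setI /D setIACA setIid.
have fN b (A : set X) : measurable (A : set (borel X)) -> A `&` D b = set0 ->
    \int[m]_(z in A) f b z = 0.
  by move=> mA AD; rewrite fE// AD integral_set0.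
have Wd z : W true z -> W false z -> False.
  by move=> h1 h2; have : set0 z by rewrite -Wdisj.
have nuW b L : measurable L -> nu (W b `&` E @^-1` L) = k%:E * mu (L `&` Q1).
  move=> mL; have mWL : measurable (W b `&` E @^-1` L : set (borel X)).
    by apply: measurableI => //; exact: mEL.
  rewrite nuE//; case: b mWL => mWL.
    rewrite fW// (fN false) ?adde0//.
    by apply/seteqP; split => // z [[h1 _] [h2 _]]; case: (Wd z).
  rewrite fW// (fN true) ?add0e//.
  by apply/seteqP; split => // z [[h1 _] [h2 _]]; case: (Wd z).
have nuC : nu (~` C) = 0.
  have mCC : measurable (~` C : set (borel X)) by exact: measurableC.
  rewrite nuE// !fN ?adde0 ?mule0//; apply/seteqP; split => // z [nC [h1 h2]].
    by apply: nC; split => //; right.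
  by apply: nC; split => //; left.
have nuT : nu setT = 1.
  have CE : C = (W true `&` E @^-1` Q1) `|` (W false `&` E @^-1` Q1) by rewrite /C setIUl.
  have h1 : nu C = 1.
    rewrite CE measureU; [|exact: (mD true)|exact: (mD false)|]; last first.
      by rewrite setIACA Wdisj set0I.
    have := nuW true Q1 mQ1; have := nuW false Q1 mQ1; rewrite setIid muQ1 => n1 n2.
    transitivity (nu (W true `&` E @^-1` Q1) + nu (W false `&` E @^-1` Q1)) => //.
    rewrite n1 n2 -EFinM -EFinD; congr EFin; rewrite /k; field.
    by rewrite subr_eq0 gt_eqF.
  transitivity (nu C + nu (~` C)); last by rewrite h1 nuC adde0.
  by rewrite -measureU ?setUv ?setICr//; exact: measurableC.
(* The measure [nu] already has mass 1; normalising only supplies the structure of a probability. *)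
have E1 A : mnormalize nu (dirac (p : borel X)) A = nu A.
  by rewrite /mnormalize nuT onee_eq0/= invr1 mule1.
exists (mnormalize nu (dirac (p : borel X))); split.
- move=> A mA A0; rewrite /= E1.
  by apply: null_set_integral => //; exact: measurable_funTS.
- by move=> b L mL; rewrite /= E1 nuW.
- by rewrite /= E1.
Qed.


Hypothesis split_time : forall u, Q0 u -> exists t : {i01 R}, (0 < t%:num < 1)%R /\
  forall g1 g2 : geo X, geo_start g1 = yc u -> geo_start g2 = yc u ->
    W true (geo_end g1) -> W false (geo_end g2) ->
    geo_length g1 = c -> geo_length g2 = c ->
    forall s : {i01 R}, (s%:num <= t%:num)%R -> g1 s = g2 s.
(** This form covers all three hypotheses: under essential non-branching the given plan itself will
    do, while very strict CD returns a plan of its own choice. *)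
Hypothesis non_branching_plan : forall mu0 mu1 : probability (borel X) R,
  P2ac m mu0 -> P2ac m mu1 ->
  mu0 (~` [set y | mdist p y <= r]%R) = 0 -> mu1 (~` [set y | mdist p y <= r]%R) = 0 ->
  (exists eta, OptGeo mu0 mu1 eta) -> exists eta G, [/\ OptGeo mu0 mu1 eta,
    measurable (G : set (borel (geo X))), eta (~` G) = 0 & non_branching_set G].

Let mT : measurable_fun [set: borel X] (T : borel X -> borel X).
Proof. exact: continuous_borel T_continuous. Qed.

Let defect0 z : C z -> defect e c (T z) z = 0%R.
Proof.
move=> [Wz Qz]; have [b Wb] : exists b, W b z by case: Wz; [exists true|exists false].
have Qc : Q0 (E z - c)%R by exact: Q0E.
rewrite /defect /T (dist_yc Wb Qc) -/(E z) -/(E (yc (E z - c)%R)) E_yc//; ring.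
Qed.

Section target.
Variable mu1 : probability (borel X) R.
Hypothesis ac1 : forall A : set (borel X), measurable A -> m A = 0 -> mu1 A = 0.
Hypothesis massW : forall b (L : set R), measurable L ->
  mu1 (W b `&` E @^-1` L) = k%:E * mu (L `&` Q1).
Hypothesis muC : mu1 (~` C) = 0.
Let mu0 : probability (borel X) R := push mu1 mT.

Let height_null (L : set R) : measurable L -> mu (L `&` Q1) = 0 -> mu1 (E @^-1` L) = 0.
Proof.
move=> mL L0; have mWE b : measurable (W b `&` E @^-1` L : set (borel X)).
  by apply: measurableI => //; exact: mEL.
have W0' b : mu1 (W b `&` E @^-1` L) = 0 by rewrite massW// L0 mule0.
apply: (@null_setU2 _ _ _ mu1 _ ((W true `&` E @^-1` L) `|` (W false `&` E @^-1` L)) (~` C)) => //.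
- exact: mEL.
- exact: measurableU.
- exact: measurableC.
- move=> z Lz; have [[[Wz|Wz] _]|nC] := pselect (C z); last by right.
    by left; left.
  by left; right.
- by apply: (@null_setU2 _ _ _ mu1 _ (W true `&` E @^-1` L) (W false `&` E @^-1` L)) => //;
    [exact: measurableU|exact: W0'|exact: W0'].
Qed.

Let mu0B : mu0 (~` [set y | mdist p y <= r]%R) = 0.
Proof.
rewrite /mu0 /= /push /pushforward (_ : _ @^-1` _ = set0) ?measure0//.
by apply/seteqP; split => // z /=; apply; exact: yc_near.
Qed.

Let mu1B : mu1 (~` [set y | mdist p y <= r]%R) = 0.
Proof.
apply/eqP; rewrite eq_le measure_ge0 andbT -muC; apply: le_measure; rewrite ?inE.
- by apply: measurableC; apply: borel_closed; exact: closed_mdist_le.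
- exact: measurableC.
- by apply: subsetC => z [[/Wr|/Wr]].
Qed.

Let P1 : P2ac m mu1. Proof. exact: P2ac_intro ac1 mu1B. Qed.

(** If [A] is [m]-null, then so are the points of [W0] whose height [v] is in [Q0] with [yc v] in
    [A]; by [charge0] these heights are Lebesgue-null, and so are the heights of [mu1] obtained by
    adding [c]. *)
Lemma fork_source_P2ac : P2ac m mu0.
Proof.
apply: P2ac_intro mu0B => A mA A0.
pose L := [set u | A (yc (u - c)%R)].
have mL : measurable L.
  have cf : continuous (fun u => yc (u - c)%R).
    move=> u; apply: (@continuous_comp _ _ _ (fun u => u - c)%R yc); last exact: yc_continuous.
    by apply: cvgB; [exact: cvg_id|exact: cvg_cst].
  by have := measurable_path cf measurableT mA; rewrite setTI.
have : mu1 (E @^-1` L) = 0; last by [].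
apply: height_null => //; pose L0 := [set v | Q0 v /\ A (yc v)].
have mL0 : measurable L0.
  apply: measurableI; first exact: measurable_itv.
  by have := measurable_path yc_continuous measurableT mA; rewrite setTI.
have -> : mu (L `&` Q1) = mu L0.
  rewrite /mu (lebesgue_affine c (ltr01) (measurableI _ _ mL mQ1)) mul1e; congr (lebesgue_measure _).
  apply/seteqP; split => v; rewrite /L /L0 /Q0 /Q1 /= !in_itv /= mul1r addrAC subrr add0r.
    by move=> [Av /andP[q1 q2]]; split; [apply/andP; split; lra|exact: Av].
  by move=> [/andP[q1 q2] Av]; split; [exact: Av|apply/andP; split; lra].
apply: charge0 => //; first by move=> v [].
apply: (subset_measure0 _ mA _ A0).
  by apply: measurableI => //; exact: mEL.
by move=> z [W0z [Qz Az]]; rewrite (W0_yc W0z Qz).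
Qed.

Let IT : \int[mu0]_y (E y)%:E = \int[mu1]_z (E (T z))%:E.
Proof.
transitivity (\int[push mu1 mT]_y (E y)%:E); first by [].
rewrite ge0_integral_push//; first exact/measurable_EFinP.
by move=> z; rewrite lee_fin mdist_ge0.
Qed.

Let E0 : \int[mu0]_y (E y)%:E < +oo.
Proof.
rewrite IT; apply: (@le_lt_trans _ _ (\int[mu1]_z (mdist e p + r)%R%:E)).
  apply: ge0_le_integral_nonmeas => z _; rewrite lee_fin ?mdist_ge0//.
  by apply: le_trans (metric_triangle _ p _) _; rewrite lerD2l; exact: yc_near.
have -> : \int[mu1]__ (mdist e p + r)%R%:E = (mdist e p + r)%R%:E * mu1 setT.
  exact: integral_cst.
by rewrite (probability_setT mu1) mule1 ltry.
Qed.

Let nCC : measurable (~` C : set (borel X)). Proof. exact: measurableC. Qed.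

Let IE : \int[mu1]_z (E z)%:E = \int[mu0]_y (E y)%:E + c%:E.
Proof.
have mET : measurable_fun [set: borel X] (fun z : borel X => E (T z) : R).
  exact: (measurableT_comp mE mT).
transitivity (\int[mu1]_z ((E (T z))%:E + c%:E)).
  rewrite (ge0_negligible_integral nCC)//; [|exact/measurable_EFinP|by move=> z _; rewrite lee_fin mdist_ge0].
  rewrite [RHS](ge0_negligible_integral nCC)//; last 2 first.
  - by apply: emeasurable_funD => //; exact/measurable_EFinP.
  - by move=> z _; rewrite adde_ge0// lee_fin ?mdist_ge0// ltW.
  apply: eq_integral => z; rewrite inE => -[_ /contrapT[_ Qz]].
  by rewrite -EFinD /T E_yc ?subrK//; exact: Q0E.
rewrite ge0_integralD//; first last.
- by move=> z _; rewrite lee_fin ltW.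
- exact/measurable_EFinP.
- by move=> z _; rewrite lee_fin mdist_ge0.
rewrite -IT; congr (_ + _).
have -> : \int[mu1]__ c%:E = c%:E * mu1 setT by exact: integral_cst.
by rewrite (probability_setT mu1) mule1.
Qed.

(** The geodesics starting at the image under [T] of their end form, within the ball, a compact set;
    a measurable selection picks one for each end [z], and [mu1] is pushed forward by it. *)
Lemma fork_calibrated_plan : exists2 eta : probability (borel (geo X)) R,
    coupling mu0 mu1 (distribution eta (@geo_ends R X)) &
    \int[distribution eta (@geo_ends R X)]_q (defect e c q.1 q.2)%:E = 0.
Proof.
pose K := geos [set y | mdist p y <= r]%R [set y | mdist p y <= r]%R `&`
  [set g | mdist (geo_start g) (T (geo_end g)) <= 0]%R.
have cK : compact K.
  apply: compact_closedI; first by apply: (compact_geos good) => //; exact: closed_mdist_le.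
  pose F (g : geo X) : R := mdist (geo_start g) (T (geo_end g)).
  rewrite (_ : [set g | _] = F @^-1` [set u | u <= 0]%R)//.
  apply: preimage_closed; last exact: closed_le.
  move=> g _; apply: (@cvg_mdist R X _ (nbhs g) _ (@geo_start R X) (T \o @geo_end R X)).
    exact: geo_eval_continuous.
  apply: (@continuous_comp _ _ _ (@geo_end R X) T); [exact: geo_eval_continuous|exact: T_continuous].
have [s [ms sP]] := compact_selection cK (@geo_eval_continuous R X one01).
have sC z : C z -> geo_start (s z) = T z /\ geo_end (s z) = z.
  move=> [Wz _]; have zr : (mdist p z <= r)%R by case: Wz => /Wr.
  have [g [g0 g1]] := geo_ex (yc_near (E z - c)%R) zr.
  have [|[_ /= sT] sz] := sP z.
    exists g; last exact: g1.
    split; first by split; rewrite /= ?g0 ?g1//; exact: yc_near.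
    by rewrite /= g0 g1 mdistxx.
  split; last exact: sz.
  apply: mdist_positivity; apply/eqP; rewrite eq_le mdist_ge0 andbT.
  by have := sT; rewrite (sz : geo_end (s z) = z).
pose eta1 : probability (borel (geo X)) R := push mu1 ms.
have mpre (t : {i01 R}) (A : set X) : measurable (A : set (borel X)) ->
    measurable ([set z | A (s z t)] : set (borel X)).
  by move=> mA; have := ms measurableT _ (measurable_slice t mA); rewrite setTI.
exists eta1.
  move=> A mA; split.
    apply: (@eq_measure_off_null _ _ _ mu1 [set z | A (s z zero01)] (T @^-1` A) (~` C)) => //.
    - exact: mpre.
    - by rewrite -[X in measurable X]setTI; exact: mT.
    - by move=> z /contrapT/sC[sz _]; rewrite /= -sz.
  apply: (@eq_measure_off_null _ _ _ mu1 [set z | A (s z one01)] A (~` C)) => //.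
  - exact: mpre.
  - by move=> z /contrapT/sC[_ sz]; rewrite /= -[X in _ <-> A X]sz.
have mends : measurable_fun [set: borel (geo X)] (@geo_ends R X : borel (geo X) -> borel (X * X)).
  exact: measurable_funPT.
transitivity (\int[push eta1 mends]_q (defect e c q.1 q.2)%:E) => //.
have mdef := measurable_defect e c.
have d0 q : 0 <= (defect e c q.1 q.2)%:E :> \bar R by rewrite lee_fin defect_ge0// ltW.
rewrite ge0_integral_push//; last exact/measurable_EFinP.
rewrite /eta1 ge0_integral_push//; last first.
  by apply/measurable_EFinP; exact: (measurableT_comp mdef mends).
rewrite (ge0_negligible_integral nCC)//; last first.
  by apply/measurable_EFinP; exact: (measurableT_comp (measurableT_comp mdef mends) ms).
rewrite integral0_eq// => z [_ /contrapT Cz]; rewrite /geo_ends /=.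
by have [-> ->] := sC z Cz; rewrite defect0.
Qed.

Section plan.
Variables (eta : probability (borel (geo X)) R) (G : set (geo X)).
Hypotheses (og : OptGeo mu0 mu1 eta) (mG : measurable (G : set (borel (geo X)))).
Hypotheses (G0 : eta (~` G) = 0) (nbG : non_branching_set G).
Hypothesis def0 : eta [set g : geo X | 0 < defect e c (geo_start g) (geo_end g)]%R = 0.

Let D b := [set g : geo X | (W b `&` E @^-1` Q1) (geo_end g)].
Let P := [set g : geo X | G g /\ defect e c (geo_start g) (geo_end g) <= 0]%R `&`
  [set g : geo X | (yc @` Q0) (geo_start g)].

(** The good geodesics ending on one branch have mass 1/2. A compact part is taken because its
    heights then form a compact, hence measurable, set. *)
Lemma fork_compact_part b :
  exists F : set (geo X), [/\ compact F, F `<=` P `&` D b & (4^-1)%:E < eta F].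
Proof.
have mWQ : measurable (W b `&` E @^-1` Q1 : set (borel X)).
  by apply: measurableI => //; exact: mEL.
have mD : measurable (D b : set (borel (geo X))) by exact: (measurable_slice one01 mWQ).
have etaD : eta (D b) = (2^-1)%:E.
  rewrite (OptGeo_end og mWQ) massW// setIid muQ1 -EFinM; congr EFin; rewrite /k; field.
  by rewrite subr_eq0 gt_eqF.
have mycQ : measurable (yc @` Q0 : set (borel X)).
  apply: borel_closed; apply: compact_closed; first exact: metric_hausdorff.
  apply: continuous_compact; last exact: segment_compact.
  by apply: continuous_subspaceT => v; exact: yc_continuous.
have mends : measurable_fun [set: borel (geo X)] (@geo_ends R X : borel (geo X) -> borel (X * X)).
  exact: measurable_funPT.
pose Z := [set g : geo X | 0 < defect e c (geo_start g) (geo_end g)]%R.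
have mZ : measurable (Z : set (borel (geo X))).
  rewrite -[Z]setTI.
  by apply: measurable_fun_ltr => //; exact: (measurableT_comp (measurable_defect e c) mends).
have ZC : [set g | G g /\ (defect e c (geo_start g) (geo_end g) <= 0)%R] = G `&` ~` Z.
  by apply/seteqP; split => g [Gg] /=; rewrite /Z /= leNgt => /negP.
have mZC : measurable (~` Z : set (borel (geo X))) by exact: measurableC.
have myc : measurable ([set g : geo X | (yc @` Q0) (geo_start g)] : set (borel (geo X))).
  exact: (measurable_slice zero01 mycQ).
have mP : measurable (P : set (borel (geo X))).
  by rewrite /P ZC; apply: measurableI => //; exact: measurableI.
have mPC : measurable (~` P : set (borel (geo X))) by exact: measurableC.
have yc0 : eta [set g : geo X | (~` (yc @` Q0)) (geo_start g)] = 0.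
  rewrite (OptGeo_start og (measurableC mycQ)).
  apply: (subset_measure0 _ nCC _ muC) => [|z /= nz].
    rewrite -[X in measurable X]setTI; apply: (mT measurableT); exact: measurableC.
  by move=> [_ Qz]; apply: nz; exists (E z - c)%R => //; exact: Q0E.
have mGC : measurable (~` G : set (borel (geo X))) by exact: measurableC.
have P1' : eta (~` P) = 0.
  apply: (@null_setU2 _ _ _ eta (~` P) (~` G `|` Z)
    [set g : geo X | (~` (yc @` Q0)) (geo_start g)]) => //.
  - exact: measurableU.
  - exact: (measurable_slice zero01 (measurableC mycQ)).
  - move=> g; rewrite /P ZC => nP; have [yg|] := pselect ((yc @` Q0) (geo_start g)); last by right.
    left; have [Gg|] := pselect (G g); last by left.
    by right; apply: contrapT => nZ; apply: nP.
  - exact: (@null_setU2 _ _ _ eta (~` G `|` Z) (~` G) Z (measurableU _ _ mGC mZ) mGC mZ _ G0 def0).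
have mPD : measurable (P `&` D b : set (borel (geo X))) by exact: measurableI.
have PD : eta (P `&` D b) = (2^-1)%:E.
  rewrite -etaD; apply: (@eq_measure_off_null _ _ _ eta _ _ (~` P)) => //.
  by move=> g /contrapT Pg; split => [[]|].
have e4 : (0 < 4^-1 :> R)%R by rewrite invr_gt0.
have [F [cF FPD FD]] := inner_regular eta mPD e4.
exists F; split => //.
- apply: (subclosed_compact cF (compact_geos good _ _ (@subset_refl _ _) (@subset_refl _ _)));
    [exact: closed_mdist_le|exact: closed_mdist_le|].
  move=> g /FPD[[_ [v _ sg]] [Wg _]]; split; last exact: Wr Wg.
  by rewrite /= -sg; exact: yc_near.
- have mF : measurable (F : set (borel (geo X))) by exact: borel_closed.
  have : eta (P `&` D b) = eta (P `&` D b `\` F) + eta (P `&` D b `&` F) by exact: measureDI.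
  rewrite (setIidr FPD) PD => PDE; rewrite ltNge; apply/negP => F4.
  have Ffin : eta F \is a fin_num by rewrite ge0_fin_numE// (le_lt_trans F4)// ltry.
  have := lte_leD Ffin FD F4; rewrite -PDE -EFinD lte_fin; lra.
Qed.

(** Mass above 1/4 means, for a height law of density [k], a set of heights filling more than half
    of [Q1]; two such sets intersect. *)
Lemma fork_common_height : exists g1 g2, [/\ P g1, P g2, W true (geo_end g1),
  W false (geo_end g2) & E (geo_end g1) = E (geo_end g2)].
Proof.
have [F FP] := choice fork_compact_part.
pose Lam b := (E \o @geo_end R X) @` F b.
have cLam b : compact (Lam b).
  have [cF _ _] := FP b; apply: continuous_compact => //.
  apply: continuous_subspaceT => g; apply: continuous_comp; first exact: geo_eval_continuous.
  exact: mdist_continuous.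
have LamQ b : Lam b `<=` Q1.
  by move=> _ [g Fg <-]; case: (FP b) => _ /(_ g Fg)[_ [_]].
have mLam b : measurable (Lam b).
  by apply: closed_measurable; apply: compact_closed => //; exact: Rhausdorff.
have big b : ((u1 - u0) / 2)%:E < mu (Lam b).
  have [_ FPD F4] := FP b.
  have mWL : measurable (W b `&` E @^-1` Lam b : set (borel X)).
    by apply: measurableI => //; exact: mEL.
  have : eta (F b) <= k%:E * mu (Lam b).
    have <- : mu (Lam b `&` Q1) = mu (Lam b) by rewrite (setIidl (LamQ b)).
    rewrite -(massW b)// -(OptGeo_end og mWL); apply: le_measure; rewrite ?inE.
    - apply: borel_closed; apply: compact_closed; [exact: metric_hausdorff|by case: (FP b)].
    - exact: (measurable_slice one01 mWL).
    - move=> g Fg; have [_ [Wg _]] := FPD g Fg; split => //; by exists g.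
  move=> /(lt_le_trans F4); rewrite (_ : 4^-1 = k * ((u1 - u0) / 2))%R.
    by rewrite EFinM lte_pmul2l// lte_fin.
  by rewrite /k; field; rewrite subr_eq0 gt_eqF.
have [u [ut uf]] : exists u, Lam true u /\ Lam false u.
  apply: contrapT => disj.
  have L0 : Lam true `&` Lam false = set0.
    by apply/seteqP; split => // u [h1 h2]; apply: disj; exists u.
  have : mu (Lam true `|` Lam false) <= mu Q1.
    have mU : measurable (Lam true `|` Lam false) by exact: measurableU (mLam true) (mLam false).
    apply: le_measure; rewrite ?inE.
    - exact: mU.
    - exact: mQ1.
    - by move=> u []; exact: LamQ.
  have -> : mu (Lam true `|` Lam false) = mu (Lam true) + mu (Lam false).
    exact: (measureU (@lebesgue_measure R) (mLam true) (mLam false) L0).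
  rewrite muQ1 leNgt => /negP; apply.
  rewrite (_ : u1 - u0 = (u1 - u0) / 2 + (u1 - u0) / 2)%R; last by field.
  by rewrite EFinD; apply: lteD.
move: ut uf => [g1 Fg1 Eg1] [g2 Fg2 Eg2].
have [_ /(_ g1 Fg1)[Pg1 [Wg1 _]] _] := FP true.
have [_ /(_ g2 Fg2)[Pg2 [Wg2 _]] _] := FP false.
by exists g1, g2; split => //; exact: etrans Eg1 (esym Eg2).
Qed.

(** Equal end heights and zero defect give equal start heights, hence the same starting point on the
    ray. The two geodesics then agree initially, so they coincide, although their ends lie in
    disjoint sets. *)
Lemma fork_branching : False.
Proof.
have [g1 [g2 [[[G1 dg1] [v1 Qv1 s1]] [[G2 dg2] [v2 Qv2 s2]] W1 W2 E12]]] := fork_common_height.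
have [l1 h1] := defect_le0 c0 dg1; have [l2 h2] := defect_le0 c0 dg2.
have e1 : mdist e (geo_start g1) = v1 by rewrite -s1; exact: E_yc.
have e2 : mdist e (geo_start g2) = v2 by rewrite -s2; exact: E_yc.
have v12 : v2 = v1.
  by move: h1 h2; rewrite e1 e2 -/(E (geo_end g1)) -/(E (geo_end g2)) E12; lra.
rewrite {}v12 in s2.
have [t [t01 agree]] := split_time Qv1.
have g12 : g1 = g2 by apply: (nbG G1 G2 t01); exact: agree.
have : (W true `&` W false) (geo_end g1) by split => //; rewrite g12.
by rewrite Wdisj.
Qed.

End plan.

Lemma fork_target_absurd : False.
Proof.
have [eta1 piO pi0] := fork_calibrated_plan.
have opt1 : OptGeo mu0 mu1 eta1 by exact: (calibrated_Opt (ltW c0) E0 IE piO pi0).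
have [eta [G [og mG G0 nbG]]] :=
  non_branching_plan fork_source_P2ac P1 mu0B mu1B (ex_intro _ eta1 opt1).
exact: (fork_branching og mG G0 nbG (Opt_calibrated (ltW c0) E0 IE piO pi0 og)).
Qed.

End target.

Theorem no_fork : False.
Proof. by have [mu1 [ac1 massW muC]] := fork_target; exact: fork_target_absurd ac1 massW muC. Qed.

End fork.

Lemma plan_non_branching {R : realType} {X : pmetricType R}
    (m : {measure set (borel X) -> \bar R}) (p : X) (r : R) : metric_measure_space m ->
  curvature_condition m ->
  good_radius m p r -> forall mu0 mu1 : probability (borel X) R,
  P2ac m mu0 -> P2ac m mu1 ->
  mu0 (~` [set y | mdist p y <= r]) = 0%E -> mu1 (~` [set y | mdist p y <= r]) = 0%E ->
  (exists eta, OptGeo mu0 mu1 eta) -> exists eta G, [/\ OptGeo mu0 mu1 eta,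
    measurable (G : set (borel (geo X))), eta (~` G) = 0%E & non_branching_set G].
Proof.
move=> hX hc good mu0 mu1 P0 P1 B0 B1 [eta og].
have enb_case : essentially_non_branching m -> exists eta G, [/\ OptGeo mu0 mu1 eta,
    measurable (G : set (borel (geo X))), eta (~` G) = 0%E & non_branching_set G].
  by move=> enb; have [G [mG G0 nb]] := enb mu0 mu1 P0 P1 eta og; exists eta, G.
case: hc => [[K [N [N1 cd]]]|[K [N [N1 enb _]]]|[enb _]]; [|exact: enb_case|exact: enb_case].
have [eta' og' cdF] := cd mu0 mu1 P0 P1.
have [r0 _ moo] := good.
have mc : measurable ([set y | mdist p y <= r] : set (borel X)).
  by apply: borel_closed; exact: closed_mdist_le.
have mB : measurable ([set y | mdist p y <= 4 * r] : set (borel X)).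
  by apply: borel_closed; exact: closed_mdist_le.
have etaB (t : {i01 R}) : eta' [set g | ~ [set y | mdist p y <= 4 * r] (g t)] = 0%E.
  apply: (OptGeo_null og' mc mc B0 B1 (measurable_slice t (measurableC mB))).
  by move=> g g0 g1; apply; exact: (geo_near good).
have etaTh : eta' [set g | 2 * r < geo_length g] = 0%E.
  apply: (OptGeo_null og' mc mc B0 B1 (measurable_long _)) => g g0 g1 /=.
  by apply/negP; rewrite -leNgt; apply: (geo_near_length (p := p)).
have ac0 (A : set (borel X)) : measurable A -> m A = 0%E -> eta' [set g | A (g zero01)] = 0%E.
  move=> mA A0; have [_ ac] := P0; rewrite (OptGeo_start og' mA).
  exact: (ac A ((measure0_null_setP m mA).2 A0) A mA (@subset_refl _ A)).
have [[_ _ [D cD dD] _] _ _] := hX.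
have [G [mG G0 nb]] := CD_plan_non_branching N1 mB moo cdF etaB etaTh ac0 cD dD.
by exists eta', G.
Qed.

(** * The fork at the end of a ray *)

Section core.
Context {R : realType} {X : metricType R}.
Variables (q : X) (l r : R) (gam : R -> X).
Hypotheses (l0 : 0 < l) (ul : unit_speed l gam) (gam0 : gam 0 = q).
Hypothesis gam_int : forall a : R, 0 < a < l -> interior_point (gam a).
Hypotheses (r0 : 0 < r) (rl : 2 * r < l).
Hypothesis geo_ex : forall y z, mdist q y < r -> mdist q z < r ->
  exists g : geo X, geo_start g = y /\ geo_end g = z.

Let branch z (a : R) : ~ on_curve l gam z -> mdist q z < r -> 0 <= a < r ->
  mdist (gam a) z = mdist q z + a.
Proof.
move=> nz zr /andP[a0 ar].
by apply: (branch_dist l0 ul gam0 gam_int geo_ex) => //; have := rl; lra.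
Qed.

(* A geodesic leaving the curve does so through [q], so near its start it runs back along
   the curve. *)
Lemma branch_initial (a c : R) : 0 < a -> 0 < c -> a + c < r ->
  exists t : {i01 R}, 0 < t%:num < 1 /\ forall g : geo X, geo_start g = gam a ->
    ~ on_curve l gam (geo_end g) -> mdist q (geo_end g) < r -> geo_length g = c ->
    forall s : {i01 R}, s%:num <= t%:num -> g s = gam (a - s%:num * c).
Proof.
move=> a0 c0 acr; have al : 0 < a < l.
  apply/andP; split; first exact: a0.
  have := r0; have := rl; lra.
have [d d0 dP] := gam_open ul gam_int al.
(* Up to time [tt] the geodesic covers at most [d / 2], so it stays where [gam_open] leaves only
   points of the curve. *)
pose tt := Num.min (1 / 2) (d / (2 * c)).
have tt0 : 0 < tt by rewrite lt_min !divr_gt0 ?mulr_gt0.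
have tt1 : tt < 1 by apply: (@le_lt_trans _ _ (1 / 2)); [rewrite /tt ge_min lexx|lra].
have ttd : tt * c < d.
  apply: (@le_lt_trans _ _ (d / (2 * c) * c)).
    by rewrite ler_wpM2r ?(ltW c0)// /tt ge_min lexx orbT.
  rewrite (_ : _ * c = d / 2); [lra|by field; rewrite gt_eqF].
pose t : {i01 R} := Itv01 (ltW tt0) (ltW tt1).
exists t; split; first by rewrite /= tt0.
move=> g g0 nz zr len s st; have s1 : s%:num <= 1 by [].
have s0 : 0 <= s%:num by [].
have gs : mdist (gam a) (g s) = s%:num * c.
  by rewrite -g0 /geo_start geo_speed /= sub0r normrN ger0_norm//; congr (_ * _).
have ge : mdist (g s) (geo_end g) = (1 - s%:num) * c.
  by rewrite /geo_end geo_speed /= distrC ger0_norm ?subr_ge0//; congr (_ * _).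
have scd : s%:num * c < d by apply: le_lt_trans ttd; rewrite ler_wpM2r// ltW.
have [|b bl gb] := dP (g s); first by rewrite gs.
have bE : `|a - b| = s%:num * c.
  by rewrite -gs gb ul//; apply/andP; split; apply: ltW; [case/andP: al|case/andP: al|case/andP: bl|case/andP: bl].
have sc : s%:num * c <= c by rewrite ler_piMl// ltW.
have br : 0 <= b < r.
  apply/andP; split; first by apply: ltW; case/andP: bl.
  by move: bE; case: (leP 0 (a - b)) => h; [rewrite ger0_norm//|rewrite ltr0_norm//]; lra.
(* By [branch], both the whole geodesic and its remainder after time [s] pass through [q]; comparing
   their lengths gives [b]. *)
have h1 : mdist q (geo_end g) + a = c.
  by rewrite -len /geo_length g0 branch//; apply/andP; split; lra.
have h2 : mdist q (geo_end g) + b = (1 - s%:num) * c by rewrite -ge gb branch.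
by rewrite gb; congr gam; lra.
Qed.


(** The parameter on the curve of the point at height [u] below [gam (r / 2)], truncated so that the
    path is defined, Lipschitz and near [q] for every real [u]. *)
Definition clamp (u : R) : R := Num.max 0 (Num.min (r / 2) (r / 2 - u)).

Lemma clamp_itv u : 0 <= clamp u <= r / 2.
Proof.
by rewrite /clamp le_max lexx /= ge_max ge_min lexx /= andbT divr_ge0// ltW.
Qed.

Lemma clamp_id u : 0 <= u <= r / 2 -> clamp u = r / 2 - u.
Proof.
move=> /andP[u0 u1]; rewrite /clamp min_r; last by rewrite lerBlDr lerDl.
by rewrite max_r// subr_ge0.
Qed.

Lemma clamp_lip u v : `|clamp u - clamp v| <= `|u - v|.
Proof.
have := r0; rewrite /clamp => rp.
by case: (leP (r / 2) (r / 2 - u)) => h1; case: (leP (r / 2) (r / 2 - v)) => h2;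
  rewrite ?(max_r (divr_ge0 (ltW rp) _))//;
  case: (leP 0 (r / 2 - u)) => h3; case: (leP 0 (r / 2 - v)) => h4;
  rewrite ?(max_l (ltW h3)) ?(max_l (ltW h4)) ?(max_r h3) ?(max_r h4);
  case: (leP 0 (u - v)) => h5; rewrite ?(ger0_norm h5) ?(ltr0_norm h5) ler_norml;
  apply/andP; split; lra.
Qed.

End core.

Theorem ray_core {R : realType} {X : pmetricType R}
    (m : {measure set (borel X) -> \bar R}) : metric_measure_space m ->
  curvature_condition m ->
  forall (q : X) (l : R) (gam : R -> X), 0 < l ->
  unit_speed l gam -> gam 0 = q ->
  (forall a : R, 0 < a < l -> interior_point (gam a)) ->
  ~ (forall e : R, 0 < e -> exists w1 w2, [/\ w1 != w2, mdist q w1 = mdist q w2,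
    0 < mdist q w1 < e, ~ on_curve l gam w1 & ~ on_curve l gam w2]).
Proof.
move=> hX hc q l gam l0 ul gam0 gam_int fork.
have [[_ _ _ lX] _ spt] := hX.
have [rc rc0 con] := contracting_exists q hX hc.
have m0 : 0 < Num.min rc (l / 2) by rewrite lt_min rc0 divr_gt0.
have [r good] := good_radius_exists q hX m0.
rewrite lt_min => /andP[rrc rl2].
have rl : 2 * r < l by lra.
have {}con := con r rrc good.
have [r0 cK moo] := good.
have geo_ex y z : mdist q y <= r -> mdist q z <= r ->
    exists g : geo X, geo_start g = y /\ geo_end g = z.
  move=> qy qz; apply: (geodesic_exists lX cK) => x /= yx.
  have := metric_triangle q y x; have := metric_triangle y q z.
  by rewrite (metric_sym y q); lra.
have geo_ex' y z : mdist q y < r -> mdist q z < r ->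
    exists g : geo X, geo_start g = y /\ geo_end g = z.
  by move=> /ltW qy /ltW qz; exact: geo_ex.
have dist_q (a : R) : 0 <= a <= l -> mdist q (gam a) = a by exact: (dist_gam l0 ul gam0).
have branch z (a : R) : ~ on_curve l gam z -> mdist q z < r -> 0 <= a < r ->
    mdist (gam a) z = mdist q z + a.
  move=> nz zr /andP[a0 ar].
  by apply: (branch_dist l0 ul gam0 gam_int geo_ex') => //; lra.
have r80 : 0 < r / 8 by rewrite divr_gt0.
have [w1 [w2 [w12 eqw /andP[w0 wr] nw1 nw2]]] := fork (r / 8) r80.
pose om := mdist q w1.
have [d1 d10 off1] := off_curve_open l0 ul gam0 nw1.
have [d2 d20 off2] := off_curve_open l0 ul gam0 nw2.
have s_itv : 0 < r / 8 < l by apply/andP; split; lra.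
have [d3 d30 on3] := gam_open ul gam_int s_itv.
have d120 : 0 < mdist w1 w2 by rewrite mdist_gt0.
(* In turn: the balls around [w1] and [w2] miss the curve, the ball around [gam (r / 8)] consists of
   curve points, the first two balls are disjoint, and all of them stay well inside the ball of
   radius [r]. *)
pose d := Num.min (Num.min (d1 / 2) (d2 / 2)) (Num.min (d3 / 2) (Num.min (mdist w1 w2 / 3) (r / 16))).
have d0 : 0 < d by rewrite !lt_min !divr_gt0.
have [dd1 dd2 dd3] : [/\ d <= d1 / 2, d <= d2 / 2 & d <= d3 / 2].
  by split; rewrite /d !ge_min lexx ?orbT.
have [dd4 dd5] : d <= mdist w1 w2 / 3 /\ d <= r / 16.
  by split; rewrite /d !ge_min lexx ?orbT.
move: d d0 dd1 dd2 dd3 dd4 dd5 => d d0 dd1 dd2 dd3 dd4 dd5.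
pose w (b : bool) := if b then w1 else w2.
have qw b : mdist q (w b) = om by case: b.
pose W b := [set z | mdist (w b) z <= d].
have offW b z : W b z -> ~ on_curve l gam z.
  by case: b; rewrite /W /= => wz; [apply: off1|apply: off2]; clear -wz dd1 dd2 d0 r0; lra.
have qW b z : W b z -> mdist q z < r / 4.
  move=> wz; have := metric_triangle q (w b) z; rewrite qw /om; move: wz; rewrite /W /=; clear -wr dd5 r0; lra.
(* Order along the ray from [q]: the piece [W0] around parameter [r / 8], the targets [o v] from
   [3 * r / 8] on, and [e] at the far end, so that contraction moves both [W] and [W0] towards
   [e]. *)
pose e := gam (r / 2).
have r2l : 0 <= r / 2 <= l by clear -r0 rl; apply/andP; split; lra.
have EW b z : W b z -> mdist e z = mdist q z + r / 2.
  move=> wz; apply: branch; [exact: offW wz|have := qW b z wz; clear -r0; lra|clear -r0; apply/andP; split; lra].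
(* All heights involved, plus [d], are at most [r], so [lam * r = d / 2] meets the last hypothesis
   of [contracting_level_charging]. *)
pose lam : R := d / (2 * r).
have lamr : lam * r = d / 2 by rewrite /lam; field; rewrite gt_eqF.
have lam0 : 0 < lam by rewrite divr_gt0 ?mulr_gt0.
have lam1 : lam <= 1 / 32.
  by rewrite /lam ler_pdivrMr ?mulr_gt0//; clear -dd5 r0; lra.
have lam01 : 0 < lam < 1 by rewrite lam0; clear -lam1 r0; lra.
pose v1 := r / 8.
pose o v := gam (r / 2 - v).
have oP v : 0 <= v <= v1 -> mdist q (o v) < r /\ mdist e (o v) <= v.
  move=> /andP[va vb]; rewrite /v1 in vb.
  have vl : 0 <= r / 2 - v <= l by clear -va vb r0 rl; apply/andP; split; lra.
  by rewrite /o dist_q// /e ul//; split; [clear -va r0; lra|rewrite opprB addrCA subrr addr0 ger0_norm].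
pose W0 := [set z | mdist (gam (r / 8)) z <= d].
have W0P z : W0 z -> exists b, [/\ z = gam b, r / 16 <= b & b <= 3 * r / 16].
  move=> wz; have [|b /andP[b0 bl] zb] := on3 z; first by move: wz; rewrite /W0 /=; clear -dd3 d0 r0; lra.
  exists b; have : `|r / 8 - b| <= d.
    rewrite -ul; [by rewrite -zb|by clear -r0 rl; apply/andP; split; lra|by apply/andP; split; exact: ltW].
  by rewrite ler_norml => /andP[h1 h2]; split => //; clear -h1 h2 dd5 r0; lra.
have EW0 b : 0 <= b <= r / 2 -> mdist e (gam b) = r / 2 - b.
  by move=> /andP[ba bb]; rewrite /e ul//; [rewrite ger0_norm// subr_ge0|clear -ba bb r0 rl; apply/andP; split; lra].
(* The centres of [W] and [W0] have heights [om + r / 2] and [3 * r / 8]. As both are contracted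
   with the same [lam] and [v1], the charged intervals differ exactly by [1 - lam] times the
   difference. *)
pose c : R := (1 - lam) * (om + r / 8).
have omr : om < r / 8 by [].
have om0 : 0 < om by [].
have c0 : 0 < c by rewrite /c mulr_gt0//; clear -lam1 om0 r0; lra.
pose u0 : R := (1 - lam) * (om + r / 2) + lam * (v1 / 4).
pose u1 : R := (1 - lam) * (om + r / 2) + lam * (3 * v1 / 4).
have lamv : 0 < lam * v1 by rewrite mulr_gt0.
have u01 : u0 < u1 by rewrite /u0 /u1; clear -lamv r0; lra.
have e0 : mdist e (gam (r / 8)) = 3 * r / 8.
  by rewrite EW0; clear -r0; [lra|apply/andP; split; lra].
have ew b : mdist e (w b) = om + r / 2.
  by rewrite (EW b)// ?qw// /W /= mdistxx ltW.
have chargeW b : level_charging m (W b) (mdist e) `[u0, u1]%classic.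
  have := @contracting_level_charging R X m q e (w b) r d v1 lam o spt good con d0 r80.
  rewrite ew; apply => //.
  - by rewrite qw; clear -omr dd5 r0; lra.
  - move=> v z /andP[va vb] wz; rewrite /v1 in vb.
    have h1 : mdist q z < r by have := qW b z wz; clear -r0; lra.
    have h2 : 0 <= r / 2 - v < r by clear -va vb r0; apply/andP; split; lra.
    by rewrite (EW b z wz) metric_sym (branch _ _ (offW b z wz) h1 h2) addrA.
  - have : lam * (om + r / 2 + d) <= lam * r by rewrite ler_wpM2l ?(ltW lam0)//; clear -omr dd5 r0; lra.
    by rewrite lamr.
have q0 : u0 - c = (1 - lam) * mdist e (gam (r / 8)) + lam * (v1 / 4).
  by rewrite e0 /u0 /c; field.
have q1 : u1 - c = (1 - lam) * mdist e (gam (r / 8)) + lam * (3 * v1 / 4).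
  by rewrite e0 /u1 /c; field.
have charge0 : level_charging m W0 (mdist e) `[u0 - c, u1 - c]%classic.
  rewrite q0 q1; apply: (@contracting_level_charging R X m q e _ r d v1 lam o) => //.
  - by rewrite dist_q; clear -r0 rl dd5; [lra|apply/andP; split; lra].
  - move=> v z /andP[va vb] /W0P[b [-> b1 b2]]; rewrite /v1 in vb.
    rewrite EW0; last by clear -b1 b2 r0; apply/andP; split; lra.
    by rewrite ul; clear -b1 b2 va vb r0 rl; [rewrite distrC ger0_norm; lra|apply/andP; split; lra|apply/andP; split; lra].
  - have : lam * (mdist e (gam (r / 8)) + d) <= lam * r.
      by rewrite e0 ler_wpM2l ?(ltW lam0)//; clear -dd5 r0; lra.
    by rewrite lamr.
have Q0r u : (`[u0 - c, u1 - c]%classic : set R) u -> r / 4 <= u <= 3 * r / 8.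
  rewrite q0 q1 /= in_itv /= e0 => /andP[h1 h2].
  have : lam * r <= 1 / 32 * r by rewrite ler_wpM2r// ltW.
  have : 0 < lam * r by rewrite mulr_gt0.
  by move: h1 h2; rewrite /v1 => h1 h2 h3 h4; clear -h1 h2 h3 h4 r0; apply/andP; split; lra.
pose yc u := gam (clamp r u).
have clamp_l u : 0 <= clamp r u <= l.
  by have /andP[h1 h2] := clamp_itv r0 u; clear -h1 h2 r0 rl; apply/andP; split; lra.
apply: (@no_fork R X m q e r c u0 u1 W W0 yc) => //.
- by move=> b; exact: closed_mdist_le.
- by move=> b z /qW /=; clear -r0; lra.
- apply/seteqP; split => // z [/= h1 h2].
  by have := metric_triangle w1 z w2; rewrite (metric_sym z); move: h1 h2; rewrite /W /=; clear -dd4 d120 r0; lra.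
- by move=> u v; rewrite ul// clamp_lip.
- by move=> u; rewrite dist_q//; have /andP[h1 h2] := clamp_itv r0 u; clear -h1 h2 r0; lra.
- move=> u /Q0r/andP[h1 h2]; rewrite /yc clamp_id; last by clear -h1 h2 r0; apply/andP; split; lra.
  by rewrite EW0; clear -h1 h2 r0; [lra|apply/andP; split; lra].
- move=> z /W0P[b [-> b1 b2]] _; rewrite EW0; last by clear -b1 b2 r0; apply/andP; split; lra.
  by rewrite /yc clamp_id; clear -b1 b2 r0; [congr gam; lra|apply/andP; split; lra].
- by apply: borel_closed; exact: closed_mdist_le.
- move=> b z u wz /Q0r/andP[h1 h2]; rewrite /yc clamp_id; last by clear -h1 h2 r0; apply/andP; split; lra.
  have h3 : mdist q z < r by have := qW b z wz; clear -r0; lra.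
  have h4 : 0 <= r / 2 - u < r by clear -h1 h2 r0; apply/andP; split; lra.
  by rewrite (EW b z wz) (branch _ _ (offW b z wz) h3 h4) addrA.
- move=> u /Q0r/andP[h1 h2].
  have uc : clamp r u = r / 2 - u by apply: clamp_id => //; clear -h1 h2 r0; apply/andP; split; lra.
  have c4 : c <= om + r / 8.
    by rewrite /c ler_piMl//; clear -lam0 om0 r0; lra.
  have [||| t [t01 tP]] := @branch_initial R X q l r gam l0 ul gam0 gam_int r0 rl geo_ex' (r / 2 - u) c.
  + by clear -h2 r0; lra.
  + by [].
  + by clear -h1 c4 omr r0; lra.
  exists t; split => // g1 g2 sg1 sg2 eg1 eg2 l1 l2 s st.
  rewrite /yc uc in sg1 sg2.
  rewrite (tP g1) ?(tP g2)//.
  * exact: offW eg2.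
  * by have := qW _ _ eg2; clear -r0; lra.
  * exact: offW eg1.
  * by have := qW _ _ eg1; clear -r0; lra.
- by move=> mu0 mu1; exact: (plan_non_branching hX hc good).
Qed.

Theorem corollary3p2 (R : realType) (X : pmetricType R)
    (m : {measure set (borel X) -> \bar R})
    (hX : metric_measure_space m)
    (hcurv :
      [\/ exists K N : R, 1 < N /\ very_strict_CD m K N,
          exists K N : R, [/\ 1 < N, essentially_non_branching m & MCP m K N]
        | essentially_non_branching m /\ qualitatively_non_degenerate m])
    (hball : exists (x : X) (r : R),
      0 < r /\ isometric_to_open_interval (ball x r)) :
  one_manifold_with_boundary R X.
Proof.
have [[_ lcX [D cD dD] lX] _ _] := hX.
apply: (one_manifold_of_charts cD dD); apply: (all_points_chart lX lcX (ray_core hX hcurv)).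
have [x [r [r0 iso]]] := hball.
by exists x; exact: isometric_interior_point r0 iso.
Qed.
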